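(* Let $\Omega\subseteq\mathbb{R}^n$ be a bounded open set with Lipschitz boundary. Let $u:\mathbb{R}^n\to\mathbb{R}$ be a measurable function such that $u|_\Omega\in L^\infty(\Omega)$ and take $M>0$ with $M\ge\|u\|_{L^\infty(\Omega)}$. Then $$u|_\Omega\in W^{s,1}(\Omega)\quad\text{if and only if}\quad\mathrm{Per}_s(\mathcal{S}_u,\Omega^M)<\infty.$$ In particular, it holds $$\mathrm{Per}_s(\mathcal{S}_u,\Omega^M)=\mathcal{F}^M_s(u,\Omega)+\kappa_{\Omega,M},$$ where $\kappa_{\Omega,M}$ is the (positive) constant $$\kappa_{\Omega,M}:=\mathrm{Per}_s^L\big(\{X_{n+1}<0\},\Omega^\infty\big)-\mathrm{Per}_s^L\big(\{X_{n+1}<0\},\Omega^\infty\setminus\Omega^M\big).$$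
   Context: $n\ge1$ is an integer, $s\in(0,1)$. Points of $\mathbb{R}^{n+1}$ are written $X=(x,X_{n+1})$. $\Omega^M:=\Omega\times(-M,M)$ for $M>0$, $\Omega^\infty:=\Omega\times\mathbb{R}$, $\mathcal{S}_u:=\{(x,t)\in\mathbb{R}^n\times\mathbb{R}: t<u(x)\}$. $W^{s,1}(\Omega)$ is the space of $u\in L^1(\Omega)$ with $\int_\Omega\int_\Omega\frac{|u(x)-u(y)|}{|x-y|^{n+s}}\,dx\,dy<\infty$. For measurable disjoint $A,B\subseteq\mathbb{R}^{n+1}$, $\mathcal{L}_s(A,B):=\int_A\int_B\frac{dX\,dY}{|X-Y|^{n+1+s}}$; with $\mathcal{C}E:=\mathbb{R}^{n+1}\setminus E$, $$\mathrm{Per}_s^L(E,O):=\mathcal{L}_s(E\cap O,\mathcal{C}E\cap O),$$ $$\mathrm{Per}_s(E,O):=\mathrm{Per}_s^L(E,O)+\mathcal{L}_s(E\cap O,\mathcal{C}E\setminus O)+\mathcal{L}_s(E\setminus O,\mathcal{C}E\cap O).$$ Let $g_s(t):=(1+t^2)^{-\frac{n+1+s}{2}}$, $\mathcal{G}_s(t):=\int_0^t\int_0^\tau g_s(\sigma)\,d\sigma\,d\tau$, $\overline{G}_s(t):=\int_{-\infty}^tg_s(\tau)\,d\tau$, and $\mathcal{F}^M_s(u,\Omega):=\mathcal{A}_s(u,\Omega)+\mathcal{N}^M_s(u,\Omega)$ with $$\mathcal{A}_s(u,\Omega):=\int_\Omega\int_\Omega\mathcal{G}_s\left(\frac{u(x)-u(y)}{|x-y|}\right)\frac{dx\,dy}{|x-y|^{n-1+s}},$$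 $$\mathcal{N}^M_s(u,\Omega):=\int_\Omega\left\{\int_{\mathbb{R}^n\setminus\Omega}\left(\int_{\frac{-M-u(y)}{|x-y|}}^{\frac{u(x)-u(y)}{|x-y|}}\overline{G}_s(t)\,dt+\int_{\frac{u(x)-u(y)}{|x-y|}}^{\frac{M-u(y)}{|x-y|}}\overline{G}_s(-t)\,dt\right)\frac{dy}{|x-y|^{n-1+s}}\right\}dx.$$ These quantities take values in $[0,+\infty]$ under the hypotheses of the statement, and the identity is understood in $[0,+\infty]$. *)

(* Defs.v *)
From HB Require Import structures.
From mathcomp Require Import all_boot all_order all_algebra.
From mathcomp Require Import all_classical all_reals all_analysis.
Import Order.TTheory GRing.Theory Num.Theory.
Import numFieldNormedType.Exports.

Set Implicit Arguments.
Unset Strict Implicit.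
Unset Printing Implicit Defensive.

Local Open Scope classical_set_scope.
Local Open Scope ring_scope.

Section LebesgueRn.
Variable R : realType.

Definition coord n (i : 'I_n) (x : 'rV[R]_n) : measurableTypeR R := x ord0 i.

Definition cylinders n : set (set 'rV[R]_n) :=
  \big[setU/set0]_(i < n) preimage_set_system setT (@coord n i) measurable.

(* 'rV[R]_n with the sigma-algebra generated by the coordinates, that is, the
   Borel sigma-algebra. *)
Definition borelRn n := g_sigma_algebraType (@cylinders n).

Definition consRn n (p : borelRn n * measurableTypeR R) : borelRn n.+1 :=
  row_mx (p.2%:M : 'rV_1) (p.1 : 'rV_n).

Lemma measurable_coord n (i : 'I_n) :
  measurable_fun [set: borelRn n] (@coord n i).
Proof.
move=> _ Y mY; rewrite setTI; apply: sub_sigma_algebra; rewrite /cylinders.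
rewrite -bigcup_seq/=; exists i => /=; first by rewrite mem_index_enum.
by exists Y => //; rewrite setTI.
Qed.

Lemma measurable_consRn n : measurable_fun [set: _] (@consRn n).
Proof.
apply: (@measurability _ _ _ (borelRn n.+1) _ _ (@cylinders n.+1)) => //.
move=> _ [B + <-]; rewrite /cylinders.
rewrite -bigcup_seq => -[i _] [Y mY <-]; rewrite !setTI.
have mi : measurable_fun [set: _] (@coord n.+1 i \o @consRn n).
  have [j|j] := @split_ordP 1 n i; move=> ->{i}.
    rewrite (_ : _ \o _ = snd); first exact: measurable_snd.
    apply/funext => p /=; rewrite /coord /consRn (row_mxEl (p.2%:M : 'rV_1)).
    by rewrite !mxE !ord1 eqxx.
  rewrite (_ : _ \o _ = @coord n j \o fst).
    exact: (measurableT_comp (measurable_coord j) measurable_fst).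
  by apply/funext => p /=; rewrite /coord /consRn (row_mxEr (p.2%:M : 'rV_1)).
by have := mi measurableT _ mY; rewrite setTI.
Qed.

Section consRn_measure.
Variables (n : nat) (mu : {measure set (borelRn n) -> \bar R}).

Definition consRn_measure : set (borelRn n.+1) -> \bar R :=
  pushforward (mu \x (@lebesgue_measure R))%E (@consRn n).

Let consRn_measure0 : consRn_measure set0 = 0%E.
Proof. by rewrite /consRn_measure /pushforward preimage_set0 measure0. Qed.

Let consRn_measure_ge0 A : (0 <= consRn_measure A)%E.
Proof. by rewrite /consRn_measure /pushforward; exact: measure_ge0. Qed.

Let consRn_measure_sigma_additive : semi_sigma_additive consRn_measure.
Proof.
move=> F mF tF mUF; rewrite /consRn_measure /pushforward preimage_bigcup.
have mpre A : measurable A -> measurable (@consRn n @^-1` A).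
  by move=> mA; rewrite -[X in measurable X]setTI; exact: measurable_consRn.
apply: measure_semi_sigma_additive.
- by move=> k; exact: mpre.
- apply/trivIsetP => /= i j _ _ ij; rewrite -preimage_setI.
  by move/trivIsetP : tF => /(_ _ _ _ _ ij) ->//; rewrite preimage_set0.
- by rewrite -preimage_bigcup; exact: mpre.
Qed.

HB.instance Definition _ := isMeasure.Build _ _ _ consRn_measure
  consRn_measure0 consRn_measure_ge0 consRn_measure_sigma_additive.

End consRn_measure.

Fixpoint borel_lebesgueRn n : {measure set (borelRn n) -> \bar R} :=
  match n with
  | 0 => @dirac _ (borelRn 0) (0 : 'rV[R]_0) R
  | n'.+1 => consRn_measure (borel_lebesgueRn n')
  end.

(* 'rV[R]_n with the Lebesgue-measurable sets: the Caratheodory completion of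
   [borel_lebesgueRn n], as for [completed_lebesgue_measure] on R. *)
Definition Rn n := caratheodory_type (mu_ext (borel_lebesgueRn n)).

Definition lebesgueRn n : {measure set (Rn n) -> \bar R} :=
  @completed_measure_extension _ _ R (borel_lebesgueRn n).

End LebesgueRn.

Section FractionalPerimeter.
Variables (R : realType) (n : nat).
Implicit Types (s M : R) (Omega : set 'rV[R]_n) (u : 'rV[R]_n -> R).

Definition dotp (x y : 'rV[R]_n) : R := \sum_i x ord0 i * y ord0 i.

(* The library norm on 'rV[R]_n is the sup norm. *)
Definition enorm (x : 'rV[R]_n) : R := Num.sqrt (dotp x x).

(* Near every boundary point p, Omega lies strictly below the graph of a
   Lipschitz function phi on the hyperplane orthogonal to a unit vector e. *)
Definition lipschitz_boundary Omega : Prop :=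
  forall p, (closure Omega `\` interior Omega) p ->
  exists (e : 'rV[R]_n) (r L : R) (phi : 'rV[R]_n -> R),
    [/\ enorm e = 1, 0 < r,
      forall x y, dotp x e = 0 -> dotp y e = 0 ->
        `|phi x - phi y| <= L * enorm (x - y) &
      forall x, enorm (x - p) < r ->
        (Omega x <-> dotp x e < phi (x - dotp x e *: e))].

Definition Linfty_norm Omega u : \bar R :=
  ('N[lebesgueRn R n]_+oo[(EFin \o u) \_ Omega])%E.

Definition Linfty Omega u : Prop :=
  measurable_fun (Omega : set (Rn R n)) u /\ (Linfty_norm Omega u < +oo)%E.

Definition Ws1 s Omega u : Prop :=
  (lebesgueRn R n).-integrable Omega (EFin \o u) /\
  (\int[lebesgueRn R n]_(x in Omega) \int[lebesgueRn R n]_(y in Omega)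
     (`|u x - u y| / enorm ((x : 'rV[R]_n) - y) `^ (n%:R + s))%:E < +oo)%E.

(* R^(n+1) is represented as R^n * R. *)
Definition Rn1 := (Rn R n * measurableTypeR R)%type.

Definition lebesgueRn1 : {measure set Rn1 -> \bar R} :=
  (lebesgueRn R n \x (@lebesgue_measure R))%E.

Definition dist1 (X Y : Rn1) : R :=
  Num.sqrt (enorm ((X.1 : 'rV[R]_n) - Y.1) ^+ 2 + (X.2 - Y.2) ^+ 2).

Definition interaction s (A B : set Rn1) : \bar R :=
  (\int[lebesgueRn1]_(X in A) \int[lebesgueRn1]_(Y in B)
     ((dist1 X Y `^ (n%:R + 1 + s))^-1)%:E)%E.

Definition PerL s (E O : set Rn1) : \bar R :=
  interaction s (E `&` O) (~` E `&` O).

Definition Per s (E O : set Rn1) : \bar R :=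
  (PerL s E O + interaction s (E `&` O) (~` E `\` O)
   + interaction s (E `\` O) (~` E `&` O))%E.

Definition cylinder_inf Omega : set Rn1 := Omega `*` setT.

Definition cylinder Omega M : set Rn1 := Omega `*` [set t | - M < t < M].

Definition subgraph u : set Rn1 := [set X | X.2 < u X.1].

Definition lower_halfspace : set Rn1 := [set X | X.2 < 0].

(* The integral of f from a to b, with the usual sign when b < a *)
Definition oint (a b : R) (f : R -> R) : R :=
  if a <= b then \int[@lebesgue_measure R]_(t in `[a, b]) f t
  else - \int[@lebesgue_measure R]_(t in `[b, a]) f t.

Definition g_s s (t : R) : R := (1 + t ^+ 2) `^ (- ((n%:R + 1 + s) / 2)).

Definition calG_s s (t : R) : R :=
  oint 0 t (fun tau => oint 0 tau (g_s s)).

Definition barG_s s (t : R) : R :=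
  \int[@lebesgue_measure R]_(tau in `]-oo, t]) g_s s tau.

Definition A_s s Omega u : \bar R :=
  (\int[lebesgueRn R n]_(x in Omega) \int[lebesgueRn R n]_(y in Omega)
     (let r := enorm ((x : 'rV[R]_n) - y) in
      calG_s s ((u x - u y) / r) / r `^ (n%:R - 1 + s))%:E)%E.

Definition N_s s M Omega u : \bar R :=
  (\int[lebesgueRn R n]_(x in Omega) \int[lebesgueRn R n]_(y in ~` Omega)
     (let r := enorm ((x : 'rV[R]_n) - y) in
      (oint ((- M - u y) / r) ((u x - u y) / r) (barG_s s)
       + oint ((u x - u y) / r) ((M - u y) / r) (fun t => barG_s s (- t)))
      / r `^ (n%:R - 1 + s))%:E)%E.

Definition F_s s M Omega u : \bar R := (A_s s Omega u + N_s s M Omega u)%E.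

Definition kappa s Omega M : \bar R :=
  (PerL s lower_halfspace (cylinder_inf Omega)
   - PerL s lower_halfspace (cylinder_inf Omega `\` cylinder Omega M))%E.

End FractionalPerimeter.

(* Main.v *)
(* By Tonelli, an interaction in R^(n+1) is an integral over pairs (x, y) of an
   interaction between subsets of the vertical lines over x and y; for two
   half-lines the latter is |x - y|^-(n - 1 + s) times the primitive Phi of
   barG_s at (u x - u y) / |x - y|. Adding to Per_s(S_u, Omega^M) the local
   perimeter of {X_(n+1) < 0} in Omega^oo \ Omega^M completes the truncated
   sections over Omega to half-lines, so that no infinite quantity is ever
   subtracted. On Omega x Omega, symmetrization in (x, y) and the identity
   Phi(w) + Phi(-w) = 2 Phi(0) + 2 calG_s(w) produce the area functional plus the
   half-space term; the pairs in Omega x C Omega produce the nonlocal one.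
   The half-space term is finite because |x - y|^-(n - 1 + s) is integrable on
   Omega x Omega, and N_s because |x - y|^-(n + s) is integrable on
   Omega x C Omega: a translation by h moves only a set of measure O(|h|) out of
   a bounded Lipschitz domain. The equivalence then follows from the linear
   growth of calG_s. *)
Require Import Defs.
From HB Require Import structures.
From mathcomp Require Import all_boot all_order all_algebra.
From mathcomp Require Import all_classical all_reals all_analysis.
From mathcomp Require Import measurable_realfun ess_sup_inf ring lra.
Import Order.TTheory GRing.Theory Num.Theory.
Import numFieldNormedType.Exports.

Set Implicit Arguments.
Unset Strict Implicit.
Unset Printing Implicit Defensive.

Local Open Scope classical_set_scope.
Local Open Scope ring_scope.

(** * Lebesgue measure on R^n *)

(** Symmetrization on Omega x Omega is forced: [Phi_s w] differs from [Phi_s 0] plus [calG_s w] by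
    an odd term, linear in w. Against |x - y|^-(n - 1 + s) that term need not be absolutely
    integrable, and it disappears only between (x, y) and (y, x). Singular kernels are treated
    without polar coordinates. |x - y|^-a is dominated by the product of the |x_i - y_i|^-(a/n), so
    a < n becomes a/n < 1 in each coordinate and no range of exponents is lost; away from the
    diagonal n + s becomes 1 + s/n > 1 in each coordinate. Both exponents n - 1 + s come under the
    first case because s < 1. Layers of a Lipschitz domain are measured by sliding them along the
    axis e of the local graph. This takes translation invariance and Tonelli only, never a rotation
    that would make the graph vertical. Since u is only Lebesgue measurable, pairs of points live on
    completed spaces, while products and translations come from the recursive Borel construction.
    The two are reconciled by keeping the translated sets Borel, which is possible because Omega is
    open. *)

Section BorelRn.
Variable R : realType.
Local Notation lam := (@lebesgue_measure R).

Lemma measurable_fun_borelRn d (T : measurableType d) n (D : set T)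
    (f : T -> borelRn R n) :
  (forall i, measurable_fun D (fun x => f x ord0 i : measurableTypeR R)) ->
  measurable_fun D f.
Proof.
move=> mf mD; move: (mD); rewrite -/(measurable_fun D f).
apply: (@measurability _ _ _ (borelRn R n) _ _ (@cylinders R n)) => //.
move=> _ [B + <-]; rewrite /cylinders -bigcup_seq => -[i _] [Y mY <-].
by rewrite setTI; exact: (mf i mD Y mY).
Qed.

(** The measure on R^(n+1) is a pushforward by [consRn], so a cover is needed whose preimages are
    rectangles. The maps [tl] and [hd] invert [consRn] and pull such rectangles back. *)
Lemma sigma_finite_borel_lebesgueRn n :
  sigma_finite [set: borelRn R n] (borel_lebesgueRn R n).
Proof.
elim: n => [|n [F UF mF]].
  exists (fun=> setT); first by rewrite bigcup_const.
  by move=> i; split => //=; rewrite /dirac/= indicT/= ltry.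
pose tl (x : borelRn R n.+1) : borelRn R n := \row_j (x : 'rV[R]_n.+1) ord0 (lift ord0 j).
have mtl : measurable_fun setT tl.
  apply: measurable_fun_borelRn => j; rewrite [X in measurable_fun _ X](_ : _ = @Defs.coord R n.+1 (lift ord0 j)); last by apply/funext => x; rewrite /tl mxE.
  exact: measurable_coord.
have tlE p : tl (@consRn R n p) = p.1.
  apply/rowP => j; rewrite mxE (_ : lift ord0 j = rshift 1 j); last exact/val_inj.
  by rewrite /consRn (row_mxEr (p.2%:M : 'rV_1)).
pose hd (x : borelRn R n.+1) : measurableTypeR R := (x : 'rV[R]_n.+1) ord0 ord0.
have mhd : measurable_fun setT hd by exact: measurable_coord.
have hdE p : hd (@consRn R n p) = p.2.
  rewrite /hd (_ : @ord0 n = @lshift 1 n ord0); last exact/val_inj.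
  by rewrite /consRn (row_mxEl (p.2%:M : 'rV_1)) !mxE eqxx.
have [G UG mG] := @sigma_finiteT _ _ R lam.
(* Partial unions allow a single index: a point with tail in F i and head in G j lies in the k-th
   set for k = max(i, j) + 1, whereas the sets F k x G k need not cover. *)
exists (fun k => tl @^-1` (\big[setU/set0]_(i < k) F i) `&` hd @^-1` (\big[setU/set0]_(i < k) G i)).
  apply/esym; rewrite -subTset => x _.
  have : (\bigcup_i F i) (tl x) by rewrite -UF.
  move=> [i _ Fi].
  have : (\bigcup_i G i) (hd x) by rewrite -UG.
  move=> [j _ Gj].
  exists (maxn i j).+1 => //; split => /=; rewrite -bigcup_mkord.
    by exists i => //=; rewrite ltnS leq_maxl.
  by exists j => //=; rewrite ltnS leq_maxr.
move=> k.
have mU : measurable (\big[setU/set0]_(i < k) F i).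
  by apply: bigsetU_measurable => i _; exact: (mF i).1.
have mV : measurable (\big[setU/set0]_(i < k) G i).
  by apply: bigsetU_measurable => i _; exact: (mG i).1.
split.
  apply: measurableI; rewrite -[X in measurable X]setTI.
    exact: mtl.
  exact: mhd.
rewrite /= /consRn_measure /pushforward.
rewrite [X in product_measure1 _ _ X](_ : _ = (\big[setU/set0]_(i < k) F i) `*` (\big[setU/set0]_(i < k) G i)); last first.
  by apply/seteqP; split => -[p t] /=; rewrite tlE hdE.
rewrite product_measure1E//.
rewrite lte_mul_pinfty //.
- rewrite ge0_fin_numE//.
  apply: (@le_lt_trans _ _ (\sum_(i < k) borel_lebesgueRn R n (F i))%E).
    apply: (@content_subadditive _ _ _ (borel_lebesgueRn R n) _ F) => // i _.
    exact: (mF i).1.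
  by apply/lte_sum_pinfty => i _; exact: (mF i).2.
- apply: (@le_lt_trans _ _ (\sum_(i < k) lam (G i))%E).
    apply: (@content_subadditive _ _ _ lam _ G) => // i _.
    exact: (mG i).1.
  by apply/lte_sum_pinfty => i _; exact: (mG i).2.
Qed.

End BorelRn.

Section measure_preserving.
Context d1 d2 (X : measurableType d1) (Y : measurableType d2) (R : realType).
Variables (phi : X -> Y) (mphi : measurable_fun setT phi).
Variables (mu : {measure set X -> \bar R}) (nu : {measure set Y -> \bar R}).

Lemma ge0_integral_measure_preserving (f : Y -> \bar R) :
  (forall A, measurable A -> mu (phi @^-1` A) = nu A) ->
  measurable_fun setT f -> (forall y, 0 <= f y)%E ->
  (\int[nu]_y f y = \int[mu]_x f (phi x))%E.
Proof.
move=> munu mf f0; transitivity (\int[pushforward mu phi]_y f y)%E.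
  by apply: eq_measure_integral => A mA _; rewrite -munu.
by rewrite ge0_integral_pushforward// preimage_setT.
Qed.

End measure_preserving.

Section RnMeasure.
Variable R : realType.
Local Notation lam := (@lebesgue_measure R).

(* Copies of the two Lebesgue measures that carry a sigma-finite structure. *)
Definition bleb n : set (borelRn R n) -> \bar R := borel_lebesgueRn R n.
HB.instance Definition _ n := isMeasure.Build _ _ _ (@bleb n)
  (measure0 (borel_lebesgueRn R n)) (measure_ge0 (borel_lebesgueRn R n))
  (@measure_semi_sigma_additive _ _ _ (borel_lebesgueRn R n)).
HB.instance Definition _ n := Measure_isSigmaFinite.Build _ _ _ (@bleb n)
  (@sigma_finite_borel_lebesgueRn R n).

Definition leb n : set (Rn R n) -> \bar R := lebesgueRn R n.
HB.instance Definition _ n := isMeasure.Build _ _ _ (@leb n)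
  (measure0 (lebesgueRn R n)) (measure_ge0 (lebesgueRn R n))
  (@measure_semi_sigma_additive _ _ _ (lebesgueRn R n)).
HB.instance Definition _ n := Measure_isSigmaFinite.Build _ _ _ (@leb n)
  (completed_measure_extension_sigma_finite (@sigma_finite_borel_lebesgueRn R n)).

Lemma measurable_borelRn_Rn n (A : set (borelRn R n)) :
  measurable A -> measurable (A : set (Rn R n)).
Proof. by move=> mA; apply: sub_caratheodory; exact: sub_sigma_algebra. Qed.

Lemma measurable_fun_id_Rn n : measurable_fun [set: Rn R n] (id : Rn R n -> borelRn R n).
Proof. by move=> _ A mA; rewrite setTI; exact: measurable_borelRn_Rn. Qed.

Lemma leb_bleb n (A : set (borelRn R n)) : measurable A -> leb A = bleb A.
Proof. by move=> mA; exact: measurable_mu_extE. Qed.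

(** The identity from the completed space to the Borel space is measure preserving. Borel integrands
    thus inherit everything provable by recursion on the dimension. *)
Lemma integral_leb_bleb n (F : borelRn R n -> \bar R) :
  measurable_fun [set: borelRn R n] F -> (forall x, 0 <= F x)%E ->
  (\int[@leb n]_x F x = \int[@bleb n]_x F x)%E.
Proof.
move=> mF F0.
apply/esym/(ge0_integral_measure_preserving (@measurable_fun_id_Rn n)) => //.
by move=> A mA; exact: leb_bleb.
Qed.

Lemma measurable_fun_Rn_borel d (Y : measurableType d) n (F : borelRn R n -> Y) :
  measurable_fun [set: borelRn R n] F -> measurable_fun [set: Rn R n] (F : Rn R n -> Y).
Proof. by move=> mF; apply: (measurableT_comp mF); exact: measurable_fun_id_Rn. Qed.

Lemma integral_bleb_cons n (F : borelRn R n.+1 -> \bar R) :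
  measurable_fun [set: borelRn R n.+1] F -> (forall x, 0 <= F x)%E ->
  (\int[@bleb n.+1]_x F x = \int[@bleb n]_x \int[lam]_t F (consRn (x, t)))%E.
Proof.
move=> mF F0.
rewrite (ge0_integral_measure_preserving (mu := (@bleb n \x lam)%E) (@measurable_consRn R n))//.
rewrite fubini_tonelli1//.
by apply: measurableT_comp => //; exact: measurable_consRn.
Qed.

Lemma consRn0 n p : (@consRn R n p : 'rV[R]_n.+1) ord0 ord0 = p.2.
Proof.
rewrite (_ : @ord0 n = @lshift 1 n ord0); last exact/val_inj.
by rewrite /consRn (row_mxEl (p.2%:M : 'rV_1)) !mxE eqxx.
Qed.

Lemma consRnS n p j : (@consRn R n p : 'rV[R]_n.+1) ord0 (lift ord0 j) = (p.1 : 'rV[R]_n) ord0 j.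
Proof.
rewrite (_ : lift ord0 j = rshift 1 j); last exact/val_inj.
by rewrite /consRn (row_mxEr (p.2%:M : 'rV_1)).
Qed.

Lemma measurable_fun_prod_coord n (f : 'I_n -> R -> R) :
  (forall i, measurable_fun setT (f i)) ->
  measurable_fun [set: borelRn R n] (fun x : borelRn R n => \prod_(i < n) f i ((x : 'rV_n) ord0 i)).
Proof.
move=> mf; apply: measurable_prod => i _.
by apply: (measurableT_comp (mf i)); exact: measurable_coord.
Qed.

Lemma integral_bleb_prod n (f : 'I_n -> R -> R) :
  (forall i, measurable_fun setT (f i)) -> (forall i t, 0 <= f i t) ->
  (\int[@bleb n]_x (\prod_(i < n) f i ((x : 'rV_n) ord0 i))%:E
   = \prod_(i < n) \int[lam]_t (f i t)%:E)%E.
Proof.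
elim: n f => [|n IH] f mf f0.
  under eq_integral do rewrite big_ord0.
  by rewrite big_ord0 integral_cst// mul1e /= /bleb /= /dirac /= indicT.
rewrite integral_bleb_cons//; last 2 first.
- by apply/measurable_EFinP; exact: measurable_fun_prod_coord.
- by move=> x; rewrite lee_fin; apply: prodr_ge0.
rewrite big_ord_recl -(IH (fun i => f (lift ord0 i)))//.
rewrite -ge0_integralZl//; last 3 first.
- apply/measurable_EFinP.
  by apply: (@measurable_fun_prod_coord _ (fun i => f (lift ord0 i))).
- by move=> x _; rewrite lee_fin; apply: prodr_ge0.
- by apply: integral_ge0 => t _; rewrite lee_fin.
apply: eq_integral => x _.
rewrite muleC -ge0_integralZl//; last 3 first.
- by apply/measurable_EFinP; exact: mf.
- by move=> t _; rewrite lee_fin.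
- by rewrite lee_fin; apply: prodr_ge0.
apply: eq_integral => t _.
rewrite big_ord_recl consRn0 /= mulrC.
by under eq_bigr do rewrite consRnS.
Qed.

(** The source of every explicit volume and kernel bound over R^n: indicators of boxes and
    hyperplanes are products, and singular kernels are dominated by products. *)
Lemma integral_leb_prod n (f : 'I_n -> R -> R) :
  (forall i, measurable_fun setT (f i)) -> (forall i t, 0 <= f i t) ->
  (\int[@leb n]_x (\prod_(i < n) f i ((x : 'rV_n) ord0 i))%:E
   = \prod_(i < n) \int[lam]_t (f i t)%:E)%E.
Proof.
move=> mf f0; rewrite -integral_bleb_prod//.
apply: (@integral_leb_bleb n (fun x => (\prod_(i < n) f i ((x : 'rV_n) ord0 i))%:E)).
  by apply/measurable_EFinP; exact: measurable_fun_prod_coord.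
by move=> x; rewrite lee_fin; apply: prodr_ge0.
Qed.
End RnMeasure.

(** * Affine changes of variable on the line *)

Section affine.
Variable R : realType.
Local Notation lam := (@lebesgue_measure R).

(** Uniqueness of Lebesgue measure reduces the claim to intervals ]x, y]. For a < 0 the preimage is
    closed on the other side, which does not change its length. *)
Lemma lebesgue_measure_affine (a b : R) (A : set (measurableTypeR R)) : a != 0 -> measurable A ->
  (`|a|%:E * lam ((fun t => a * t + b)%R @^-1` A) = lam A)%E.
Proof.
move=> a0 mA.
pose phi : measurableTypeR R -> measurableTypeR R := fun t => a * t + b.
have mphi : measurable_fun setT phi.
  by apply: measurable_funD => //; exact: measurable_funM.
pose k : {nonneg R} := NngNum (normr_ge0 a).
have -> : (`|a|%:E * lam (phi @^-1` A))%E = pushforward (mscale k lam) phi A by [].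
apply/esym/lebesgue_measure_unique => // _ [[x y]] _ <-.
change (lam `]x, y]%classic = (`|a|%:E * lam (phi @^-1` `]x, y]%classic))%E).
have [ap|an] := ltP 0 a.
  have -> : phi @^-1` `]x, y]%classic = `](x - b) / a, (y - b) / a]%classic.
    apply/seteqP; split => t; rewrite /phi/= !in_itv/=.
      by rewrite ltr_pdivrMr// ler_pdivlMr// ltrBlDr lerBrDr mulrC.
    by rewrite ltr_pdivrMr// ler_pdivlMr// ltrBlDr lerBrDr mulrC.
  rewrite !lebesgue_measure_itv/= !lte_fin ltr_pM2r ?invr_gt0// ltrD2r.
  case: ifPn => xy; last by rewrite mule0.
  rewrite -!EFinB -EFinM gtr0_norm//; congr EFin.
  by field; rewrite gt_eqF.
have {an a0}an : a < 0 by rewrite lt_neqAle a0.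
have -> : phi @^-1` `]x, y]%classic = `[(y - b) / a, (x - b) / a[%classic.
  apply/seteqP; split => t; rewrite /phi/= !in_itv/=.
    by rewrite ltr_ndivlMr// ler_ndivrMr// ltrBlDr lerBrDr mulrC andbC.
  by rewrite ltr_ndivlMr// ler_ndivrMr// ltrBlDr lerBrDr mulrC andbC.
rewrite !lebesgue_measure_itv/= !lte_fin ltr_nM2r ?invr_lt0// ltrD2r.
case: ifPn => xy; last by rewrite mule0.
rewrite -!EFinB -EFinM ltr0_norm//; congr EFin.
by field; rewrite lt_eqF.
Qed.

Lemma ge0_integral_affine (a b : R) (f : R -> \bar R) : a != 0 ->
  measurable_fun setT f -> (forall t, 0 <= f t)%E ->
  (\int[lam]_t f t = `|a|%:E * \int[lam]_t f (a * t + b)%R)%E.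
Proof.
move=> a0 mf f0.
pose phi : measurableTypeR R -> measurableTypeR R := fun t => a * t + b.
have mphi : measurable_fun setT phi.
  by apply: measurable_funD => //; exact: measurable_funM.
pose k : {nonneg R} := NngNum (normr_ge0 a).
rewrite (ge0_integral_measure_preserving (mu := mscale k lam) mphi)//.
  by rewrite ge0_integral_mscale//; exact: measurableT_comp.
by move=> A mA; exact: lebesgue_measure_affine.
Qed.

Lemma ge0_integral_shift (b : R) (f : R -> \bar R) :
  measurable_fun setT f -> (forall t, 0 <= f t)%E ->
  (\int[lam]_t f (t + b)%R = \int[lam]_t f t)%E.
Proof.
move=> mf f0; rewrite [RHS](ge0_integral_affine (a := 1) b)// normr1 mul1e.
by apply: eq_integral => t _; rewrite mul1r.
Qed.

Lemma ge0_integral_reflect (b : R) (f : R -> \bar R) :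
  measurable_fun setT f -> (forall t, 0 <= f t)%E ->
  (\int[lam]_t f (b - t)%R = \int[lam]_t f t)%E.
Proof.
move=> mf f0; rewrite [RHS](ge0_integral_affine (a := -1) b)// ?oppr_eq0 ?oner_neq0//.
rewrite normrN1 mul1e.
by apply: eq_integral => t _; rewrite mulN1r addrC.
Qed.

End affine.

(** * Translation invariance on R^n *)

Section translation.
Variable R : realType.
Local Notation lam := (@lebesgue_measure R).

(** Induction on the dimension: the induction hypothesis translates the tail in the function
    obtained by integrating out the head, and the one-dimensional shift translates the head. *)
Lemma integral_bleb_shift n (v : 'rV[R]_n) (F : borelRn R n -> \bar R) :
  measurable_fun [set: borelRn R n] F -> (forall x, 0 <= F x)%E ->
  (\int[@bleb R n]_x F ((x : 'rV_n) + v)%R = \int[@bleb R n]_x F x)%E.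
Proof.
elim: n v F => [|n IH] v F mF F0.
  by apply: eq_integral => x _; congr F; apply/matrixP => i [].
have mshift (m : nat) (w : 'rV[R]_m) : measurable_fun [set: borelRn R m]
    (fun x : borelRn R m => ((x : 'rV_m) + w) : borelRn R m).
  apply: measurable_fun_borelRn => // i.
  rewrite [X in measurable_fun _ X](_ : _ = fun x => @Defs.coord R m i x + w ord0 i).
    by apply: measurable_funD => //; exact: measurable_coord.
  by apply/funext => x; rewrite mxE.
have mFv : measurable_fun [set: borelRn R n.+1] (fun x => F ((x : 'rV_n.+1) + v)).
  exact: (measurableT_comp mF (mshift _ v)).
rewrite (integral_bleb_cons mFv (fun=> F0 _)).
rewrite (integral_bleb_cons mF F0).
have mFc : measurable_fun setT (F \o @consRn R n).
  by apply: (measurableT_comp mF); exact: measurable_consRn.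
rewrite -(IH (\row_j v ord0 (lift ord0 j)) (fun x => \int[lam]_t F (consRn (x, t)))%E); last 2 first.
- apply: (@measurable_fun_fubini_tonelli_F _ _ _ _ _ lam (F \o @consRn R n) mFc (fun=> F0 _)).
- by move=> x; exact: integral_ge0.
apply: eq_integral => x _.
rewrite -[RHS](ge0_integral_shift (v ord0 ord0))//; last first.
  exact: (measurableT_comp mFc (measurable_pair1 _)).
apply: eq_integral => t _; congr F; apply/rowP => i.
rewrite mxE; have [j ->|->] := unliftP ord0 i.
  by rewrite !consRnS/= !mxE.
by rewrite !consRn0.
Qed.

(** Restricted to Borel integrands, for which the recursive measure is available. This is why the
    boundary layers below are covered by Borel sets. *)
Lemma integral_leb_shift n (v : 'rV[R]_n) (F : borelRn R n -> \bar R) :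
  measurable_fun [set: borelRn R n] F -> (forall x, 0 <= F x)%E ->
  (\int[@leb R n]_x F ((x : 'rV_n) + v)%R = \int[@leb R n]_x F x)%E.
Proof.
move=> mF F0; rewrite (integral_leb_bleb mF F0) -(integral_bleb_shift v)//.
apply: (integral_leb_bleb (F := fun x => F ((x : 'rV_n) + v)%R)) => //.
apply: (measurableT_comp mF); apply: measurable_fun_borelRn => // i.
rewrite [X in measurable_fun _ X](_ : _ = fun x => @Defs.coord R n i x + v ord0 i).
  by apply: measurable_funD => //; exact: measurable_coord.
by apply/funext => x; rewrite mxE.
Qed.

End translation.

(** * Boxes, open sets and the Euclidean norm *)

Section RnTopology.
Variables (R : realType) (n : nat).
Implicit Types x y c : 'rV[R]_n.

Lemma rV_coord_le x i : `|x ord0 i| <= `|x|.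
Proof.
rewrite [leRHS]/Num.Def.normr/= mx_normrE.
exact: (le_bigmax _ (fun ij : 'I_1 * 'I_n => `|x ij.1 ij.2|) (ord0, i)).
Qed.

Lemma rV_norm_le x e : 0 <= e -> (forall i, `|x ord0 i| <= e) -> `|x| <= e.
Proof.
move=> e0 xe; rewrite /Num.Def.normr/= mx_normrE; apply/bigmax_leP; split => // -[i j] _ /=.
by rewrite ord1.
Qed.

Definition rV_box c (e : R) : set 'rV[R]_n :=
  [set x | forall i, `|x ord0 i - c ord0 i| <= e].

Lemma measurable_rV_box c (e : R) :
  measurable (rV_box c e : set (borelRn R n)).
Proof.
rewrite (_ : rV_box c e = \bigcap_(i in [set: 'I_n]) (Defs.coord i @^-1` `[c ord0 i - e, c ord0 i + e]%classic)); last first.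
  apply/seteqP; split => x /= xe i; first by move=> _; have := xe i; rewrite /= in_itv/= ler_distl.
  by rewrite ler_distl; have := xe i Logic.I; rewrite /= in_itv.
apply: fin_bigcap_measurable => // i _.
by rewrite -[X in measurable X]setTI; exact: measurable_coord.
Qed.

(** A is the union of the countably many boxes with rational centre and radius 1/(k+1) that it
    contains. If the ball of radius e about x lies in A, a box of radius below e/2 that contains x
    stays within that ball. *)
Lemma open_measurable_borelRn (A : set 'rV[R]_n) :
  open A -> measurable (A : set (borelRn R n)).
Proof.
move=> oA.
pose box (p : 'rV[rat]_n * nat) : set 'rV[R]_n :=
  rV_box (map_mx ratr p.1) p.2.+1%:R^-1.
have -> : A = \bigcup_p (if `[< box p `<=` A >] then box p else set0).
  apply/seteqP; split => x; last by move=> [p _]; case: asboolP => // pA /pA.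
  move=> Ax; have /nbhs_ballP[e /= e0 xe] : nbhs x A by exact: open_nbhs_nbhs.
  have [k ke] : exists k : nat, k.+1%:R^-1 < e / 2.
    have /ltr_add_invr[k] : 0 < e / 2 by rewrite divr_gt0.
    by rewrite add0r; exists k.
  have k0 : (0 : R) < k.+1%:R^-1 by rewrite invr_gt0.
  have /choice[q qP] : forall i, exists q : rat, `|x ord0 i - ratr q| <= k.+1%:R^-1.
    move=> i; have : x ord0 i - k.+1%:R^-1 < x ord0 i + k.+1%:R^-1 by rewrite ltrD2l gtrN.
    move=> /rat_in_itvoo[q]; rewrite in_itv/= => /andP[q1 q2]; exists q.
    by rewrite distrC ler_distl !ltW.
  exists (\row_i q i, k) => //.
  have bx : box (\row_i q i, k) x by move=> i; rewrite !mxE.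
  case: asboolP => // -[] y yb; apply: xe; split => // i j.
  rewrite ord1 /ball/= /ball_/=.
  have := yb j; have := bx j; rewrite /= !mxE.
  move: (k.+1%:R^-1) ke => k' ke h1 h2.
  have -> : x ord0 j - y ord0 j = (x ord0 j - ratr (q j)) - (y ord0 j - ratr (q j)) by lra.
  by apply: (le_lt_trans (ler_normB _ _)); lra.
apply: countable_bigcupT_measurable => // p.
by case: ifP => // _; exact: measurable_rV_box.
Qed.

(** The indicator of a box is the product of the indicators of its sides. *)
Lemma leb_box c (e : R) : 0 <= e ->
  leb (rV_box c e : set (Rn R n)) = ((2 * e) ^+ n)%:E.
Proof.
move=> e0.
pose f (i : 'I_n) : R -> R := \1_(`[c ord0 i - e, c ord0 i + e]%classic).
have := @integral_leb_prod R n f (fun i => measurable_indic _) (fun i t => _).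
rewrite -/f => h.
transitivity (\prod_(i < n) (\int[@lebesgue_measure R]_t (f i t)%:E))%E; last first.
  rewrite (eq_bigr (fun=> (2 * e)%:E)) => [|i _]; last first.
    rewrite /f integral_indic// setIT/= lebesgue_measure_itv/= lte_fin.
    case: ifPn => [_|]; first by rewrite -EFinB; congr EFin; lra.
    by rewrite -leNgt => ee; congr EFin; lra.
  by rewrite prodEFin prodr_const card_ord.
rewrite -h//.
rewrite -[in LHS](setIT (rV_box c e)) -(@integral_indic _ _ _ (@leb R n) setT measurableT); last first.
  by apply: measurable_borelRn_Rn; exact: measurable_rV_box.
apply: eq_integral => x _; congr EFin; rewrite indicE.
have [xb|xb] := boolP (x \in _).
  rewrite big1// => i _; rewrite /f indicE mem_set//= in_itv/=.
  by move: xb; rewrite inE/= => /(_ i); rewrite ler_distl.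
have [i xi] : exists i, ~~ (`|(x : 'rV_n) ord0 i - c ord0 i| <= e).
  apply/existsP; rewrite -negb_forall; apply: contraNN xb => /forallP xb.
  by rewrite inE.
rewrite (bigD1 i)//= /f indicE memNset ?mul0r//= in_itv/=.
by apply/negP; rewrite -ler_distl.
Qed.

Lemma leb_bounded_lty (A : set 'rV[R]_n) : measurable (A : set (Rn R n)) ->
  bounded_set A -> (leb (A : set (Rn R n)) < +oo)%E.
Proof.
move=> mA [N [Nr NA]].
have B0 : 0 <= `|N| + 1 by have := normr_ge0 N; lra.
apply: (@le_lt_trans _ _ (leb (rV_box 0 (`|N| + 1) : set (Rn R n)))).
  apply: le_measure; rewrite ?inE//; first by apply: measurable_borelRn_Rn; exact: measurable_rV_box.
  move=> x /= Ax i; rewrite mxE subr0 (le_trans (rV_coord_le _ _))//.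
  apply: NA => //; have := ler_norm N; lra.
by rewrite leb_box// ltry.
Qed.

(** A point is a box of radius 0. In dimension 0 the whole space is one point of mass 1, hence n >
    0. *)
Lemma leb_set1 (c : 'rV[R]_n) : (0 < n)%N -> leb ([set c] : set (Rn R n)) = 0%E.
Proof.
move=> n0; rewrite (_ : [set c] = rV_box c 0).
  by rewrite leb_box// mulr0 expr0n gtn_eqF.
apply/seteqP; split => x /= => [-> i|h]; first by rewrite subrr normr0.
by apply/rowP => i; have := h i; rewrite normr_le0 subr_eq0 => /eqP.
Qed.

Lemma leb_open_gt0 (A : set 'rV[R]_n) : open A -> A !=set0 ->
  (0 < leb (A : set (Rn R n)))%E.
Proof.
move=> oA [c Ac].
have /nbhs_ballP[e /= e0 ce] : nbhs c A by exact: open_nbhs_nbhs.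
have e20 : 0 <= e / 2 by lra.
apply: (@lt_le_trans _ _ (leb (rV_box c (e / 2) : set (Rn R n)))).
  by rewrite leb_box// lte_fin exprn_gt0//; lra.
apply: le_measure; rewrite ?inE.
- by apply: measurable_borelRn_Rn; exact: measurable_rV_box.
- by apply: measurable_borelRn_Rn; exact: open_measurable_borelRn.
- move=> x /= xc; apply: ce; split => // i j; rewrite ord1 /ball/= /ball_/= distrC.
  by apply: (le_lt_trans (xc _)); lra.
Qed.

Lemma enorm_ge0 x : 0 <= enorm x. Proof. exact: sqrtr_ge0. Qed.

Lemma rV_coord_le_enorm x i : `|x ord0 i| <= enorm x.
Proof.
rewrite /enorm -sqrtr_sqr ler_sqrt// /dotp.
  by rewrite (bigD1 i)//= expr2 lerDl sumr_ge0// => j _; rewrite -expr2 sqr_ge0.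
by rewrite sumr_ge0// => j _; rewrite -expr2 sqr_ge0.
Qed.

Lemma norm_le_enorm x : `|x| <= enorm x.
Proof. by apply: rV_norm_le => [|i]; [exact: enorm_ge0|exact: rV_coord_le_enorm]. Qed.

(** The sharp constant is the square root of n; n itself spares a root and is good enough for all
    the estimates. *)
Lemma enorm_le_norm x : enorm x <= n%:R * `|x|.
Proof.
rewrite -[leRHS]ger0_norm ?mulr_ge0// -sqrtr_sqr ler_sqrt ?sqr_ge0// /dotp.
rewrite (@le_trans _ _ (\sum_(i < n) `|x| ^+ 2))//.
  by apply: ler_sum => i _; rewrite -expr2 -real_normK ?num_real// lerXn2r ?nnegrE// rV_coord_le.
rewrite sumr_const card_ord exprMn -[leLHS]mulr_natl.
rewrite ler_wpM2r ?sqr_ge0// -natrX ler_nat.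
by case: n => // m; rewrite expnS expn1 leq_pmulr.
Qed.

Lemma enorm_gt0 x : (0 < enorm x) = (x != 0).
Proof.
apply/idP/idP => [|x0].
  apply: contraTN => /eqP ->; rewrite -leNgt.
  by rewrite (le_trans (enorm_le_norm _))// normr0 mulr0.
by apply: lt_le_trans (norm_le_enorm x); rewrite normr_gt0.
Qed.

Lemma enorm_distC x y : enorm (x - y) = enorm (y - x).
Proof.
rewrite /enorm /dotp; congr Num.sqrt; apply: eq_bigr => i _; rewrite !mxE.
by rewrite -mulrNN !opprB.
Qed.

Lemma measurable_fun_enorm d (T : measurableType d) (f : T -> 'rV[R]_n) :
  (forall i, measurable_fun [set: T] (fun x : T => f x ord0 i)) ->
  measurable_fun [set: T] (fun x : T => enorm (f x)).
Proof.
move=> mf; apply: measurableT_comp.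
  by apply: continuous_measurable_fun; exact: sqrt_continuous.
by apply: measurable_sum => i; exact: measurable_funM.
Qed.

Lemma measurable_coord_Rn (i : 'I_n) : measurable_fun [set: Rn R n] (@Defs.coord R n i).
Proof. by apply: measurable_fun_Rn_borel; exact: measurable_coord. Qed.

Lemma measurable_fun_enormB :
  measurable_fun [set: Rn R n * Rn R n] (fun z : Rn R n * Rn R n => enorm ((z.1 : 'rV_n) - z.2)).
Proof.
apply: measurable_fun_enorm => i.
rewrite [X in measurable_fun _ X](_ : _ = fun z : Rn R n * Rn R n => Defs.coord i z.1 - Defs.coord i z.2).
  apply: measurable_funB; first exact: (measurableT_comp (measurable_coord_Rn i) measurable_fst).
  exact: (measurableT_comp (measurable_coord_Rn i) measurable_snd).
by apply/funext => z; rewrite !mxE.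
Qed.

End RnTopology.

(** * One-dimensional integrability *)

Section tails.
Variable R : realType.
Local Notation lam := (@lebesgue_measure R).

Lemma powRN_cvg0 (c : R) : 0 < c -> x `^ (- c) @[x --> +oo%R] --> (0 : R).
Proof.
move=> c0; have cn0 : c != 0 by rewrite gt_eqF.
apply/cvgrPdist_lt => e e0; near=> t.
have t1 : 1 < t by near: t; exact: nbhs_pinfty_gt.
have t0 : 0 < t by exact: lt_trans t1.
rewrite sub0r normrN ger0_norm ?powR_ge0// powRN invf_plt ?posrE ?powR_gt0//.
(* The threshold is (1/e)^(1/c): beyond it t^c exceeds 1/e. *)
rewrite -[ltLHS](@powRr1 _ e^-1) ?invr_ge0 ?ltW// -(mulVf cn0) powRrM.
rewrite gt0_ltr_powR// ?nnegrE ?powR_ge0 ?ltW//.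
Unshelve. all: by end_near. Qed.

Lemma integral_powRN_y (b : R) : 1 < b ->
  (\int[lam]_(t in `[1%R, +oo[) (t `^ (- b))%:E = ((b - 1)^-1)%:E)%E.
Proof.
move=> b1; have b10 : b - 1 != 0 by rewrite gt_eqF// subr_gt0.
pose F (t : R) := - (b - 1)^-1 * t `^ (- (b - 1)).
have dF (x : R) : 1 <= x -> is_derive x 1 F (x `^ (- b)).
  move=> x1; have x0 : 0 < x by exact: lt_le_trans x1.
  have -> : x `^ (- b) = - (b - 1)^-1 *: (- (b - 1) * x `^ (- (b - 1) - 1)).
    rewrite scalerA mulrNN mulVf// scale1r; congr (_ `^ _); lra.
  have dp := is_derive1_powR (- (b - 1)) x0.
  exact: (@is_deriveZ _ _ _ (fun t : R => t `^ (- (b - 1))) _ _ _ _ dp).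
rewrite (@ge0_continuous_FTC2y _ _ F _ 0).
- by rewrite -EFinB /F powR1 mulr1 sub0r opprK.
- by move=> x _; exact: powR_ge0.
- apply: derivable_within_continuous => x; rewrite in_itv/= andbT => x1.
  by apply: derivable_powR; rewrite in_itv/= andbT; exact: lt_le_trans x1.
- rewrite -[X in _ --> X](mulr0 (- (b - 1)^-1)).
  by apply: cvgMr; apply: powRN_cvg0; rewrite subr_gt0.
- by move=> x /ltW/dF[].
- apply: cvg_at_right_filter; apply: differentiable_continuous.
  by apply/derivable1_diffP; have [] := dF 1 (lexx _).
- move=> x; rewrite in_itv/= andbT => /ltW x1.
  by rewrite derive1E; exact: (@derive_val _ _ _ _ _ _ _ (dF _ x1)).
Qed.

(** A Japanese bracket with max(1, |t|) in place of sqrt(1 + t^2), so that it is constant on [-1, 1]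
    and a pure power outside. *)
Definition japanese (b t : R) : R := Num.max 1 `|t| `^ (- b).

Lemma japanese_ge0 b t : 0 <= japanese b t. Proof. exact: powR_ge0. Qed.

Lemma measurable_japanese b : measurable_fun setT (japanese b).
Proof.
apply: (measurableT_comp (measurable_powR _)).
by apply: measurable_maxr => //.
Qed.

Lemma ge0_integral_even (f : R -> \bar R) :
  measurable_fun setT f -> (forall t, 0 <= f t)%E -> (forall t, f (- t)%R = f t) ->
  (\int[lam]_t f t = \int[lam]_(t in `[0%R, +oo[) f t + \int[lam]_(t in `[0%R, +oo[) f t)%E.
Proof.
move=> mf f0 fN.
rewrite {2}ge0_integration_by_substitution0//.
under [X in (_ + X)%E]eq_integral do rewrite fN.
rewrite -(@integral_itv_bndo_bndc _ _ _ f); last exact: measurable_funTS.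
rewrite -ge0_integral_setU//=; last 2 first.
- exact: measurable_funTS.
- apply/disj_setPS => t /=; rewrite !in_itv/= andbT => -[]; lra.
rewrite (_ : _ `|` _ = setT)//; apply/seteqP; split => // t _ /=.
by rewrite !in_itv/= andbT; case: (leP 0 t); [left|right].
Qed.

Lemma integral_japanese_lty b : 1 < b -> (\int[lam]_t (japanese b t)%:E < +oo)%E.
Proof.
move=> b1; rewrite ge0_integral_even; last 3 first.
- by apply/measurable_EFinP; exact: measurable_japanese.
- by move=> t; rewrite lee_fin; exact: japanese_ge0.
- by move=> t; rewrite /japanese normrN.
suff : (\int[lam]_(t in `[0%R, +oo[) (japanese b t)%:E < +oo)%E.
  by move=> h; rewrite lte_add_pinfty.
have mj D : measurable_fun D (fun t => (japanese b t)%:E).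
  by apply: measurable_funTS; apply/measurable_EFinP; exact: measurable_japanese.
have -> : `[0%R, +oo[%classic = `[0%R, 1%R[%classic `|` `[(1 : R), +oo[%classic.
  by rewrite -itv_bndbnd_setU// ?bnd_simp.
rewrite ge0_integral_setU//; last 3 first.
- exact: mj.
- by move=> t _; rewrite lee_fin; exact: japanese_ge0.
- apply/disj_setPS => t /=; rewrite !in_itv/= andbT => -[]; lra.
rewrite lte_add_pinfty//.
  apply: (@le_lt_trans _ _ (\int[lam]_(t in `[0%R, 1%R[) (cst 1 t))%E).
    apply: ge0_le_integral => //.
      by move=> t _; rewrite lee_fin; exact: japanese_ge0.
      exact: mj.
    move=> t /=; rewrite in_itv/= => /andP[t0 t1].
    by rewrite /japanese max_l ?powR1// ger0_norm// ltW.
  by rewrite integral_cst// mul1e /= lebesgue_measure_itv/= lte_fin ltr01 -EFinB ltry.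
rewrite [X in (X < _)%E](_ : _ = \int[lam]_(t in `[1%R, +oo[) (t `^ (- b))%:E)%E.
  by rewrite integral_powRN_y// ltry.
apply: eq_integral => t; rewrite inE/= in_itv/= andbT => t1; rewrite /japanese max_r.
  by rewrite ger0_norm// (le_trans _ t1).
by rewrite ger0_norm// (le_trans _ t1).
Qed.

End tails.

Lemma measurable_setb d (T : measurableType d) (b : T -> bool) :
  measurable_fun [set: T] b -> measurable [set x | b x].
Proof.
move=> mb; rewrite (_ : [set x | b x] = setT `&` b @^-1` [set true]); first exact: mb.
by rewrite setTI; apply/seteqP; split.
Qed.

(** * Power singularities at the origin *)

Section layer_cake.
Variable R : realType.
Local Notation lam := (@lebesgue_measure R).

(** For g nonzero the value at t = 0 is 0, not infinity, by the convention on powers of 0. *)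
Definition trunc_pow (g B t : R) : R := (`|t| <= B)%R%:R * `|t| `^ (- g).

Lemma trunc_pow_ge0 g B t : 0 <= trunc_pow g B t.
Proof. by rewrite mulr_ge0// powR_ge0. Qed.

Lemma measurable_trunc_pow g B : measurable_fun setT (trunc_pow g B).
Proof.
apply: measurable_funM; last first.
  by apply: (measurableT_comp (measurable_powR _)); exact: normr_measurable.
rewrite (_ : (fun _ => _) = \1_[set t : R | `|t| <= B]); last first.
  by apply/funext => t; rewrite indicE mem_setE.
by apply: measurable_indic; apply: measurable_setb; apply: measurable_fun_ler => //; exact: normr_measurable.
Qed.

(* Layer cake: the superlevel sets of |t|^-g on [-1, 1] reduce integrability at
   0 to that of v^-(1/g) at infinity. *)
Lemma integral_trunc_pow1_lty g : 0 < g < 1 ->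
  (\int[lam]_t (trunc_pow g 1 t)%:E < +oo)%E.
Proof.
move=> /andP[g0 g1].
have gn0 : g != 0 by rewrite gt_eqF.
pose f (z : measurableTypeR R * measurableTypeR R) : \bar R := (\1_[set z : measurableTypeR R * measurableTypeR R | (0 < z.2) && (z.2 <= trunc_pow g 1 z.1)] z)%:E.
have mf : measurable_fun setT f.
  apply/measurable_EFinP/measurable_indic; apply: measurable_setb; apply: measurable_and.
    by apply: measurable_fun_ltr.
  by apply: measurable_fun_ler => //; exact: (measurableT_comp (measurable_trunc_pow _ _) measurable_fst).
have f0 z : (0 <= f z)%E by rewrite lee_fin.
have -> : (\int[lam]_t (trunc_pow g 1 t)%:E = \int[lam]_t \int[lam]_v f (t, v))%E.
  apply: eq_integral => t _.
  rewrite (eq_integral (fun v => (\1_(`]0%R, trunc_pow g 1 t]%classic : set (measurableTypeR R)) v)%:E)); last first.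
    by move=> v _; rewrite /f; congr EFin; rewrite !indicE.
  rewrite integral_indic// setIT/= lebesgue_measure_itv/= lte_fin -EFinB subr0.
  by have := trunc_pow_ge0 g 1 t; rewrite le_eqVlt => /predU1P[<-|->//]; rewrite ltxx.
rewrite (fubini_tonelli _ mf f0).
apply: (@le_lt_trans _ _ (\int[lam]_v (2%:E * (japanese g^-1 v)%:E)))%E; last first.
  rewrite ge0_integralZl//.
  - by rewrite lte_mul_pinfty// integral_japanese_lty// invf_gt1.
  - by apply/measurable_EFinP; exact: measurable_japanese.
  - by move=> v _; rewrite lee_fin japanese_ge0.
apply: ge0_le_integral => //.
- by move=> v _; exact: integral_ge0.
- exact: measurable_fun_fubini_tonelli_G.
- by apply: measurable_funeM; apply/measurable_EFinP; exact: measurable_japanese.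
move=> v _; have [v0|v0] := leP v 0.
  rewrite integral0_eq ?mule_ge0 ?lee_fin ?japanese_ge0// => t _.
  by rewrite /f indicE memNset//= ltNge v0.
(* For v > 0 the superlevel set lies in [-j, j], of length 2j: if v <= 1 then j = 1 and the
   truncation gives |t| <= 1, otherwise |t|^-g >= v means |t| <= v^(-1/g) = j. *)
set j := japanese _ _.
apply: (@le_trans _ _ (\int[lam]_t (\1_(`[- j, j]%classic : set (measurableTypeR R)) t)%:E)%E); last first.
  rewrite integral_indic// setIT/= lebesgue_measure_itv/= lte_fin.
  have j0 : 0 <= j by exact: japanese_ge0.
  by case: ifP => _; rewrite ?mule_ge0// -EFinB -EFinM lee_fin; lra.
apply: ge0_le_integral => //.
- exact: (measurableT_comp mf (measurable_pair2 _)).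
- by apply/measurable_EFinP/measurable_indic.
move=> t _; rewrite lee_fin !indicE ler_nat.
case: (boolP (_ \in _)) => //; rewrite inE/= v0/= => vt.
rewrite mem_set//= in_itv/= -ler_norml.
have t1 : `|t| <= 1.
  rewrite leNgt; apply/negP => t1; move: vt.
  by rewrite /trunc_pow (lt_geF t1) mul0r leNgt v0.
move: vt; rewrite /trunc_pow t1 mul1r => vt.
(* t = 0 is excluded because the power takes the value 0 there, below v. *)
have t0 : 0 < `|t|.
  rewrite lt_neqAle normr_ge0 andbT eq_sym; apply/eqP => t0; move: vt.
  by rewrite t0 powR0 ?oppr_eq0// leNgt v0.
rewrite /j /japanese (gtr0_norm v0); case: (lerP v 1) => v1; first by rewrite powR1.
rewrite powRN invf_pge ?posrE ?powR_gt0//.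
move: vt; rewrite powRN => vt.
have /(ge0_ler_powR _) : v <= (`|t| `^ g)^-1 by [].
move=> /(_ g^-1 _ _ _)-/(_ _ _ _); rewrite invr_ge0 ltW// nnegrE ltW// nnegrE invr_ge0 powR_ge0.
move=> /(_ isT isT isT); rewrite -powRN -powRrM mulNr mulfV// powRN powRr1//.
Qed.

(** Outside [-1, 1] the power is at most 1, so the indicator of [-B, B] absorbs what [trunc_pow g 1]
    misses. *)
Lemma integral_trunc_pow_lty g B : 0 < g < 1 ->
  (\int[lam]_t (trunc_pow g B t)%:E < +oo)%E.
Proof.
move=> g01.
apply: (@le_lt_trans _ _ (\int[lam]_t ((trunc_pow g 1 t)%:E + (\1_(`[- B, B]%classic : set (measurableTypeR R)) t)%:E))%E).
  apply: ge0_le_integral => //.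
  - by move=> t _; rewrite lee_fin trunc_pow_ge0.
  - by apply/measurable_EFinP; exact: measurable_trunc_pow.
  - apply: emeasurable_funD; apply/measurable_EFinP; first exact: measurable_trunc_pow.
    exact: measurable_indic.
  move=> t _; rewrite -EFinD lee_fin /trunc_pow; have [t1|t1] := leP `|t| 1.
    rewrite mul1r; case: (leP `|t| B) => _; first by rewrite mul1r lerDl.
    by rewrite mul0r addr_ge0// powR_ge0.
  rewrite mul0r add0r; have [tB|tB] := leP `|t| B; last by rewrite mul0r.
  rewrite mul1r indicE mem_set/=; last by rewrite in_itv/= -ler_norml.
  rewrite powRN invf_le1 ?powR_gt0 ?(lt_trans _ t1)//.
  rewrite -(powRr0 `|t|); apply: ler_powR; first exact: ltW.
  by case/andP : g01 => /ltW.
rewrite ge0_integralD//.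
- rewrite lte_add_pinfty ?integral_trunc_pow1_lty// integral_indic// setIT/=.
  by rewrite lebesgue_measure_itv/=; case: ifP => _; rewrite -?EFinB ltry.
- by move=> t _; rewrite lee_fin trunc_pow_ge0.
- by apply/measurable_EFinP; exact: measurable_trunc_pow.
- by apply/measurable_EFinP/measurable_indic.
Qed.

End layer_cake.

(** * Integrals over intervals, with variable end points *)

Section integral_aux.
Variable R : realType.
Local Notation lam := (@lebesgue_measure R).

Lemma ge0_integral_itv_split (f : R -> \bar R) (a b c : itv_bound R) :
  measurable_fun setT f -> (forall t, 0 <= f t)%E -> (a <= b)%O -> (b <= c)%O ->
  (\int[lam]_(t in [set` Interval a c]) f t =
   \int[lam]_(t in [set` Interval a b]) f t + \int[lam]_(t in [set` Interval b c]) f t)%E.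
Proof.
move=> mf f0 ab bc; rewrite (itv_bndbnd_setU ab bc) ge0_integral_setU//.
- exact: measurable_funTS.
- apply/disj_setPS => t /=; rewrite !itv_boundlr => -[/andP[_ tb] /andP[bt _]].
  by have := le_trans tb bt; rewrite bnd_simp ltxx.
Qed.

Lemma ge0_integral_opp (D : set R) (f : R -> \bar R) : measurable (D : set (measurableTypeR R)) ->
  measurable_fun setT f -> (forall t, 0 <= f t)%E ->
  (\int[lam]_(t in -%R @^-1` D) f (- t)%R = \int[lam]_(t in D) f t)%E.
Proof.
move=> mD mf f0; rewrite [RHS]integral_mkcond [LHS]integral_mkcond.
rewrite -[RHS](ge0_integral_reflect 0).
- by apply: eq_integral => t _; rewrite sub0r /patch.
- exact/(measurable_restrictT _ mD)/measurable_funTS.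
- exact: erestrict_ge0.
Qed.

Lemma ge0_integral_lty_fin d (T : measurableType d) (mu : {measure set T -> \bar R})
    (D : set T) (f : T -> R) : (forall t, 0 <= f t) ->
  (\int[mu]_(t in D) (f t)%:E < +oo)%E ->
  (\int[mu]_(t in D) f t)%R%:E = (\int[mu]_(t in D) (f t)%:E)%E.
Proof.
move=> f0 flty; rewrite /Rintegral fineK// ge0_fin_numE//.
by apply: integral_ge0 => t _; rewrite lee_fin.
Qed.

(** A vanishing integral would make f zero almost everywhere on D, hence D negligible. *)
Lemma integral_gt0 d (T : measurableType d) (mu : {measure set T -> \bar R})
    (D : set T) (f : T -> \bar R) : measurable D -> measurable_fun D f ->
  (forall x, D x -> 0 < f x)%E -> (0 < mu D)%E -> (0 < \int[mu]_(x in D) f x)%E.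
Proof.
move=> mD mf f0 D0; rewrite lt_neqAle integral_ge0 ?andbT; last by move=> x /f0/ltW.
apply/eqP => /esym if0.
have : (\int[mu]_(x in D) `|f x| = 0)%E.
  by rewrite -if0; apply: eq_integral => x; rewrite inE => /f0/ltW/gee0_abs.
move=> /(ae_eq_integral_abs mu mD mf)[N [mN N0 DN]].
move: D0; rewrite lt_neqAle => /andP[/eqP D0 _]; apply: D0; apply/esym.
apply: (subset_measure0 mD mN _ N0) => x Dx; apply: DN => /= /(_ Dx) fx.
by have := f0 _ Dx; rewrite fx ltxx.
Qed.

(** The bound C keeps the extended integral finite; an infinite one would be sent to 0 by the
    passage to real integrals. *)
Lemma EFin_oint (f : R -> R) (C a b : R) : measurable_fun setT f ->
  (forall t, 0 <= f t <= C) -> a <= b ->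
  (oint a b f)%:E = (\int[lam]_(t in `[a, b]) (f t)%:E)%E.
Proof.
move=> mf fC ab; rewrite /oint ab.
apply: ge0_integral_lty_fin => [t|]; first by case/andP: (fC t).
apply: (@le_lt_trans _ _ (\int[lam]_(t in `[a, b]) (cst C%:E t))%E).
  apply: ge0_le_integral => //.
  - by move=> t _; rewrite lee_fin; case/andP: (fC t).
  - by apply: measurable_funTS; apply/measurable_EFinP.
  - by move=> t _; rewrite lee_fin; case/andP: (fC t).
rewrite integral_cst//= lebesgue_measure_itv/= lte_fin.
by case: ifP => _; rewrite ?mule0 -?EFinB -?EFinM ltry.
Qed.

(** Moving the end points into the indicator of a measurable set of pairs turns this into a section
    integral of Tonelli's theorem. *)
Lemma measurable_fun_itv_integral d (T : measurableType d) (f : R -> R) (a b : T -> R) :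
  measurable_fun setT f -> (forall t, 0 <= f t) ->
  measurable_fun setT a -> measurable_fun setT b ->
  measurable_fun setT (fun x => \int[lam]_(t in `[a x, b x]) (f t)%:E)%E.
Proof.
move=> mf f0 ma mb.
pose S := [set z : T * measurableTypeR R | (a z.1 <= z.2) && (z.2 <= b z.1)].
have mS : measurable S.
  apply: measurable_setb; apply: measurable_and.
    by apply: measurable_fun_ler => //; exact: (measurableT_comp ma measurable_fst).
  by apply: measurable_fun_ler => //; exact: (measurableT_comp mb measurable_fst).
pose F (z : T * measurableTypeR R) : \bar R := (\1_S z * f z.2)%:E.
have mF : measurable_fun setT F.
  apply/measurable_EFinP; apply: measurable_funM; first exact: measurable_indic.
  exact: (measurableT_comp mf measurable_snd).
have F0 z : (0 <= F z)%E by rewrite lee_fin mulr_ge0.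
rewrite [X in measurable_fun _ X](_ : _ = fubini_F lam F).
  exact: measurable_fun_fubini_tonelli_F.
apply/funext => x; rewrite [LHS]integral_mkcond /fubini_F.
apply: eq_integral => t _.
rewrite /F patchE indicE (_ : ((x, t) \in S) = (t \in `[a x, b x]%classic)); last first.
  by rewrite /S !mem_setE/= in_itv.
by case: ifP => _; rewrite ?mul1r ?mul0r.
Qed.

Lemma measurable_oint d (T : measurableType d) (f : R -> R) (a b : T -> R) :
  measurable_fun setT f -> (forall t, 0 <= f t) ->
  measurable_fun setT a -> measurable_fun setT b ->
  measurable_fun setT (fun x => oint (a x) (b x) f).
Proof.
move=> mf f0 ma mb; apply: measurable_fun_ifT.
- exact: measurable_fun_ler.
- apply: (measurableT_comp (fine_measurable measurableT)).
  exact: measurable_fun_itv_integral.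
- apply: measurableT_comp => //; apply: (measurableT_comp (fine_measurable measurableT)).
  exact: measurable_fun_itv_integral.
Qed.

End integral_aux.

(** * The profile functions *)

Lemma ge0_le_integralT d (T : measurableType d) (R : realType)
    (mu : {measure set T -> \bar R}) (f g : T -> \bar R) :
  measurable_fun setT f -> measurable_fun setT g ->
  (forall x, 0 <= f x)%E -> (forall x, f x <= g x)%E ->
  (\int[mu]_x f x <= \int[mu]_x g x)%E.
Proof. by move=> mf mg f0 fg; exact: ge0_le_integral. Qed.

Section profile.
Variables (R : realType) (n : nat) (s : R).
Hypotheses (n_ge1 : (1 <= n)%N) (s0 : 0 < s).
Local Notation lam := (@lebesgue_measure R).
Local Notation g := (@g_s R n s).
Local Notation G := (@barG_s R n s).

Let n1 : (1 : R) <= n%:R. Proof. by rewrite ler1n. Qed.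

Let ns_gt1 : 1 < n%:R + s. Proof. by have := s0; have := n1; lra. Qed.

Let ns1_gt1 : 1 < n%:R + 1 + s. Proof. by have := s0; have := n1; lra. Qed.

Lemma g_s_gt0 t : 0 < g t.
Proof. by apply: powR_gt0; rewrite ltr_pwDl// sqr_ge0. Qed.

Lemma g_s_ge0 t : 0 <= g t. Proof. exact/ltW/g_s_gt0. Qed.

Lemma g_sN t : g (- t) = g t. Proof. by rewrite /g_s sqrrN. Qed.

Lemma measurable_g_s : measurable_fun setT g.
Proof.
apply: (measurableT_comp (measurable_powR _)); exact: measurable_funD.
Qed.

Let mg : measurable_fun setT (EFin \o g).
Proof. by apply/measurable_EFinP; exact: measurable_g_s. Qed.

Let g0 t : (0 <= (EFin \o g) t)%E. Proof. by rewrite lee_fin g_s_ge0. Qed.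

Lemma g_s_le_japanese t : g t <= japanese (n%:R + 1 + s) t.
Proof.
rewrite /g_s /japanese; set p := n%:R + 1 + s; set m := Num.max 1 `|t|.
have p0 : 0 <= p by exact: le_trans ler01 (ltW ns1_gt1).
have m0 : 0 < m by rewrite lt_max ltr01.
have -> : m `^ (- p) = (m ^+ 2) `^ (- (p / 2)).
  by rewrite -powR_mulrn ?ltW// -powRrM; congr (_ `^ _); rewrite mulrN mulrC divfK.
rewrite !powRN lef_pV2 ?posrE ?powR_gt0 ?exprn_gt0//; last by rewrite ltr_pwDl// sqr_ge0.
apply: ge0_ler_powR; rewrite ?nnegrE ?divr_ge0 ?sqr_ge0//; first by rewrite addr_ge0// sqr_ge0.
rewrite /m; case: (lerP 1 `|t|) => _; last by rewrite expr1n lerDl sqr_ge0.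
by rewrite real_normK ?num_real// lerDr.
Qed.

(** The first moment of [g_s] costs one power of t and leaves the exponent n + s, still above 1.
    This moment bounds [Phi_s 0]. *)
Lemma norm_g_s_le_japanese t : `|t| * g t <= japanese (n%:R + s) t.
Proof.
apply: (@le_trans _ _ (Num.max 1 `|t| * japanese (n%:R + 1 + s) t)).
  by rewrite ler_pM ?g_s_ge0 ?g_s_le_japanese// le_max lexx orbT.
rewrite /japanese; set m := Num.max _ _.
have m0 : 0 < m by rewrite lt_max ltr01.
rewrite -[X in X * _](powRr1 (ltW m0)) -powRD; last by rewrite (gt_eqF m0) implybT.
by apply: ler_powR; [rewrite le_max lexx|lra].
Qed.

Lemma integral_g_s_lty : (\int[lam]_t (g t)%:E < +oo)%E.
Proof.
apply: (@le_lt_trans _ _ (\int[lam]_t (japanese (n%:R + 1 + s) t)%:E)%E).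
  apply: ge0_le_integralT => // [|t]; last by rewrite lee_fin g_s_le_japanese.
  by apply/measurable_EFinP; exact: measurable_japanese.
by apply: integral_japanese_lty.
Qed.

Lemma EFin_barG_s t : (G t)%:E = (\int[lam]_(x in `]-oo, t]) (g x)%:E)%E.
Proof.
apply: ge0_integral_lty_fin => [x|]; first exact: g_s_ge0.
apply: le_lt_trans integral_g_s_lty.
by apply: ge0_subset_integral => // x _; exact: g0.
Qed.

Lemma barG_s_gt0 t : 0 < G t.
Proof.
rewrite -lte_fin EFin_barG_s; apply: integral_gt0 => //.
- exact: measurable_funTS.
- by move=> x _; rewrite lte_fin g_s_gt0.
- by rewrite /= lebesgue_measure_itv/= ltNyr; exact: ltry.
Qed.

Lemma barG_s_ge0 t : 0 <= G t. Proof. exact/ltW/barG_s_gt0. Qed.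

Definition mass_g_s := \int[lam]_t g t.

Lemma EFin_mass_g_s : mass_g_s%:E = (\int[lam]_t (g t)%:E)%E.
Proof. by apply: ge0_integral_lty_fin => [t|]; [exact: g_s_ge0|exact: integral_g_s_lty]. Qed.

Lemma barG_s_le t : G t <= mass_g_s.
Proof.
rewrite -lee_fin EFin_barG_s EFin_mass_g_s.
by apply: ge0_subset_integral => // x _; exact: g0.
Qed.

Lemma mass_g_s_ge0 : 0 <= mass_g_s.
Proof. exact: le_trans (barG_s_ge0 0) (barG_s_le 0). Qed.

Let S : set (measurableTypeR R * measurableTypeR R) := [set z | z.2 <= z.1].

Let mS : measurable S.
Proof. by apply: measurable_setb; exact: measurable_fun_ler. Qed.

Let F (z : measurableTypeR R * measurableTypeR R) : \bar R := (\1_S z * g z.2)%:E.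

Let mF : measurable_fun setT F.
Proof.
apply/measurable_EFinP; apply: measurable_funM; first exact: measurable_indic.
exact: (measurableT_comp measurable_g_s measurable_snd).
Qed.

Let F0 z : (0 <= F z)%E. Proof. by rewrite lee_fin mulr_ge0// g_s_ge0. Qed.

Let EFin_barG_sF t : (G t)%:E = (\int[lam]_x F (t, x))%E.
Proof.
rewrite EFin_barG_s integral_mkcond; apply: eq_integral => x _.
rewrite /F patchE indicE (_ : ((t, x) \in S) = (x \in `]-oo, t]%classic)); last first.
  by rewrite /S !mem_setE/= in_itv.
by case: ifP => _; rewrite ?mul1r ?mul0r.
Qed.

(** [barG_s] is the section integral of [g_s] over the half-plane [S], so Tonelli applies. *)
Lemma measurable_barG_s : measurable_fun setT G.
Proof.
apply/measurable_EFinP; rewrite (_ : _ \o _ = fubini_F lam F).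
  exact: measurable_fun_fubini_tonelli_F.
by apply/funext => t; exact: EFin_barG_sF.
Qed.

Let mG : measurable_fun setT (EFin \o G).
Proof. by apply/measurable_EFinP; exact: measurable_barG_s. Qed.

Let G0 t : (0 <= (EFin \o G) t)%E. Proof. by rewrite lee_fin barG_s_ge0. Qed.

(** Extended-valued, so that the identities for it can be stated and used before any finiteness is
    known. *)
Definition Phi_s (w : R) : \bar R := (\int[lam]_(t in `]-oo, w]) (G t)%:E)%E.

Lemma Phi_s_ge0 w : (0 <= Phi_s w)%E.
Proof. by apply: integral_ge0 => t _; exact: G0. Qed.

(** Exchanging the two integrals gives the integral of |x| [g_s] x over x <= 0: a given x is counted
    for t in [x, 0], of length |x|. *)
Lemma Phi_s0_lty : (Phi_s 0 < +oo)%E.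
Proof.
rewrite /Phi_s integral_mkcond.
pose F' (z : measurableTypeR R * measurableTypeR R) : \bar R :=
  ((\1_[set z : measurableTypeR R * measurableTypeR R | (z.1 <= 0)%R] z)%:E * F z)%E.
have mF' : measurable_fun setT F'.
  apply: emeasurable_funM => //; apply/measurable_EFinP; apply: measurable_indic.
  by apply: measurable_setb; exact: measurable_fun_ler.
have F'0 z : (0 <= F' z)%E by rewrite mule_ge0.
have -> : (\int[lam]_t ((EFin \o G) \_ `]-oo, 0%R]%classic) t = \int[lam]_t \int[lam]_x F' (t, x))%E.
  apply: eq_integral => t _; rewrite patchE.
  under [RHS]eq_integral => x _.
    rewrite /F' indicE (_ : ((t, x) \in _) = (t \in `]-oo, 0%R]%classic)); last first.
      by rewrite !mem_setE/= in_itv.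
    over.
  case: ifP => _; last by rewrite integral0_eq// => x _; rewrite mul0e.
  by under [RHS]eq_integral do rewrite mul1e; exact: EFin_barG_sF.
rewrite (fubini_tonelli _ mF' F'0).
apply: (@le_lt_trans _ _ (\int[lam]_t (japanese (n%:R + s) t)%:E)%E); last first.
  by apply: integral_japanese_lty.
apply: ge0_le_integralT.
- exact: measurable_fun_fubini_tonelli_G.
- by apply/measurable_EFinP; exact: measurable_japanese.
- by move=> x; apply: integral_ge0 => t _; exact: F'0.
move=> x; apply: (@le_trans _ _ (`|x| * g x)%:E); last by rewrite lee_fin norm_g_s_le_japanese.
have -> : (\int[lam]_t F' (t, x) = \int[lam]_(t in `[x, 0%R]) (cst (g x)%:E t))%E.
  rewrite [RHS]integral_mkcond; apply: eq_integral => t _.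
  rewrite patchE /F' /F !indicE -EFinM mulrA -natrM mulnb.
  rewrite (_ : (_ && _) = (t \in `[x, 0%R]%classic)); last first.
    by rewrite /S !mem_setE/= in_itv/= andbC.
  by case: ifP => _; rewrite ?mul1r ?mul0r.
rewrite integral_cst//= lebesgue_measure_itv/= lte_fin.
case: ifPn => x0; last by rewrite mule0 lee_fin mulr_ge0// g_s_ge0.
by rewrite -EFinB -EFinM lee_fin sub0r ltr0_norm// mulrC.
Qed.

End profile.

(** * Reflection identities and linear growth of the profile *)

Section profile_identities.
Variables (R : realType) (n : nat) (s : R).
Hypotheses (n_ge1 : (1 <= n)%N) (s0 : 0 < s).
Local Notation lam := (@lebesgue_measure R).
Local Notation g := (@g_s R n s).
Local Notation G := (@barG_s R n s).
Local Notation C := (mass_g_s n s).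

Let mg := measurable_g_s n s.
Let mG := measurable_barG_s n_ge1 s0.
Let mgE : measurable_fun setT (EFin \o g).
Proof. exact/measurable_EFinP. Qed.
Let mGE : measurable_fun setT (EFin \o G).
Proof. exact/measurable_EFinP. Qed.
Let g0 t : (0 <= (EFin \o g) t)%E. Proof. by rewrite lee_fin g_s_ge0. Qed.
Let G0 t : (0 <= (EFin \o G) t)%E.
Proof. by rewrite lee_fin; exact: barG_s_ge0. Qed.

Lemma g_s_le1 t : g t <= 1.
Proof.
rewrite /g_s powRN invf_le1; last by rewrite powR_gt0// ltr_pwDl// sqr_ge0.
rewrite -[leLHS](powRr0 (1 + t ^+ 2)); apply: ler_powR; first by rewrite lerDl sqr_ge0.
by have := s0; have : (0 : R) <= n%:R by []; lra.
Qed.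

Lemma EFin_oint_g_s a b : a <= b ->
  (oint a b g)%:E = (\int[lam]_(t in `[a, b]) (g t)%:E)%E.
Proof. by apply: (@EFin_oint R g 1) => // t; rewrite g_s_ge0 g_s_le1. Qed.

Lemma EFin_oint_barG_s a b : a <= b ->
  (oint a b G)%:E = (\int[lam]_(t in `[a, b]) (G t)%:E)%E.
Proof.
by apply: (@EFin_oint R G C) => // t; rewrite barG_s_ge0//= barG_s_le.
Qed.

(** The inner integral of [calG_s], made even and nonnegative by the absolute value. The signs of
    [oint] are then handled once, in [EFin_calG_s]. *)
Definition half_mass (t : R) : R := oint 0 `|t| g.

Lemma EFin_half_mass t : (half_mass t)%:E = (\int[lam]_(x in `[0%R, `|t|%R]) (g x)%:E)%E.
Proof. exact: EFin_oint_g_s. Qed.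

Lemma half_mass_ge0 t : 0 <= half_mass t.
Proof. by rewrite -lee_fin EFin_half_mass; apply: integral_ge0 => x _; exact: g0. Qed.

Lemma half_mass_le t : half_mass t <= C.
Proof.
rewrite -lee_fin EFin_half_mass EFin_mass_g_s//.
by apply: ge0_subset_integral => // x _; exact: g0.
Qed.

Lemma measurable_half_mass : measurable_fun setT half_mass.
Proof. by apply: measurable_oint => // t; exact: g_s_ge0. Qed.

Let mH : measurable_fun setT (EFin \o half_mass).
Proof. by apply/measurable_EFinP; exact: measurable_half_mass. Qed.

Let H0 t : (0 <= (EFin \o half_mass) t)%E.
Proof. by rewrite lee_fin half_mass_ge0. Qed.

Lemma integral_g_s_sym t : 0 <= t ->
  (\int[lam]_(x in `](- t)%R, t]) (g x)%:E = (half_mass t)%:E + (half_mass t)%:E)%E.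
Proof.
move=> t0; rewrite (ge0_integral_itv_split (b := BRight 0) mgE g0) ?bnd_simp ?oppr_le0//.
rewrite EFin_half_mass ger0_norm//; congr (_ + _)%E; last first.
  by rewrite integral_itv_obnd_cbnd//; exact: measurable_funTS.
transitivity (\int[lam]_(x in -%R @^-1` `](- t)%R, 0%R]) (g (- x)%R)%:E)%E.
  by apply/esym; apply: (ge0_integral_opp _ mgE g0).
rewrite opp_preimage_itvbndbnd/= oppr0 opprK.
rewrite integral_itv_bndo_bndc; last first.
  by apply: measurable_funTS; exact: (measurableT_comp mgE).
by apply: eq_integral => x _; rewrite g_sN.
Qed.

(** Evenness of [g_s] on [-t, t]. Integrated over [0, w], it becomes [Phi_s_refl]. *)
Lemma barG_s_refl t : 0 <= t -> G t = G (- t) + (half_mass t + half_mass t).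
Proof.
move=> t0; apply: EFin_inj; rewrite EFinD !EFin_barG_s//.
rewrite (ge0_integral_itv_split (b := BRight (- t)) mgE g0) ?bnd_simp ?ge0_cp//.
by rewrite integral_g_s_sym.
Qed.

Lemma Phi_s_split v w : v <= w ->
  (Phi_s n s w = Phi_s n s v + \int[lam]_(t in `[v, w]) (G t)%:E)%E.
Proof.
move=> vw; rewrite -(@integral_itv_obnd_cbnd _ v (BRight w) (fun t => (G t)%:E)).
  by apply: (ge0_integral_itv_split mGE G0); rewrite ?bnd_simp.
exact: measurable_funTS.
Qed.

Lemma Phi_s_refl w : 0 <= w ->
  (Phi_s n s w + Phi_s n s (- w) = Phi_s n s 0 + Phi_s n s 0 +
   (\int[lam]_(t in `[0%R, w]) (half_mass t)%:E + \int[lam]_(t in `[0%R, w]) (half_mass t)%:E))%E.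
Proof.
move=> w0.
have Pw := Phi_s_split w0.
have mGN : measurable_fun setT (fun t : R => (G (- t))%:E) by exact: (measurableT_comp mGE).
have P0 : (Phi_s n s 0 = Phi_s n s (- w) + \int[lam]_(t in `[0%R, w]) (G (- t)%R)%:E)%E.
  have Nw0 : - w <= 0 by rewrite oppr_le0.
  have E : (\int[lam]_(t in `[(- w)%R, 0%R]) (G t)%:E = \int[lam]_(t in `[0%R, w]) (G (- t)%R)%:E)%E.
    transitivity (\int[lam]_(x in -%R @^-1` `[(- w)%R, 0%R]) (G (- x)%R)%:E)%E.
      by apply/esym; apply: (ge0_integral_opp _ mGE G0).
    by rewrite opp_preimage_itvbndbnd/= oppr0 opprK.
  exact: (eq_trans (Phi_s_split Nw0) (f_equal (fun z => Phi_s n s (- w) + z)%E E)).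
have GH : (\int[lam]_(t in `[0%R, w]) (G t)%:E =
    \int[lam]_(t in `[0%R, w]) (G (- t)%R)%:E +
    (\int[lam]_(t in `[0%R, w]) (half_mass t)%:E + \int[lam]_(t in `[0%R, w]) (half_mass t)%:E))%E.
  have mD (f : R -> \bar R) : measurable_fun setT f -> measurable_fun `[0%R, w]%classic f.
    exact: measurable_funTS.
  rewrite -(ge0_integralD lam (measurable_itv _) (fun t _ => H0 t) (mD _ mH) (fun t _ => H0 t) (mD _ mH)).
  have HH0 t : `[0%R, w]%classic t -> (0 <= (EFin \o half_mass) t + (EFin \o half_mass) t)%E.
    by move=> _; apply: adde_ge0; exact: H0.
  have mHH := mD _ (emeasurable_funD mH mH).
  rewrite -(ge0_integralD lam (measurable_itv _) (fun t _ => G0 (- t)) (mD _ mGN) HH0 mHH).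
  apply: eq_integral => t; rewrite inE/= in_itv/= => /andP[t0 _].
  by rewrite {1}barG_s_refl.
move: Pw P0 GH.
(* What is left is an identity between sums of extended reals, obtained by rearrangement alone:
   nothing is cancelled, so infinite values do no harm. *)
move: (Phi_s n s w) (Phi_s n s (- w)) (Phi_s n s 0) => a b c.
move: (integral _ _ _) (integral _ _ _) (integral _ _ _) => i j k -> E ->.
transitivity (c + ((b + j) + (i + i)))%E; last by rewrite -E addeA.
by rewrite -addeA; congr (_ + _)%E; rewrite addeC (addeA b).
Qed.

(** For w < 0 both the outer and the inner integral run backwards, and the two signs cancel. *)
Lemma EFin_calG_s w :
  (calG_s n s w)%:E = (\int[lam]_(t in `[0%R, `|w|%R]) (half_mass t)%:E)%E.
Proof.
have HB t : 0 <= half_mass t <= C by rewrite half_mass_ge0 half_mass_le.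
have [w0|w0] := leP 0 w.
  rewrite (ger0_norm w0) -(EFin_oint measurable_half_mass HB w0); apply: (congr1 EFin).
  rewrite /calG_s /oint w0; apply: eq_Rintegral => t.
  by rewrite inE/= in_itv/= => /andP[t0 _]; rewrite /half_mass ger0_norm.
rewrite ltr0_norm//.
have Nw0 : 0 <= - w by rewrite oppr_ge0 ltW.
transitivity (\int[lam]_(t in `[w, 0%R]) (half_mass t)%:E)%E; last first.
  transitivity (\int[lam]_(x in -%R @^-1` `[w, 0%R]) (half_mass (- x)%R)%:E)%E.
    by apply/esym; apply: (ge0_integral_opp _ mH H0).
  rewrite opp_preimage_itvbndbnd/= oppr0; apply: eq_integral => t _.
  by rewrite /half_mass normrN.
rewrite -(EFin_oint measurable_half_mass HB (ltW w0)); apply: (congr1 EFin).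
rewrite /calG_s /oint leNgt w0/= ltW//.
rewrite -[RHS]opprK; apply: (congr1 -%R).
rewrite /Rintegral -fineN -integral_ge0N; last by move=> t _; exact: H0.
apply: (congr1 fine); apply: eq_integral => t; rewrite inE/= in_itv/= => /andP[_ t0].
apply: (congr1 EFin); rewrite /half_mass.
(* At t = 0 [oint 0 t] takes its branch without sign, hence the separate case. *)
have [t00|t00] := leP 0 t.
  have -> : t = 0 by apply/eqP; rewrite eq_le t0 t00.
  by rewrite normr0 /oint lexx set_itv1 Rintegral_set1 integral_set1 oppr0.
rewrite ltr0_norm//; apply: (congr1 -%R).
have Nt0 : 0 <= - t by rewrite oppr_ge0 ltW.
apply: EFin_inj; rewrite EFin_oint_g_s//.
transitivity (oint t 0 g)%:E; first by rewrite /oint ltW.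
rewrite EFin_oint_g_s ?ltW//.
transitivity (\int[lam]_(x in -%R @^-1` `[t, 0%R]) (g (- x)%R)%:E)%E.
  by apply/esym; apply: (ge0_integral_opp _ mgE g0).
rewrite opp_preimage_itvbndbnd/= oppr0; apply: eq_integral => x _.
by rewrite g_sN.
Qed.

(** Doubles are written as sums, the form that [adde_self_inj] halves even at infinity. *)
Lemma Phi_s_sym w : (Phi_s n s w + Phi_s n s (- w) =
  (Phi_s n s 0 + (calG_s n s w)%:E) + (Phi_s n s 0 + (calG_s n s w)%:E))%E.
Proof.
rewrite EFin_calG_s [RHS]addeACA; have [w0|w0] := leP 0 w.
  by rewrite ger0_norm//; exact: Phi_s_refl.
have Nw0 : 0 <= - w by rewrite oppr_ge0 ltW.
by rewrite ltr0_norm// -Phi_s_refl// opprK addeC.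
Qed.

Lemma calG_s_ge0 w : 0 <= calG_s n s w.
Proof. by rewrite -lee_fin EFin_calG_s; apply: integral_ge0 => t _; exact: H0. Qed.

Lemma measurable_calG_s : measurable_fun setT (calG_s n s).
Proof.
apply/measurable_EFinP.
rewrite (_ : _ \o _ = fun w => (\int[lam]_(t in `[0%R, `|w|%R]) (half_mass t)%:E)%E); last first.
  by apply/funext => w; exact: EFin_calG_s.
apply: measurable_fun_itv_integral => //; exact: measurable_half_mass.
Qed.

(** The slope of [calG_s] is a [half_mass], at most the total mass of [g_s]. This bounds the area
    functional by the Gagliardo seminorm. *)
Lemma calG_s_le w : calG_s n s w <= C * `|w|.
Proof.
rewrite -lee_fin EFin_calG_s.
apply: (@le_trans _ _ (\int[lam]_(t in `[0%R, `|w|%R]) (cst C%:E t))%E).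
  apply: ge0_le_integral => //.
  - by move=> t _; exact: H0.
  - exact: measurable_funTS.
  - by move=> t _; rewrite lee_fin half_mass_le.
rewrite integral_cst//= lebesgue_measure_itv/= lte_fin.
case: ifP => _; first by rewrite -EFinB -EFinM subr0.
by rewrite mule0 lee_fin mulr_ge0// mass_g_s_ge0.
Qed.

(** [half_mass] increases with |t|, so beyond 1 the slope of [calG_s] is at least [half_mass 1]; the
    additive 1 pays for [0, 1], where the slope degenerates at 0. *)
Lemma norm_le_calG_s w : `|w| <= calG_s n s w / half_mass 1 + 1.
Proof.
have c0 : 0 < half_mass 1.
  rewrite -lte_fin EFin_half_mass; apply: integral_gt0 => //.
  - exact: measurable_funTS.
  - by move=> t _; rewrite lte_fin g_s_gt0.
  - by rewrite /= lebesgue_measure_itv/= lte_fin normr1 ltr01 -EFinB lte_fin subr0.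
have [w1|w1] := leP `|w| 1; first by rewrite (le_trans w1)// lerDr divr_ge0 ?calG_s_ge0 ?ltW.
rewrite -lerBlDr ler_pdivlMr// -lee_fin EFin_calG_s.
apply: (@le_trans _ _ (\int[lam]_(t in `[1%R, `|w|%R]) (half_mass t)%:E)%E); last first.
  apply: ge0_subset_integral => //.
  - exact: measurable_funTS.
  - by move=> t _; exact: H0.
  - by move=> t /=; rewrite !in_itv/= => /andP[t1 ->]; rewrite (le_trans _ t1).
apply: (@le_trans _ _ (\int[lam]_(t in `[1%R, `|w|%R]) (cst (half_mass 1)%:E t))%E).
  rewrite integral_cst//= lebesgue_measure_itv/= lte_fin w1.
  by rewrite -EFinB -EFinM mulrC.
apply: ge0_le_integral => //.
- by move=> t _; rewrite lee_fin ltW.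
- exact: measurable_funTS.
move=> t /=; rewrite in_itv/= => /andP[t1 _].
rewrite !EFin_half_mass; apply: ge0_subset_integral => //.
- exact: measurable_funTS.
- by move=> x _; exact: g0.
move=> x /=; rewrite !in_itv/= => /andP[-> x1]/=; rewrite (le_trans x1)// normr1.
by rewrite (le_trans t1)// ler_norm.
Qed.

End profile_identities.

(** * Interactions as integrals over pairs of vertical lines *)

Section interaction.
Context d (T : measurableType d) (R : realType).
Variable mu : {sigma_finite_measure set T -> \bar R}.
Local Notation lam := (@lebesgue_measure R).
Local Notation T1 := (T * measurableTypeR R)%type.
Variable K : T1 -> T1 -> R.
Hypothesis K0 : forall X Y, 0 <= K X Y.
Hypothesis mK : measurable_fun setT (fun Z : T1 * T1 => K Z.1 Z.2).

Definition fiber_interaction (A B : set T1) (z : T * T) : \bar R :=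
  (\int[lam]_t \int[lam]_v (\1_A (z.1, t) * \1_B (z.2, v) * K (z.1, t) (z.2, v))%:E)%E.

Section measurable_sets.
Variables (A B : set T1).
Hypotheses (mA : measurable A) (mB : measurable B).

Let k (Z : T1 * T1) : \bar R := (\1_A Z.1 * \1_B Z.2 * K Z.1 Z.2)%:E.

Let k0 Z : (0 <= k Z)%E.
Proof. by rewrite lee_fin !mulr_ge0. Qed.

Let mk : measurable_fun setT k.
Proof.
apply/measurable_EFinP; apply: measurable_funM => //; apply: measurable_funM.
  have m1A : measurable_fun [set: T1] (\1_A : T1 -> R) by exact: measurable_indic.
  exact: (measurableT_comp m1A measurable_fst).
have m1B : measurable_fun [set: T1] (\1_B : T1 -> R) by exact: measurable_indic.
exact: (measurableT_comp m1B measurable_snd).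
Qed.

(** Puts the two vertical variables last, so that integrating them out consists of two successive
    sections. *)
Let pack (w : ((T * T) * measurableTypeR R) * measurableTypeR R) : T1 * T1 :=
  ((w.1.1.1, w.1.2), (w.1.1.2, w.2)).

Let mpack : measurable_fun setT pack.
Proof.
have m11 : measurable_fun setT (fun w : ((T * T) * measurableTypeR R) * measurableTypeR R => w.1.1).
  exact: (measurableT_comp measurable_fst measurable_fst).
apply: measurable_fun_pair; apply: measurable_fun_pair.
- exact: (measurableT_comp measurable_fst m11).
- exact: (measurableT_comp measurable_snd measurable_fst).
- exact: (measurableT_comp measurable_snd m11).
- exact: measurable_snd.
Qed.

Let k1 : (T * T) * measurableTypeR R -> \bar R := fubini_F lam (k \o pack).

Let k10 w : (0 <= k1 w)%E. Proof. by apply: integral_ge0 => t _; exact: k0. Qed.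

Let mk1 : measurable_fun setT k1.
Proof.
apply: measurable_fun_fubini_tonelli_F; last by move=> w; exact: k0.
exact: measurableT_comp mk mpack.
Qed.

Lemma measurable_fiber_interaction : measurable_fun setT (fiber_interaction A B).
Proof. exact: (measurable_fun_fubini_tonelli_F _ mk1 k10). Qed.

Lemma fiber_interaction_ge0 z : (0 <= fiber_interaction A B z)%E.
Proof. by apply: integral_ge0 => t _; apply: integral_ge0 => v _; rewrite lee_fin !mulr_ge0. Qed.

(** The left side integrates in the order x, t, y, v and the right side in the order x, y, t, v. The
    only exchange is that of t and y, at fixed x. *)
Lemma interactionE :
  (\int[mu \x lam]_(X in A) \int[mu \x lam]_(Y in B) (K X Y)%:E =
   \int[mu \x mu]_z fiber_interaction A B z)%E.
Proof.
transitivity (\int[mu \x lam]_X \int[mu \x lam]_Y k (X, Y))%E.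
  rewrite integral_mkcond; apply: eq_integral => X _; rewrite patchE.
  rewrite /k /= indicE; case: ifP => _; last first.
    by rewrite integral0_eq// => Y _; rewrite !mul0r.
  rewrite integral_mkcond; apply: eq_integral => Y _; rewrite patchE indicE mul1r.
  by case: ifP => _; rewrite ?mul1r ?mul0r.
rewrite (fubini_tonelli1 _ measurable_fiber_interaction fiber_interaction_ge0).
pose h X := (\int[mu \x lam]_Y k (X, Y))%E.
have hE X : h X = (\int[mu]_y \int[lam]_v k (X, (y, v)))%E.
  rewrite /h (fubini_tonelli1 (fun Y => k (X, Y)))//.
  exact: (measurableT_comp mk (measurable_pair1 _)).
have mkX : measurable_fun setT (fun w : (T1 * T) * measurableTypeR R => k (w.1.1, (w.1.2, w.2))).
  apply: (measurableT_comp mk); apply: measurable_fun_pair.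
    exact: (measurableT_comp measurable_fst measurable_fst).
  apply: measurable_fun_pair; last exact: measurable_snd.
  exact: (measurableT_comp measurable_snd measurable_fst).
have mk2 := measurable_fun_fubini_tonelli_F (m2 := lam) _ mkX (fun=> k0 _).
have k20 (w : T1 * T) : (0 <= fubini_F lam (fun w : (T1 * T) * measurableTypeR R => k (w.1.1, (w.1.2, w.2))) w)%E.
  by apply: integral_ge0 => t _; exact: k0.
have mh : measurable_fun setT h.
  have := measurable_fun_fubini_tonelli_F (m2 := mu) _ mk2 k20.
  by rewrite (_ : fubini_F _ _ = h)//; apply/funext => X; rewrite hE.
have h0 X : (0 <= h X)%E by apply: integral_ge0 => Y _; exact: k0.
rewrite (fubini_tonelli1 h mh h0).
apply: eq_integral => x _; rewrite /fubini_F.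
under eq_integral do rewrite hE.
pose f (w : measurableTypeR R * T) := (\int[lam]_v k ((x, w.1), (w.2, v)))%E.
rewrite (fubini_tonelli f).
- by [].
- apply: (measurable_fun_fubini_tonelli_F (fun w : (measurableTypeR R * T) * measurableTypeR R => k ((x, w.1.1), (w.1.2, w.2)))) => //.
  apply: (measurableT_comp mk); apply: measurable_fun_pair; apply: measurable_fun_pair => //.
  + exact: (measurableT_comp measurable_fst measurable_fst).
  + exact: (measurableT_comp measurable_snd measurable_fst).
- by move=> w; apply: integral_ge0 => t _; exact: k0.
Qed.

End measurable_sets.

End interaction.

(** * Closed formulas for interactions between two vertical lines *)

Section line_interaction.
Variables (R : realType) (n : nat) (s : R).
Hypotheses (n_ge1 : (1 <= n)%N) (s0 : 0 < s).
Local Notation lam := (@lebesgue_measure R).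
Local Notation g := (@g_s R n s).
Local Notation G := (@barG_s R n s).

Definition kern (r h : R) : R := (Num.sqrt (r ^+ 2 + h ^+ 2) `^ (n%:R + 1 + s))^-1.

Lemma kern_ge0 r h : 0 <= kern r h.
Proof. by rewrite invr_ge0 powR_ge0. Qed.

(** Homogeneity: with r factored out, the kernel on two lines at distance r is the profile [g_s] of
    the slope h / r. *)
Lemma kern_scale r h : 0 < r -> kern r h = r `^ (- (n%:R + 1 + s)) * g (h / r).
Proof.
move=> r0; rewrite /kern /g_s; set p := n%:R + 1 + s.
have -> : r ^+ 2 + h ^+ 2 = r ^+ 2 * (1 + (h / r) ^+ 2) by field; rewrite gt_eqF.
rewrite sqrtrM ?sqr_ge0// sqrtr_sqr gtr0_norm// powRM ?sqrtr_ge0 ?ltW// invfM powRN.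
congr (_ * _); rewrite powRN -powR12_sqrt; last by rewrite addr_ge0// sqr_ge0.
by rewrite -powRrM; congr (_ `^ _)^-1; rewrite mulrC.
Qed.

Definition line_interaction (r : R) (S V : set (measurableTypeR R)) : \bar R :=
  (\int[lam]_t \int[lam]_v (\1_S t * \1_V v * kern r (t - v))%:E)%E.

Let mg := measurable_g_s n s.
Let mG := measurable_barG_s n_ge1 s0.

Lemma measurable_kern d (T : measurableType d) (r h : T -> R) :
  measurable_fun setT r -> measurable_fun setT h ->
  measurable_fun setT (fun x => kern (r x) (h x)).
Proof.
move=> mr mh; under eq_fun do rewrite /kern -powRN.
apply: (measurableT_comp (measurable_powR _)); apply: measurableT_comp.
  by apply: continuous_measurable_fun; exact: sqrt_continuous.
by apply: measurable_funD; exact: measurable_funX.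
Qed.

(** The two factors r are the Jacobians of the substitutions on the two lines. *)
Lemma powR_rr (r : R) : 0 < r -> r * (r * r `^ (- (n%:R + 1 + s))) = (r `^ (n%:R - 1 + s))^-1.
Proof.
move=> r0; have rD x : r * r `^ x = r `^ (1 + x).
  by rewrite -[X in X * _](powRr1 (ltW r0)) -powRD// (gt_eqF r0) implybT.
by rewrite !rD -powRN; congr (_ `^ _); lra.
Qed.

(* the substitution [v = t - r x] *)
Lemma integral_kern_right r t b : 0 < r ->
  (\int[lam]_v (\1_(`[b, +oo[%classic : set (measurableTypeR R)) v * kern r (t - v))%:E
   = (r * r `^ (- (n%:R + 1 + s)) * G ((t - b) / r))%:E)%E.
Proof.
move=> r0; have rN0 : - r != 0 by rewrite oppr_eq0 gt_eqF.
have rn0 : r != 0 by rewrite gt_eqF.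
under eq_integral => v _ do rewrite kern_scale//.
rewrite (ge0_integral_affine t rN0); last 2 first.
- apply/measurable_EFinP; apply: measurable_funM; first exact: measurable_indic.
  apply: measurable_funM => //; apply: (measurableT_comp mg).
  by apply: measurable_funM => //; exact: measurable_funB.
- by move=> v; rewrite lee_fin !mulr_ge0// ?powR_ge0// g_s_ge0.
rewrite normrN gtr0_norm// -mulrA EFinM; congr (_ * _)%E.
rewrite EFinM EFin_barG_s// -ge0_integralZl//; last 3 first.
- exact/measurable_EFinP/measurable_funTS.
- by move=> x _; rewrite lee_fin g_s_ge0.
- by rewrite lee_fin powR_ge0.
rewrite [RHS]integral_mkcond; apply: eq_integral => x _.
rewrite patchE indicE (_ : (_ \in _) = (x \in `]-oo, ((t - b) / r)%R]%classic)); last first.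
  rewrite !mem_setE/= !in_itv/= andbT ler_pdivlMr//; apply/idP/idP; lra.
case: ifP => _; last by rewrite mul0r.
rewrite mul1r -EFinM; congr (_ * g _)%:E; field => //.
Qed.

(** The substitution t = v + r x; closing the open end of the half-line changes nothing. *)
Lemma integral_kern_left r v b : 0 < r ->
  (\int[lam]_t (\1_(`]-oo, b[%classic : set (measurableTypeR R)) t * kern r (t - v))%:E
   = (r * r `^ (- (n%:R + 1 + s)) * G ((b - v) / r))%:E)%E.
Proof.
move=> r0; have rn0 : r != 0 by rewrite gt_eqF.
under eq_integral => t _ do rewrite kern_scale//.
rewrite (ge0_integral_affine v rn0); last 2 first.
- apply/measurable_EFinP; apply: measurable_funM; first exact: measurable_indic.
  apply: measurable_funM => //; apply: (measurableT_comp mg).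
  by apply: measurable_funM => //; exact: measurable_funB.
- by move=> t; rewrite lee_fin !mulr_ge0// ?powR_ge0// g_s_ge0.
rewrite gtr0_norm// -mulrA EFinM; congr (_ * _)%E.
rewrite EFinM EFin_barG_s// -integral_itv_bndo_bndc; last first.
  exact/measurable_EFinP/measurable_funTS.
rewrite -ge0_integralZl//; last 3 first.
- exact/measurable_EFinP/measurable_funTS.
- by move=> x _; rewrite lee_fin g_s_ge0.
- by rewrite lee_fin powR_ge0.
rewrite [RHS]integral_mkcond; apply: eq_integral => x _.
rewrite patchE indicE (_ : (_ \in _) = (x \in `]-oo, ((b - v) / r)%R[%classic)); last first.
  rewrite !mem_setE/= !in_itv/= ltr_pdivlMr//; apply/idP/idP; lra.
case: ifP => _; last by rewrite mul0r.
rewrite mul1r -EFinM; congr (_ * g _)%:E; field => //.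
Qed.

Let G0 t : 0 <= G t. Proof. exact: barG_s_ge0. Qed.

Let mGE : measurable_fun setT (EFin \o G).
Proof. exact/measurable_EFinP. Qed.

Let mGN : measurable_fun setT (fun t : R => (G (- t))%:E).
Proof. exact: (measurableT_comp mGE). Qed.

(** The set S on the first line is left arbitrary so that the half-line and the strip below are both
    instances. *)
Lemma line_interaction_upper r S b : 0 < r -> measurable S ->
  line_interaction r S `[b, +oo[%classic =
  ((r `^ (n%:R - 1 + s))^-1%:E *
     \int[lam]_t (\1_S (r * t + b) * G t)%:E)%E.
Proof.
move=> r0 mS; have rn0 : r != 0 by rewrite gt_eqF.
have mS1 : measurable_fun [set: R] (\1_S : R -> R) by exact: measurable_indic.
have c0 : 0 <= r * r `^ (- (n%:R + 1 + s)) by rewrite mulr_ge0 ?powR_ge0 ?ltW.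
rewrite /line_interaction.
transitivity (\int[lam]_t ((r * r `^ (- (n%:R + 1 + s)))%:E * (\1_S t * G ((t - b) / r))%:E))%E.
  apply: eq_integral => t _; under eq_integral => v _ do rewrite -mulrA EFinM.
  rewrite ge0_integralZl//; last 2 first.
  - apply/measurable_EFinP; apply: measurable_funM; first exact: measurable_indic.
    by apply: measurable_kern => //; exact: measurable_funB.
  - by move=> v _; rewrite lee_fin mulr_ge0// kern_ge0.
  by rewrite integral_kern_right// -!EFinM; congr EFin; rewrite mulrCA mulrA.
have mf : measurable_fun setT (fun t => (\1_S t * G ((t - b) / r))%:E).
  apply/measurable_EFinP; apply: measurable_funM => //; apply: (measurableT_comp mG).
  by apply: measurable_funM => //; exact: measurable_funB.
have f0 t : (0 <= (\1_S t * G ((t - b) / r))%:E)%E by rewrite lee_fin mulr_ge0.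
rewrite (ge0_integralZl_EFin _ measurableT (fun t _ => f0 t) mf c0).
rewrite (ge0_integral_affine b rn0 mf f0).
rewrite (gtr0_norm r0) muleA -EFinM [X in X%:E]mulrC (powR_rr r0); apply: (congr2 mule erefl).
apply: eq_integral => t _; congr (_ * G _)%:E; field => //.
Qed.

Lemma line_interaction_half r a b : 0 < r ->
  line_interaction r `]-oo, a[%classic `[b, +oo[%classic =
  ((r `^ (n%:R - 1 + s))^-1%:E * Phi_s n s ((a - b) / r))%E.
Proof.
move=> r0; rewrite line_interaction_upper//; apply: (congr2 mule erefl).
rewrite /Phi_s -integral_itv_bndo_bndc; last exact: measurable_funTS.
rewrite [RHS]integral_mkcond; apply: eq_integral => t _.
rewrite patchE indicE (_ : (_ \in _) = (t \in `]-oo, ((a - b) / r)%R[%classic)); last first.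
  rewrite !mem_setE/= !in_itv/= ltr_pdivlMr//; apply/idP/idP; lra.
by case: ifP => _; rewrite ?mul1r ?mul0r.
Qed.

Lemma line_interaction_strip r c a b : 0 < r -> c <= a ->
  line_interaction r `]c, a[%classic `[b, +oo[%classic =
  (oint ((c - b) / r) ((a - b) / r) G / r `^ (n%:R - 1 + s))%:E.
Proof.
move=> r0 ca; rewrite line_interaction_upper// mulrC EFinM; apply: (congr2 mule erefl).
rewrite EFin_oint_barG_s//; last by rewrite ler_pM2r ?invr_gt0// lerD2r.
rewrite -integral_itv_bndo_bndc; last exact: measurable_funTS.
rewrite -integral_itv_obnd_cbnd; last exact: measurable_funTS.
rewrite [RHS]integral_mkcond; apply: eq_integral => t _.
rewrite patchE indicE (_ : (_ \in _) = (t \in `]((c - b) / r)%R, ((a - b) / r)%R[%classic)); last first.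
  rewrite !mem_setE/= !in_itv/= ltr_pdivlMr// ltr_pdivrMr//.
  by apply/idP/idP => /andP[? ?]; apply/andP; split; lra.
by case: ifP => _; rewrite ?mul1r ?mul0r.
Qed.

(** The unbounded set is now on the first line, so the order is exchanged to integrate it first. The
    substitution v = b + r t then turns (b - v) / r into -t, whence the reflected [barG_s]. *)
Lemma line_interaction_strip_lower r a c b : 0 < r -> a <= c ->
  line_interaction r `]-oo, b[%classic `[a, c[%classic =
  (oint ((a - b) / r) ((c - b) / r) (fun t => G (- t)) / r `^ (n%:R - 1 + s))%:E.
Proof.
move=> r0 ac; have rn0 : r != 0 by rewrite gt_eqF.
have c0 : 0 <= r * r `^ (- (n%:R + 1 + s)) by rewrite mulr_ge0 ?powR_ge0 ?ltW.
pose f (z : measurableTypeR R * measurableTypeR R) : \bar R :=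
  (\1_(`]-oo, b[%classic : set (measurableTypeR R)) z.1 * \1_(`[a, c[%classic : set (measurableTypeR R)) z.2 * kern r (z.1 - z.2))%:E.
have mi (A : set (measurableTypeR R)) : measurable A ->
    measurable_fun [set: measurableTypeR R] (\1_A : _ -> R) by move=> mA; exact: measurable_indic.
have mf : measurable_fun setT f.
  apply/measurable_EFinP; apply: measurable_funM.
    apply: measurable_funM.
      exact: (measurableT_comp (mi _ (measurable_itv _)) measurable_fst).
    exact: (measurableT_comp (mi _ (measurable_itv _)) measurable_snd).
  by apply: measurable_kern => //; exact: measurable_funB.
have f0 z : (0 <= f z)%E by rewrite lee_fin !mulr_ge0// kern_ge0.
rewrite /line_interaction (fubini_tonelli f mf f0) /f/=.
transitivity (\int[lam]_v ((r * r `^ (- (n%:R + 1 + s)))%:E * (\1_(`[a, c[%classic : set (measurableTypeR R)) v * G ((b - v) / r))%:E))%E.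
  apply: eq_integral => v _; under eq_integral => t _ do rewrite mulrAC mulrC EFinM.
  rewrite ge0_integralZl//; last 2 first.
  - apply/measurable_EFinP; apply: measurable_funM; first exact: measurable_indic.
    by apply: measurable_kern => //; exact: measurable_funB.
  - by move=> t _; rewrite lee_fin mulr_ge0// kern_ge0.
  by rewrite integral_kern_left// -!EFinM; congr EFin; rewrite mulrCA mulrA.
have mh : measurable_fun setT (fun v => (\1_(`[a, c[%classic : set (measurableTypeR R)) v * G ((b - v) / r))%:E).
  apply/measurable_EFinP; apply: measurable_funM; first exact: mi.
  apply: (measurableT_comp mG).
  by apply: measurable_funM => //; exact: measurable_funB.
have h0 t : (0 <= (\1_(`[a, c[%classic : set (measurableTypeR R)) t * G ((b - t) / r))%:E)%E by rewrite lee_fin mulr_ge0.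
rewrite (ge0_integralZl_EFin _ measurableT (fun t _ => h0 t) mh c0).
rewrite (ge0_integral_affine b rn0 mh h0).
rewrite (gtr0_norm r0) muleA -EFinM [X in X%:E]mulrC (powR_rr r0) [in RHS]mulrC [in RHS]EFinM; apply: (congr2 mule erefl).
rewrite (@EFin_oint _ _ (mass_g_s n s)); last 3 first.
- exact: (measurableT_comp mG).
- by move=> t; rewrite G0 barG_s_le.
- by rewrite ler_pM2r ?invr_gt0// lerD2r.
rewrite -integral_itv_bndo_bndc; last exact: measurable_funTS.
rewrite [RHS]integral_mkcond; apply: eq_integral => t _.
rewrite patchE indicE (_ : (_ \in _) = (t \in `[((a - b) / r)%R, ((c - b) / r)%R[%classic)); last first.
  rewrite !mem_setE/= !in_itv/= ltr_pdivlMr// ler_pdivrMr//.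
  by apply/idP/idP => /andP[? ?]; apply/andP; split; lra.
case: ifP => _; rewrite ?mul1r ?mul0r//; congr (G _)%:E; field => //.
Qed.

End line_interaction.

(** * Additivity and null points of line interactions *)

Section line_interaction_add.
Variables (R : realType) (n : nat) (s : R).
Local Notation lam := (@lebesgue_measure R).
Local Notation J := (@line_interaction R n s).
Implicit Types S V : set (measurableTypeR R).

Let k r S V (z : measurableTypeR R * measurableTypeR R) : \bar R :=
  (\1_S z.1 * \1_V z.2 * kern n s r (z.1 - z.2))%:E.

Let k0 r S V z : (0 <= k r S V z)%E.
Proof. by rewrite lee_fin !mulr_ge0// kern_ge0. Qed.

Let mi S : measurable S -> measurable_fun [set: measurableTypeR R] (\1_S : _ -> R).
Proof. by move=> mS; exact: measurable_indic. Qed.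

Let mk r S V : measurable S -> measurable V -> measurable_fun setT (k r S V).
Proof.
move=> mS mV; apply/measurable_EFinP; apply: measurable_funM.
  apply: measurable_funM.
    exact: (measurableT_comp (mi mS) measurable_fst).
  exact: (measurableT_comp (mi mV) measurable_snd).
by apply: measurable_kern => //; exact: measurable_funB.
Qed.

Let mI r S V : measurable S -> measurable V ->
  measurable_fun setT (fun t => \int[lam]_v k r S V (t, v))%E.
Proof.
by move=> mS mV; apply: (measurable_fun_fubini_tonelli_F _ (mk r mS mV)) => z; exact: k0.
Qed.

Let I0 r S V t : (0 <= \int[lam]_v k r S V (t, v))%E.
Proof. by apply: integral_ge0 => v _; exact: k0. Qed.

Let indicU (A B : set (measurableTypeR R)) t : [disjoint A & B] ->
  \1_(A `|` B) t = \1_A t + \1_B t :> R.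
Proof.
move=> /disj_setPS AB; rewrite !indicE in_setU.
have [tA|tA] := boolP (t \in A); have [tB|tB] := boolP (t \in B); rewrite ?addr0 ?add0r//.
by case: (AB t); split; exact: set_mem.
Qed.

Lemma line_interaction_ge0 r S V : (0 <= J r S V)%E.
Proof. by apply: integral_ge0 => t _; exact: I0. Qed.

Lemma line_interactionUl r S1 S2 V : measurable S1 -> measurable S2 -> measurable V ->
  [disjoint S1 & S2] -> J r (S1 `|` S2) V = (J r S1 V + J r S2 V)%E.
Proof.
move=> m1 m2 mV S12.
transitivity (\int[lam]_t (\int[lam]_v k r S1 V (t, v) + \int[lam]_v k r S2 V (t, v)))%E; last first.
  exact: (ge0_integralD lam measurableT (fun t _ => I0 r S1 V t) (mI r m1 mV)
    (fun t _ => I0 r S2 V t) (mI r m2 mV)).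
apply: eq_integral => t _.
have mk1 := measurableT_comp (mk r m1 mV) (measurable_pair1 t).
have mk2 := measurableT_comp (mk r m2 mV) (measurable_pair1 t).
rewrite -(ge0_integralD lam measurableT (fun v _ => k0 r S1 V (t, v)) mk1
  (fun v _ => k0 r S2 V (t, v)) mk2).
by apply: eq_integral => v _; rewrite /k/= indicU// !mulrDl EFinD.
Qed.

Lemma line_interactionUr r S V1 V2 : measurable S -> measurable V1 -> measurable V2 ->
  [disjoint V1 & V2] -> J r S (V1 `|` V2) = (J r S V1 + J r S V2)%E.
Proof.
move=> mS m1 m2 V12.
transitivity (\int[lam]_t (\int[lam]_v k r S V1 (t, v) + \int[lam]_v k r S V2 (t, v)))%E; last first.
  exact: (ge0_integralD lam measurableT (fun t _ => I0 r S V1 t) (mI r mS m1)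
    (fun t _ => I0 r S V2 t) (mI r mS m2)).
apply: eq_integral => t _.
have mk1 := measurableT_comp (mk r mS m1) (measurable_pair1 t).
have mk2 := measurableT_comp (mk r mS m2) (measurable_pair1 t).
rewrite -(ge0_integralD lam measurableT (fun v _ => k0 r S V1 (t, v)) mk1
  (fun v _ => k0 r S V2 (t, v)) mk2).
by apply: eq_integral => v _; rewrite /k/= indicU// mulrDr mulrDl EFinD.
Qed.

Lemma line_interaction0l r V : J r set0 V = 0%E.
Proof.
by apply: integral0_eq => t _; apply: integral0_eq => v _; rewrite indic0 !mul0r.
Qed.

Lemma line_interaction0r r S : J r S set0 = 0%E.
Proof.
by apply: integral0_eq => t _; apply: integral0_eq => v _; rewrite indic0 mulr0 mul0r.
Qed.

Lemma line_interaction1l r S V c : S `<=` [set c] -> J r S V = 0%E.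
Proof.
move=> Sc; rewrite -[RHS](integral_set1 (fun t => \int[lam]_v k r S V (t, v))%E c).
rewrite [RHS]integral_mkcond; apply: eq_integral => t _; rewrite patchE.
case: ifPn => // tc; apply: integral0_eq => v _; rewrite indicE memNset ?mul0r//.
by move=> /Sc St; move: tc; rewrite notin_setE.
Qed.

Lemma line_interaction1r r S V c : V `<=` [set c] -> J r S V = 0%E.
Proof.
move=> Vc; apply: integral0_eq => t _.
rewrite -[RHS](integral_set1 (fun v => k r S V (t, v)) c).
rewrite [RHS]integral_mkcond; apply: eq_integral => v _; rewrite patchE.
case: ifPn => // vc; rewrite /= (_ : \1_V v = 0) ?mulr0 ?mul0r//.
by rewrite indicE memNset// => /Vc Vv; move: vc; rewrite notin_setE.
Qed.

(** Absorbs the mismatch between open and closed ends: the sections compared below agree except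
    possibly at the height -M. *)
Lemma line_interaction_off_point r S S' V V' c :
  measurable S -> measurable S' -> measurable V -> measurable V' ->
  S `\ c = S' `\ c -> V `\ c = V' `\ c -> J r S V = J r S' V'.
Proof.
have Jl A W : measurable A -> measurable W -> J r A W = J r (A `\ c) W.
  move=> mA mW; rewrite -[in LHS](setUIDK A [set c]) line_interactionUl//.
  - by rewrite (@line_interaction1l _ _ _ c) ?add0e//; exact: subIsetr.
  - exact: measurableI.
  - exact: measurableD.
  - by apply/disj_setPS => t [[_ tc] [_ /(_ tc)]].
have Jr A W : measurable A -> measurable W -> J r A W = J r A (W `\ c).
  move=> mA mW; rewrite -[in LHS](setUIDK W [set c]) line_interactionUr//.
  - by rewrite (@line_interaction1r _ _ _ c) ?add0e//; exact: subIsetr.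
  - exact: measurableI.
  - exact: measurableD.
  - by apply/disj_setPS => t [[_ tc] [_ /(_ tc)]].
have mD A : measurable A -> measurable (A `\ c) by move=> mA; exact: measurableD.
move=> mS mS' mV mV' SS VV; apply: (eq_trans (Jl _ _ mS mV)).
apply: (eq_trans (Jr _ _ (mD _ mS) mV)); rewrite SS VV; apply/esym.
exact: (eq_trans (Jl _ _ mS' mV') (Jr _ _ (mD _ mS') mV')).
Qed.

(** The first three terms are those of [Per]. The fourth, with both sets outside P, is the one that
    [fib_inside] takes from the half-space. *)
Lemma line_interaction_split r S V P : measurable S -> measurable V -> measurable P ->
  (J r S V = J r (S `&` P) (V `&` P) + J r (S `&` P) (V `\` P)
    + J r (S `\` P) (V `&` P) + J r (S `\` P) (V `\` P))%E.
Proof.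
move=> mS mV mP.
have dP (A : set (measurableTypeR R)) : [disjoint A `&` P & A `\` P].
  by apply/disj_setPS => t [[_ tP] [_ /(_ tP)]].
have mI' A : measurable A -> measurable (A `&` P) by move=> mA; exact: measurableI.
have mD A : measurable A -> measurable (A `\` P) by move=> mA; exact: measurableD.
have JV A : measurable A -> (J r A V = J r A (V `&` P) + J r A (V `\` P))%E.
  move=> mA; apply: (eq_trans (congr1 (J r A) (esym (setUIDK V P)))).
  exact: (line_interactionUr r mA (mI' _ mV) (mD _ mV) (dP V)).
apply: (eq_trans (congr1 (fun A => J r A V) (esym (setUIDK S P)))).
apply: (eq_trans (line_interactionUl r (mI' _ mS) (mD _ mS) mV (dP S))).
exact: (eq_trans (congr2 adde (JV _ (mI' _ mS)) (JV _ (mD _ mS))) (addeA _ _ _)).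
Qed.

End line_interaction_add.

Section fibers.
Variables (R : realType) (n : nat) (s : R).
Local Notation lam := (@lebesgue_measure R).
Local Notation leb := (@leb R n).
Local Notation Tn := (Rn R n).
Local Notation T1 := (Rn R n * measurableTypeR R)%type.
Local Notation J := (@line_interaction R n s).
Implicit Types A B : set T1.

Definition dist1_kernel (X Y : T1) : R := (dist1 X Y `^ (n%:R + 1 + s))^-1.

Lemma dist1_kernel_ge0 X Y : 0 <= dist1_kernel X Y.
Proof. by rewrite invr_ge0 powR_ge0. Qed.

Lemma measurable_dist1_kernel :
  measurable_fun setT (fun Z : T1 * T1 => dist1_kernel Z.1 Z.2).
Proof.
apply: (@measurable_kern R n s _ _ (fun Z : T1 * T1 => enorm ((Z.1.1 : 'rV_n) - Z.2.1))
  (fun Z : T1 * T1 => Z.1.2 - Z.2.2)).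
  have mp : measurable_fun setT (fun Z : T1 * T1 => (Z.1.1, Z.2.1)).
    apply: measurable_fun_pair; first exact: (measurableT_comp measurable_fst measurable_fst).
    exact: (measurableT_comp measurable_fst measurable_snd).
  exact: (measurableT_comp (@measurable_fun_enormB R n) mp).
apply: measurable_funB; first exact: (measurableT_comp measurable_snd measurable_fst).
exact: (measurableT_comp measurable_snd measurable_snd).
Qed.

Definition fib A B (z : Tn * Tn) : \bar R := fiber_interaction dist1_kernel A B z.

Lemma interaction_fib A B : measurable A -> measurable B ->
  interaction s A B = (\int[leb \x leb]_z fib A B z)%E.
Proof.
move=> mA mB.
exact: (interactionE leb dist1_kernel_ge0 measurable_dist1_kernel mA mB).
Qed.

Lemma measurable_fib A B : measurable A -> measurable B ->
  measurable_fun setT (fib A B).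
Proof.
exact: (measurable_fiber_interaction dist1_kernel_ge0 measurable_dist1_kernel).
Qed.

Lemma fib_ge0 A B z : (0 <= fib A B z)%E.
Proof. exact: (fiber_interaction_ge0 dist1_kernel_ge0). Qed.

Lemma fibE A B (x y : Tn) :
  fib A B (x, y) = J (enorm ((x : 'rV_n) - y)) (xsection A x) (xsection B y).
Proof.
apply: eq_integral => t _; apply: eq_integral => v _.
by rewrite !indicE !mem_xsection.
Qed.

Lemma xsection_measurable A (x : Tn) : measurable A ->
  measurable (xsection A x : set (measurableTypeR R)).
Proof. exact: measurable_xsection. Qed.

End fibers.

(** * Vertical sections of the subgraph, the cylinder and the half-space *)

Section subgraph_fibers.
Variables (R : realType) (n : nat) (s : R) (Omega : set 'rV[R]_n) (u : 'rV[R]_n -> R) (M : R).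
Hypotheses (mO : measurable (Omega : set (Rn R n))) (mu : measurable_fun [set: Rn R n] u).
Local Notation leb := (@leb R n).
Local Notation Tn := (Rn R n).
Local Notation J := (@line_interaction R n s).
Local Notation E := (subgraph u).
Local Notation O := (cylinder Omega M).
Local Notation H := (@lower_halfspace R n).
Local Notation Oinf := (cylinder_inf Omega).
Local Notation P := (`](- M)%R, M[%classic : set (measurableTypeR R)).

Lemma measurable_subgraph : measurable E.
Proof.
apply: measurable_setb; apply: measurable_fun_ltr => //.
exact: (measurableT_comp mu measurable_fst).
Qed.

Lemma measurable_cylinder : measurable O.
Proof.
apply: measurableX => //; rewrite (_ : mkset _ = P); first exact: measurable_itv.
by apply/seteqP; split => t; rewrite /= in_itv.
Qed.

Lemma measurable_cylinder_inf : measurable Oinf.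
Proof. exact: measurableX. Qed.

Lemma measurable_lower_halfspace : measurable H.
Proof. by apply: measurable_setb; apply: measurable_fun_ltr. Qed.

Lemma measurable_strip : measurable (Oinf `\` O).
Proof.
by apply: measurableD; [exact: measurable_cylinder_inf|exact: measurable_cylinder].
Qed.

Lemma xsection_subgraph x : xsection E x = `]-oo, u x[%classic.
Proof. by rewrite xsectionE; apply/seteqP; split => t; rewrite /= in_itv. Qed.

Lemma xsection_subgraphC x : xsection (~` E) x = `[u x, +oo[%classic.
Proof.
rewrite xsectionE; apply/seteqP; split => t; rewrite /= in_itv/= andbT /subgraph/=.
  by move/negP; rewrite -leNgt.
by rewrite leNgt => /negP.
Qed.

Lemma xsection_lower x : xsection H x = `]-oo, (0 : R)[%classic.
Proof. by rewrite xsectionE; apply/seteqP; split => t; rewrite /= in_itv. Qed.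

Lemma xsection_lowerC x : xsection (~` H) x = `[(0 : R), +oo[%classic.
Proof.
rewrite xsectionE; apply/seteqP; split => t; rewrite /= in_itv/= andbT /lower_halfspace/=.
  by move/negP; rewrite -leNgt.
by rewrite leNgt => /negP.
Qed.

Let cylE x t : O (x, t) <-> Omega x /\ P t.
Proof. by rewrite /cylinder/= in_itv/=. Qed.

Lemma xsectionI_cylinder (A : set (Rn1 R n)) x : Omega x ->
  xsection (A `&` O) x = xsection A x `&` P.
Proof.
move=> Ox; rewrite !xsectionE; apply/seteqP; split => t /= [At].
  by move=> /cylE[_ Pt].
by move=> Pt; split => //; apply/cylE.
Qed.

Lemma xsectionI_cylinderN (A : set (Rn1 R n)) x : ~ Omega x ->
  xsection (A `&` O) x = set0.
Proof. by move=> Ox; rewrite !xsectionE; apply/seteqP; split => t //= [_ /cylE[]]. Qed.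

Lemma xsectionD_cylinder (A : set (Rn1 R n)) x : Omega x ->
  xsection (A `\` O) x = xsection A x `\` P.
Proof.
move=> Ox; rewrite !xsectionE; apply/seteqP; split => t /= [At nO]; split => //.
  by move=> Pt; apply: nO; apply/cylE.
by move=> /cylE[_ Pt]; exact: nO.
Qed.

Lemma xsectionD_cylinderN (A : set (Rn1 R n)) x : ~ Omega x ->
  xsection (A `\` O) x = xsection A x.
Proof.
move=> Ox; rewrite !xsectionE; apply/seteqP; split => t /= => [[]//|At].
by split => // /cylE[].
Qed.

Lemma xsectionI_inf (A : set (Rn1 R n)) x : Omega x ->
  xsection (A `&` Oinf) x = xsection A x.
Proof. by move=> Ox; rewrite !xsectionE; apply/seteqP; split => t /= => [[]//|]. Qed.

Lemma xsectionI_infN (A : set (Rn1 R n)) x : ~ Omega x ->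
  xsection (A `&` Oinf) x = set0.
Proof. by move=> Ox; rewrite !xsectionE; apply/seteqP; split => t //= [_ []]. Qed.

Lemma xsectionI_strip (A : set (Rn1 R n)) x : Omega x ->
  xsection (A `&` (Oinf `\` O)) x = xsection A x `\` P.
Proof. by move=> Ox; rewrite setIDA xsectionD_cylinder// xsectionI_inf. Qed.

Lemma xsectionI_stripN (A : set (Rn1 R n)) x : ~ Omega x ->
  xsection (A `&` (Oinf `\` O)) x = set0.
Proof. by move=> Ox; rewrite setIDA xsectionD_cylinderN// xsectionI_infN. Qed.

Let mP : measurable P. Proof. exact: measurable_itv. Qed.

(** Since |u| <= M at both points, outside ]-M, M[ the subgraph and the half-space have the same
    sections up to one point. The strip term is therefore the piece missing from the four-term
    splitting of two half-lines. *)
Lemma fib_inside x y : 0 < M -> Omega x -> Omega y -> `|u x| <= M -> `|u y| <= M ->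
  (fib s (E `&` O) (~` E `&` O) (x, y) + fib s (E `&` O) (~` E `\` O) (x, y)
   + fib s (E `\` O) (~` E `&` O) (x, y)
   + fib s (H `&` (Oinf `\` O)) (~` H `&` (Oinf `\` O)) (x, y)
   = fib s E (~` E) (x, y))%E.
Proof.
move=> M0 Ox Oy; rewrite !ler_norml => /andP[Mx xM] /andP[My yM]; rewrite !fibE.
rewrite !xsectionI_cylinder// !xsectionD_cylinder// !xsectionI_strip//.
rewrite !xsection_subgraph !xsection_subgraphC xsection_lower xsection_lowerC.
have mD (a : itv_bound R) b : measurable ([set` Interval a b] `\` P : set (measurableTypeR R)).
  by apply: measurableD => //; exact: measurable_itv.
(* The exceptional point is -M: when u takes the value -M it belongs to the complement of the
   subgraph, but to the lower half-space. *)
rewrite (@line_interaction_off_point R n s _ (`]-oo, 0[%classic `\` P) (`]-oo, u x[%classic `\` P)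
  (`[0, +oo[%classic `\` P) (`[u y, +oo[%classic `\` P) (- M)).
- by apply/esym; apply: line_interaction_split => //; exact: measurable_itv.
- exact: mD.
- exact: mD.
- exact: mD.
- exact: mD.
- apply/seteqP; split => t /=; rewrite !in_itv/= => -[[t0 tP] tM].
    split=> //; split=> //; rewrite ltNge; apply/negP => xt; apply: tP.
    by rewrite (lt_trans t0)// andbT lt_neqAle (le_trans Mx)// andbT eq_sym; exact/eqP.
  split=> //; split=> //; rewrite ltNge; apply/negP => xt; apply: tP.
  by rewrite (lt_le_trans t0)// andbT (lt_le_trans _ xt)// oppr_lt0.
- apply/seteqP; split => t /=; rewrite !in_itv/= !andbT => -[[t0 tP] tM].
    split=> //; split=> //; rewrite leNgt; apply/negP => xt; apply: tP.
    by rewrite (lt_le_trans xt)// andbT (lt_le_trans _ t0)// oppr_lt0.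
  split=> //; split=> //; rewrite leNgt; apply/negP => xt; apply: tP.
  rewrite (lt_trans xt)// andbT lt_neqAle (le_trans My)// andbT eq_sym; exact/eqP.
Qed.

Let fib_outl (A B : set (Rn1 R n)) (x y : Tn) : xsection A x = set0 -> fib s A B (x, y) = 0%E.
Proof. by move=> A0; rewrite fibE A0; exact: line_interaction0l. Qed.

Let fib_outr (A B : set (Rn1 R n)) (x y : Tn) : xsection B y = set0 -> fib s A B (x, y) = 0%E.
Proof. by move=> B0; rewrite fibE B0; exact: line_interaction0r. Qed.

(** Over y nothing lies in the cylinder, so only the second term survives: the strip ]-M, u x[
    against the whole half-line above u y. *)
Lemma fib_inside_outside x y : (1 <= n)%N -> 0 < s ->
  Omega x -> ~ Omega y -> `|u x| <= M ->
  let r := enorm (x - y) in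
  (fib s (E `&` O) (~` E `&` O) (x, y) + fib s (E `&` O) (~` E `\` O) (x, y)
   + fib s (E `\` O) (~` E `&` O) (x, y)
   + fib s (H `&` (Oinf `\` O)) (~` H `&` (Oinf `\` O)) (x, y)
   = (oint ((- M - u y) / r) ((u x - u y) / r) (@barG_s R n s)
      / r `^ (n%:R - 1 + s))%:E)%E.
Proof.
move=> n1 s0 Ox Oy; rewrite ler_norml => /andP[Mx xM] r.
have r0 : 0 < r.
  by rewrite enorm_gt0 subr_eq0; apply/eqP => xy; apply: Oy; rewrite -xy.
rewrite (fib_outr (E `&` O) x (xsectionI_cylinderN _ Oy)).
rewrite (fib_outr (E `\` O) x (xsectionI_cylinderN _ Oy)).
rewrite (fib_outr (H `&` (Oinf `\` O)) x (xsectionI_stripN _ Oy)).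
rewrite add0e !adde0 fibE xsectionI_cylinder// xsectionD_cylinderN//.
rewrite xsection_subgraph xsection_subgraphC.
rewrite -(line_interaction_strip n1 s0 (u y) r0 Mx).
apply: (congr1 (fun S => J r S _)); apply/seteqP; split => t /=; rewrite !in_itv/=.
  by move=> [-> /andP[->]].
by move=> /andP[-> tx]; split => //=; exact: lt_le_trans xM.
Qed.

(** Only the third term survives. The formula is written with the inside point y first, to match the
    integrand of [N_s] at (y, x). *)
Lemma fib_outside_inside x y : (1 <= n)%N -> 0 < s ->
  ~ Omega x -> Omega y -> `|u y| <= M ->
  let r := enorm (y - x) in
  (fib s (E `&` O) (~` E `&` O) (x, y) + fib s (E `&` O) (~` E `\` O) (x, y)
   + fib s (E `\` O) (~` E `&` O) (x, y)
   + fib s (H `&` (Oinf `\` O)) (~` H `&` (Oinf `\` O)) (x, y)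
   = (oint ((u y - u x) / r) ((M - u x) / r) (fun t => @barG_s R n s (- t))
      / r `^ (n%:R - 1 + s))%:E)%E.
Proof.
move=> n1 s0 Ox Oy; rewrite ler_norml => /andP[My yM] r.
have r0 : 0 < r.
  by rewrite enorm_gt0 subr_eq0; apply/eqP => xy; apply: Ox; rewrite -xy.
rewrite (fib_outl (~` E `&` O) y (xsectionI_cylinderN _ Ox)).
rewrite (fib_outl (~` E `\` O) y (xsectionI_cylinderN _ Ox)).
rewrite (fib_outl (~` H `&` (Oinf `\` O)) y (xsectionI_stripN _ Ox)).
rewrite !add0e adde0 fibE xsectionI_cylinder// xsectionD_cylinderN//.
rewrite xsection_subgraph xsection_subgraphC enorm_distC -/r.
rewrite -(line_interaction_strip_lower n1 s0 (u x) r0 yM).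
(* The section over y is [u y, M[ without -M, a point it would contain when u y = -M. *)
apply: (@line_interaction_off_point _ _ _ _ _ _ _ _ (- M)) => //.
- by apply: measurableI.
- apply/seteqP; split => t /=; rewrite !in_itv/= !andbT.
    by move=> [[-> /andP[_ ->]]].
  move=> [/andP[yt tM] tNM]; split=> //; split => //; rewrite tM andbT.
  by rewrite lt_neqAle (le_trans My yt) andbT eq_sym; exact/eqP.
Qed.

Lemma fib_outside x y : ~ Omega x -> ~ Omega y ->
  (fib s (E `&` O) (~` E `&` O) (x, y) + fib s (E `&` O) (~` E `\` O) (x, y)
   + fib s (E `\` O) (~` E `&` O) (x, y)
   + fib s (H `&` (Oinf `\` O)) (~` H `&` (Oinf `\` O)) (x, y) = 0)%E.
Proof.
move=> Ox Oy.
rewrite (fib_outl (~` E `&` O) y (xsectionI_cylinderN _ Ox)).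
rewrite (fib_outl (~` E `\` O) y (xsectionI_cylinderN _ Ox)).
rewrite (fib_outl (~` H `&` (Oinf `\` O)) y (xsectionI_stripN _ Ox)).
rewrite (fib_outr (E `\` O) x (xsectionI_cylinderN _ Oy)).
by rewrite !adde0.
Qed.

Lemma fib_lower_inf x y :
  fib s (H `&` Oinf) (~` H `&` Oinf) (x, y) =
  ((fib s H (~` H)) \_ (Omega `*` Omega)) (x, y).
Proof.
rewrite patchE; case: ifPn; rewrite ?inE ?notin_setE/=.
  by move=> -[Ox Oy]; rewrite !fibE !xsectionI_inf.
have [Oy|Oy _] := pselect (Omega y); last exact: (fib_outr _ _ (xsectionI_infN _ Oy)).
have [Ox|Ox _] := pselect (Omega x); first by case; split.
exact: (fib_outl _ _ (xsectionI_infN _ Ox)).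
Qed.

Lemma fib_lower x y : (1 <= n)%N -> 0 < s -> x != y ->
  fib s H (~` H) (x, y) =
  ((enorm (x - y) `^ (n%:R - 1 + s))^-1%:E * Phi_s n s 0)%E.
Proof.
move=> n1 s0 xy; rewrite fibE xsection_lower xsection_lowerC.
by rewrite line_interaction_half ?subrr ?mul0r// enorm_gt0 subr_eq0.
Qed.

Lemma fib_subgraph_sym x y : (1 <= n)%N -> 0 < s -> x != y ->
  let A := ((calG_s n s ((u x - u y) / enorm (x - y)))
     / enorm (x - y) `^ (n%:R - 1 + s))%:E in
  (fib s E (~` E) (x, y) + fib s E (~` E) (y, x)
   = (fib s H (~` H) (x, y) + A) + (fib s H (~` H) (x, y) + A))%E.
Proof.
move=> n1 s0 xy A; rewrite fib_lower// !fibE !xsection_subgraph !xsection_subgraphC.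
have r0 : 0 < enorm (x - y) by rewrite enorm_gt0 subr_eq0.
rewrite (enorm_distC y x) !line_interaction_half//.
set k := (_ `^ _)^-1; have k0 : 0 <= k by rewrite invr_ge0 powR_ge0.
have p0 w : (0 <= Phi_s n s w)%E by exact: Phi_s_ge0.
have c0 : (0 <= (calG_s n s ((u x - u y) / enorm (x - y)))%:E)%E.
  by rewrite lee_fin calG_s_ge0.
rewrite -(opprB (u x) (u y)) mulNr -(ge0_muleDr _ (p0 _) (p0 _)) (Phi_s_sym n1 s0).
rewrite (ge0_muleDr _ (adde_ge0 (p0 _) c0) (adde_ge0 (p0 _) c0)) (ge0_muleDr _ (p0 _) c0).
by rewrite /A -EFinM mulrC.
Qed.

End subgraph_fibers.

(** * The perimeter identity *)

Section iterated.
Context d (T : measurableType d) (R : realType).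
Variable mu : {sigma_finite_measure set T -> \bar R}.

Lemma integral_setX (A B : set T) (F : T * T -> \bar R) :
  measurable A -> measurable B -> measurable_fun setT F -> (forall z, 0 <= F z)%E ->
  (\int[mu]_(x in A) \int[mu]_(y in B) F (x, y) = \int[mu \x mu]_(z in A `*` B) F z)%E.
Proof.
move=> mA mB mF F0; have mAB : measurable (A `*` B) by exact: measurableX.
have F'0 z : (0 <= (F \_ (A `*` B)) z)%E by exact: erestrict_ge0.
have mF' : measurable_fun setT (F \_ (A `*` B)).
  exact/(measurable_restrictT _ mAB)/measurable_funTS.
rewrite [RHS]integral_mkcond (fubini_tonelli1 _ mF' F'0) [LHS]integral_mkcond.
apply: eq_integral => x _; rewrite patchE /fubini_F.
case: ifPn => xA.
  rewrite [LHS]integral_mkcond; apply: eq_integral => y _; rewrite !patchE.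
  by rewrite in_setX xA.
by rewrite integral0_eq// => y _; rewrite patchE in_setX (negbTE xA).
Qed.

Lemma integral_swap (F : T * T -> \bar R) :
  measurable_fun setT F -> (forall z, 0 <= F z)%E ->
  (\int[mu \x mu]_z F (z.2, z.1) = \int[mu \x mu]_z F z)%E.
Proof.
move=> mF F0.
have mS : measurable_fun setT (fun z : T * T => F (z.2, z.1)).
  by apply: (measurableT_comp mF); exact: measurable_fun_pair.
by rewrite (fubini_tonelli1 _ mS (fun=> F0 _)) (fubini_tonelli2 _ mF F0).
Qed.

Lemma negligible_fst (N : set T) : mu.-negligible N -> (mu \x mu)%E.-negligible (N `*` setT).
Proof.
move=> [A [mA A0 NA]]; exists (A `*` setT); split.
- exact: measurableX.
- by rewrite product_measure1E//= A0 mul0e.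
- exact: setSX.
Qed.

Lemma negligible_snd (N : set T) : mu.-negligible N -> (mu \x mu)%E.-negligible (setT `*` N).
Proof.
move=> [A [mA A0 NA]]; exists (setT `*` A); split.
- exact: measurableX.
- by rewrite product_measure1E//= A0 mule0.
- exact: setSX.
Qed.

(** Collects the two kinds of exceptions met below: points where an almost sure property such as |u|
    <= M fails, and a null set of pairs such as the diagonal. *)
Lemma eq_integral_pairs (Q : set T) (D : set (T * T)) (F G : T * T -> \bar R) :
  {ae mu, forall x, Q x} -> (mu \x mu)%E.-negligible D ->
  measurable_fun setT F -> measurable_fun setT G ->
  (forall x y, Q x -> Q y -> ~ D (x, y) -> F (x, y) = G (x, y)) ->
  (\int[mu \x mu]_z F z = \int[mu \x mu]_z G z)%E.
Proof.
move=> aeQ nD mF mG FG; apply: ae_eq_integral => //.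
have nN := negligibleU (negligibleU (negligible_fst aeQ) (negligible_snd aeQ)) nD.
apply: negligibleS nN => -[x y] nFG; apply: contrapT => /not_orP[/not_orP[Qx Qy] Dxy].
apply: nFG => _; apply: FG => //; apply: contrapT => nQ.
  by apply: Qx.
by apply: Qy.
Qed.

Lemma patch_in (f : T * T -> \bar R) (D : set (T * T)) z : D z -> (f \_ D) z = f z.
Proof. by move=> Dz; rewrite patchT// inE. Qed.

Lemma patch_out (f : T * T -> \bar R) (D : set (T * T)) z : ~ D z -> (f \_ D) z = 0%E.
Proof. by move=> Dz; rewrite patchE memNset. Qed.

End iterated.

Section diagonal.
Variables (R : realType) (n : nat).
Hypothesis n_ge1 : (1 <= n)%N.
Local Notation leb := (@leb R n).

(** Every section is a single point, null because n >= 1; measurability comes from writing the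
    diagonal as the zero set of the distance. *)
Lemma negligible_diagonal :
  (leb \x leb)%E.-negligible [set z : Rn R n * Rn R n | z.1 = z.2].
Proof.
have -> : [set z : Rn R n * Rn R n | z.1 = z.2] =
    [set z | enorm ((z.1 : 'rV[R]_n) - z.2) == 0].
  apply/seteqP; split => -[x y]/=; rewrite eq_le enorm_ge0 andbT leNgt enorm_gt0 negbK subr_eq0.
    by move=> ->; rewrite eqxx.
  by move/eqP.
have mD : measurable [set z : Rn R n * Rn R n | enorm ((z.1 : 'rV[R]_n) - z.2) == 0].
  apply: measurable_setb; apply: measurable_fun_eqr => //.
  exact: (@measurable_fun_enormB R n).
exists [set z : Rn R n * Rn R n | enorm ((z.1 : 'rV[R]_n) - z.2) == 0]; split => //.
apply: integral0_eq => x _ /=.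
rewrite -(leb_set1 x n_ge1); congr (leb _); apply/seteqP; split => y.
  rewrite /xsection/= inE/= eq_le enorm_ge0 andbT leNgt enorm_gt0 negbK subr_eq0.
  by move/eqP.
move=> ->; rewrite /xsection/= inE/= eq_le enorm_ge0 andbT leNgt enorm_gt0 negbK subr_eq0.
exact: eqxx.
Qed.

End diagonal.

Section perimeter_identity.
Variables (R : realType) (n : nat) (s : R) (Omega : set 'rV[R]_n) (u : 'rV[R]_n -> R) (M : R).
Hypotheses (n_ge1 : (1 <= n)%N) (s0 : 0 < s) (M0 : 0 < M).
Hypotheses (mO : measurable (Omega : set (Rn R n))) (mu : measurable_fun [set: Rn R n] u).
Local Notation leb := (@leb R n).
Hypothesis uM : {ae leb, forall x, Omega x -> `|u x| <= M}.
Local Notation Tn := (Rn R n).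
Local Notation G := (@barG_s R n s).
Local Notation q := (n%:R - 1 + s).
Local Notation E := (subgraph u).
Local Notation O := (cylinder Omega M).
Local Notation H := (@lower_halfspace R n).
Local Notation Oinf := (cylinder_inf Omega).

Let dist (z : Tn * Tn) : R := enorm ((z.1 : 'rV[R]_n) - z.2).

Let mdist : measurable_fun setT dist.
Proof. exact: measurable_fun_enormB. Qed.

(* [u] truncated to [-M, M]: equal to [u] almost everywhere in [Omega], it makes
   the integrand of [N_s] nonnegative everywhere. *)
Definition clip (x : Tn) : R := Num.max (- M) (Num.min M (u x)).

Lemma clip_id x : `|u x| <= M -> clip x = u x.
Proof. by rewrite ler_norml /clip => /andP[Mx xM]; rewrite min_r// max_r. Qed.

Lemma clip_itv x : - M <= clip x <= M.
Proof.
rewrite /clip le_max lexx/= ge_max ge_min lexx/= andbT.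
by rewrite (le_trans _ (ltW M0))// oppr_le0 ltW.
Qed.

Lemma measurable_clip : measurable_fun setT clip.
Proof. exact: (measurable_maxr (measurable_cst (- M)) (measurable_minr (measurable_cst M) mu)). Qed.

(** For x in Omega and y outside, the subgraph over x within the cylinder against the complement
    over y. [cross_upper] is the complement over x against the subgraph over y. *)
Definition cross_lower (z : Tn * Tn) : R :=
  oint ((- M - u z.2) / dist z) ((clip z.1 - u z.2) / dist z) G / dist z `^ q.

Definition cross_upper (z : Tn * Tn) : R :=
  oint ((clip z.1 - u z.2) / dist z) ((M - u z.2) / dist z) (fun t => G (- t)) / dist z `^ q.

Let mu1 : measurable_fun setT (fun z : Tn * Tn => u z.2).
Proof. exact: (measurableT_comp mu measurable_snd). Qed.

Let mc1 : measurable_fun setT (fun z : Tn * Tn => clip z.1).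
Proof. exact: (measurableT_comp measurable_clip measurable_fst). Qed.

Let dist_inv : measurable_fun setT (fun z : Tn * Tn => (dist z)^-1).
Proof.
rewrite (_ : (fun _ => _) = (fun z => dist z `^ (- 1))); last first.
  by apply/funext => z; rewrite powR_inv1 ?enorm_ge0.
exact: (measurableT_comp (measurable_powR _) mdist).
Qed.

Let dist_powV : measurable_fun setT (fun z : Tn * Tn => (dist z `^ q)^-1).
Proof.
rewrite (_ : (fun _ => _) = (fun z => dist z `^ (- q))); last first.
  by apply/funext => z; rewrite powRN.
exact: (measurableT_comp (measurable_powR _) mdist).
Qed.

Let G0 t : 0 <= G t. Proof. exact: barG_s_ge0. Qed.
Let mG : measurable_fun setT G. Proof. exact: measurable_barG_s. Qed.
Let mGN : measurable_fun setT (fun t : R => G (- t)). Proof. exact: (measurableT_comp mG). Qed.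

Let mquot (f : Tn * Tn -> R) : measurable_fun setT f ->
  measurable_fun setT (fun z : Tn * Tn => (f z - u z.2) / dist z).
Proof.
by move=> mf; apply: measurable_funM dist_inv; exact: measurable_funB.
Qed.

Let mquot_cst (a : R) : measurable_fun setT (fun z : Tn * Tn => (a - u z.2) / dist z).
Proof. exact: (mquot (measurable_cst a)). Qed.

Lemma measurable_cross_lower : measurable_fun setT cross_lower.
Proof.
apply: measurable_funM dist_powV.
exact: (measurable_oint mG G0 (mquot_cst _) (mquot mc1)).
Qed.

Lemma measurable_cross_upper : measurable_fun setT cross_upper.
Proof.
apply: measurable_funM dist_powV.
exact: (measurable_oint mGN (fun=> G0 _) (mquot mc1) (mquot_cst _)).
Qed.

Let dist_le (z : Tn * Tn) a b : a <= b -> (a - u z.2) / dist z <= (b - u z.2) / dist z.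
Proof. by move=> ab; rewrite ler_wpM2r ?invr_ge0 ?enorm_ge0// lerD2r. Qed.

Lemma cross_lower_ge0 z : 0 <= cross_lower z.
Proof.
apply: mulr_ge0; last by rewrite invr_ge0 powR_ge0.
have /andP[Mc _] := clip_itv z.1.
rewrite -lee_fin (EFin_oint_barG_s n_ge1 s0 (dist_le z Mc)).
by apply: integral_ge0 => t _; rewrite lee_fin.
Qed.

Let EFin_oint_barGN a b : a <= b -> (oint a b (fun t => G (- t)))%:E =
  (\int[lebesgue_measure]_(t in `[a, b]) (G (- t))%:E)%E.
Proof.
apply: (@EFin_oint _ _ (mass_g_s n s)) => //.
by move=> t; rewrite G0 barG_s_le.
Qed.

Lemma cross_upper_ge0 z : 0 <= cross_upper z.
Proof.
apply: mulr_ge0; last by rewrite invr_ge0 powR_ge0.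
have /andP[_ Mc] := clip_itv z.1.
rewrite -lee_fin (EFin_oint_barGN (dist_le z Mc)).
by apply: integral_ge0 => t _; rewrite lee_fin.
Qed.

Definition area_integrand (z : Tn * Tn) : R :=
  calG_s n s ((u z.1 - u z.2) / dist z) / dist z `^ q.

Lemma measurable_area_integrand : measurable_fun setT area_integrand.
Proof.
apply: measurable_funM dist_powV.
apply: (measurableT_comp (measurable_calG_s n_ge1 s0)).
by apply: mquot; exact: (measurableT_comp mu measurable_fst).
Qed.

Lemma area_integrand_ge0 z : 0 <= area_integrand z.
Proof. by apply: mulr_ge0; rewrite ?calG_s_ge0// invr_ge0 powR_ge0. Qed.

Lemma A_sE : A_s s Omega u = (\int[leb \x leb]_(z in Omega `*` Omega) (area_integrand z)%:E)%E.
Proof.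
apply: (@integral_setX _ _ _ leb Omega Omega (EFin \o area_integrand)) => //.
  by apply/measurable_EFinP; exact: measurable_area_integrand.
by move=> z; rewrite lee_fin area_integrand_ge0.
Qed.

Let mOC : measurable (~` Omega : set Tn). Proof. exact: measurableC. Qed.

Let mcl : measurable_fun setT (EFin \o cross_lower).
Proof. by apply/measurable_EFinP; exact: measurable_cross_lower. Qed.

Let mcu : measurable_fun setT (EFin \o cross_upper).
Proof. by apply/measurable_EFinP; exact: measurable_cross_upper. Qed.

Let cl0 z : (0 <= (EFin \o cross_lower) z)%E.
Proof. by rewrite lee_fin cross_lower_ge0. Qed.

Let cu0 z : (0 <= (EFin \o cross_upper) z)%E.
Proof. by rewrite lee_fin cross_upper_ge0. Qed.

Let N_inner (v : Tn -> R) (x : Tn) : \bar R := (\int[leb]_(y in ~` Omega)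
     (let r := enorm ((x : 'rV[R]_n) - y) in
      (oint ((- M - u y) / r) ((v x - u y) / r) G
       + oint ((v x - u y) / r) ((M - u y) / r) (fun t => G (- t)))
      / r `^ q)%:E)%E.

(** For v = u the integrand may be negative where |u| > M, so Tonelli is applied to its positive and
    negative parts. *)
Let measurable_N_inner (v : Tn -> R) : measurable_fun [set: Tn] v ->
  measurable_fun setT (N_inner v).
Proof.
move=> mv.
have mv1 : measurable_fun setT (fun z : Tn * Tn => v z.1).
  exact: (measurableT_comp mv measurable_fst).
pose f (z : Tn * Tn) : R := ((oint ((- M - u z.2) / dist z) ((v z.1 - u z.2) / dist z) G
       + oint ((v z.1 - u z.2) / dist z) ((M - u z.2) / dist z) (fun t => G (- t)))
      / dist z `^ q).
have mf : measurable_fun setT (EFin \o f).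
  apply/measurable_EFinP; apply: measurable_funM dist_powV; apply: measurable_funD.
    exact: (measurable_oint mG G0 (mquot_cst _) (mquot mv1)).
  exact: (measurable_oint mGN (fun=> G0 _) (mquot mv1) (mquot_cst _)).
pose DO : set (Tn * Tn) := [set: Tn] `*` ~` (Omega : set Tn).
pose F : Tn * Tn -> \bar R := (EFin \o f) \_ DO.
have mfO : measurable_fun setT F.
  have mDO : measurable DO by exact: measurableX.
  exact/(measurable_restrictT _ mDO)/measurable_funTS.
have -> : N_inner v = (fun x => fubini_F leb F^\+ x
    - fubini_F leb F^\- x)%E.
  apply/funext => x; rewrite /N_inner integral_mkcond integralE /fubini_F.
  congr (_ - _)%E; apply: eq_integral => y _.
    by rewrite !funeposE /F /DO !patchE in_setX in_setT.
  by rewrite !funenegE /F /DO !patchE in_setX in_setT.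
by apply: emeasurable_funB; apply: measurable_fun_fubini_tonelli_F => //;
  [exact: measurable_funepos|exact: measurable_funeneg].
Qed.

(** Replacing u by [clip] at the outer point alters the inner integral only for x in a null set. The
    integrand is then nonnegative everywhere and Tonelli applies. *)
Lemma N_sE : N_s s M Omega u =
  (\int[leb \x leb]_(z in Omega `*` ~` Omega) ((cross_lower z)%:E + (cross_upper z)%:E))%E.
Proof.
transitivity (\int[leb]_(x in Omega) N_inner u x)%E; first by [].
transitivity (\int[leb]_(x in Omega) N_inner clip x)%E.
  apply: ae_eq_integral => //.
  - exact/measurable_funTS/measurable_N_inner.
  - by apply/measurable_funTS/measurable_N_inner; exact: measurable_clip.
  case: uM => N [mN N0 NP]; exists N; split => // x hx; apply: NP => uxM; apply: hx => Ox.
  by apply: eq_integral => y _; rewrite (clip_id (uxM Ox)).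
rewrite -(integral_setX leb mO mOC).
- by apply: eq_integral => x _; apply: eq_integral => y _; rewrite -EFinD -mulrDl.
- exact: (emeasurable_funD mcl mcu).
- by move=> z; apply: adde_ge0; [exact: cl0|exact: cu0].
Qed.

Local Notation OO := (Omega `*` Omega : set (Tn * Tn)).
Local Notation OC := (Omega `*` ~` Omega : set (Tn * Tn)).

Let mOO : measurable OO. Proof. exact: measurableX. Qed.
Let mOC2 : measurable OC. Proof. exact: measurableX. Qed.

Let mE : measurable E. Proof. exact: measurable_subgraph. Qed.
Let mEO : measurable O. Proof. exact: measurable_cylinder. Qed.
Let mEC : measurable (~` E). Proof. exact: measurableC. Qed.
Let mH : measurable H. Proof. exact: measurable_lower_halfspace. Qed.
Let mHC : measurable (~` H). Proof. exact: measurableC. Qed.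

Let e1 := fib s (E `&` O) (~` E `&` O).
Let e2 := fib s (E `&` O) (~` E `\` O).
Let e3 := fib s (E `\` O) (~` E `&` O).
Let hs := fib s (H `&` (Oinf `\` O)) (~` H `&` (Oinf `\` O)).
Let hi := fib s (H `&` Oinf) (~` H `&` Oinf).

Let me1 : measurable_fun setT e1.
Proof. by apply: measurable_fib; apply: measurableI. Qed.
Let me2 : measurable_fun setT e2.
Proof. by apply: measurable_fib; [exact: measurableI|exact: measurableD]. Qed.
Let me3 : measurable_fun setT e3.
Proof. by apply: measurable_fib; [exact: measurableD|exact: measurableI]. Qed.
Let mhs : measurable_fun setT hs.
Proof. by apply: measurable_fib; apply: measurableI => //; exact: measurable_strip. Qed.
Let mhi : measurable_fun setT hi.
Proof. by apply: measurable_fib; apply: measurableI => //; exact: measurable_cylinder_inf. Qed.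

Let integralD2 (f g : Tn * Tn -> \bar R) : measurable_fun setT f -> measurable_fun setT g ->
  (forall z, 0 <= f z)%E -> (forall z, 0 <= g z)%E ->
  (\int[leb \x leb]_z (f z + g z) = \int[leb \x leb]_z f z + \int[leb \x leb]_z g z)%E.
Proof.
move=> mf mg f0 g0.
exact: (ge0_integralD (leb \x leb)%E measurableT (fun z _ => f0 z) mf (fun z _ => g0 z) mg).
Qed.

Let total_integral : (Per s E O + PerL s H (Oinf `\` O) =
  \int[leb \x leb]_z (e1 z + e2 z + e3 z + hs z))%E.
Proof.
have f0 A B : forall z, (0 <= fib s A B z)%E by move=> z; exact: fib_ge0.
rewrite /Per /PerL.
rewrite (integralD2 (emeasurable_funD (emeasurable_funD me1 me2) me3) mhs); last 2 first.
- by move=> z; apply: adde_ge0; [apply: adde_ge0; exact: f0|exact: f0].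
- exact: f0.
rewrite (integralD2 (emeasurable_funD me1 me2) me3); last 2 first.
- by move=> z; apply: adde_ge0; exact: f0.
- exact: f0.
rewrite (integralD2 me1 me2); [|exact: f0|exact: f0].
rewrite (interaction_fib _ (measurableI _ _ mE mEO) (measurableI _ _ mEC mEO)).
rewrite (interaction_fib _ (measurableI _ _ mE mEO) (measurableD mEC mEO)).
rewrite (interaction_fib _ (measurableD mE mEO) (measurableI _ _ mEC mEO)).
have mS := measurable_strip M mO.
by rewrite (interaction_fib _ (measurableI _ _ mH mS) (measurableI _ _ mHC mS)).
Qed.

Let FE : Tn * Tn -> \bar R := (fib s E (~` E)) \_ OO.
Let FL : Tn * Tn -> \bar R := (EFin \o cross_lower) \_ OC.
Let FU : Tn * Tn -> \bar R := (EFin \o cross_upper) \_ OC.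

Let mFE : measurable_fun setT FE.
Proof. by apply/(measurable_restrictT _ mOO)/measurable_funTS; exact: measurable_fib. Qed.
Let mFL : measurable_fun setT FL.
Proof. by apply/(measurable_restrictT _ mOC2)/measurable_funTS; exact: mcl. Qed.
Let mFU : measurable_fun setT FU.
Proof. by apply/(measurable_restrictT _ mOC2)/measurable_funTS; exact: mcu. Qed.
Let FE0 z : (0 <= FE z)%E. Proof. by apply: erestrict_ge0 => w _; exact: fib_ge0. Qed.
Let FL0 z : (0 <= FL z)%E. Proof. by apply: erestrict_ge0 => w _; exact: cl0. Qed.
Let FU0 z : (0 <= FU z)%E. Proof. by apply: erestrict_ge0 => w _; exact: cu0. Qed.
Let swapT (z : Tn * Tn) := (z.2, z.1).
Let mswap : measurable_fun setT swapT. Proof. exact: measurable_fun_pair. Qed.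

(** Four cases, according to which of x and y lie in Omega. [FU] is taken at (y, x) because its
    first point is the one in Omega. *)
Let pointwise_total x y : (Omega x -> `|u x| <= M) -> (Omega y -> `|u y| <= M) ->
  (e1 (x, y) + e2 (x, y) + e3 (x, y) + hs (x, y) = FE (x, y) + FL (x, y) + FU (y, x))%E.
Proof.
move=> xM yM.
have [Ox|Ox] := pselect (Omega x); have [Oy|Oy] := pselect (Omega y).
- have -> : FL (x, y) = 0%E by apply: patch_out => -[].
  have -> : FU (y, x) = 0%E by apply: patch_out => -[].
  rewrite !adde0 (_ : FE (x, y) = fib s E (~` E) (x, y)); last by apply: patch_in.
  exact: (fib_inside _ M0 Ox Oy (xM Ox) (yM Oy)).
- have -> : FE (x, y) = 0%E by apply: patch_out => -[].
  have -> : FU (y, x) = 0%E by apply: patch_out => -[].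
  rewrite adde0 add0e (_ : FL (x, y) = (cross_lower (x, y))%:E); last by apply: patch_in.
  apply: (eq_trans (fib_inside_outside n_ge1 s0 Ox Oy (xM Ox))).
  by rewrite /cross_lower (clip_id (xM Ox)).
- have -> : FE (x, y) = 0%E by apply: patch_out => -[].
  have -> : FL (x, y) = 0%E by apply: patch_out => -[].
  rewrite !add0e (_ : FU (y, x) = (cross_upper (y, x))%:E); last by apply: patch_in.
  apply: (eq_trans (fib_outside_inside n_ge1 s0 Ox Oy (yM Oy))).
  by rewrite /cross_upper (clip_id (yM Oy)).
- have -> : FE (x, y) = 0%E by apply: patch_out => -[].
  have -> : FL (x, y) = 0%E by apply: patch_out => -[].
  have -> : FU (y, x) = 0%E by apply: patch_out => -[].
  by rewrite !adde0; exact: fib_outside.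
Qed.

Let negl0 : (leb \x leb)%E.-negligible set0. Proof. exact: negligible_set0. Qed.

Let mRHS : measurable_fun setT (fun z => FE z + FL z + FU (swapT z))%E.
Proof.
exact: (emeasurable_funD (emeasurable_funD mFE mFL) (measurableT_comp mFU mswap)).
Qed.

Let ae_total : (\int[leb \x leb]_z (e1 z + e2 z + e3 z + hs z) =
  \int[leb \x leb]_z (FE z + FL z + FU (swapT z)))%E.
Proof.
have mL := emeasurable_funD (emeasurable_funD (emeasurable_funD me1 me2) me3) mhs.
apply: (eq_integral_pairs uM negl0 mL mRHS) => x y xM yM _.
exact: pointwise_total.
Qed.

Let split_total : (\int[leb \x leb]_z (FE z + FL z + FU (swapT z)) =
  \int[leb \x leb]_z FE z + N_s s M Omega u)%E.
Proof.
have mFUs := measurableT_comp mFU mswap.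
rewrite (integralD2 (emeasurable_funD mFE mFL) mFUs (fun z => adde_ge0 (FE0 z) (FL0 z))
  (fun z => FU0 (swapT z))).
rewrite (integralD2 mFE mFL FE0 FL0) -addeA; apply: (congr1 (adde _)).
apply: (eq_trans (congr1 (adde _) (integral_swap leb mFU FU0))).
apply/esym; apply: (eq_trans N_sE).
apply: (eq_trans (ge0_integralD (leb \x leb)%E mOC2 (fun z _ => cl0 z)
  (measurable_funTS mcl) (fun z _ => cu0 z) (measurable_funTS mcu))).
by apply: (congr2 adde); exact: integral_mkcond.
Qed.

Let FA : Tn * Tn -> \bar R := (EFin \o area_integrand) \_ OO.

Let mFA : measurable_fun setT FA.
Proof.
apply/(measurable_restrictT _ mOO)/measurable_funTS/measurable_EFinP.
exact: measurable_area_integrand.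
Qed.

Let FA0 z : (0 <= FA z)%E.
Proof. by apply: erestrict_ge0 => w _; rewrite lee_fin area_integrand_ge0. Qed.

Let pointwise_sym x y : x <> y ->
  (FE (x, y) + FE (y, x) = (hi (x, y) + FA (x, y)) + (hi (x, y) + FA (x, y)))%E.
Proof.
move=> /eqP xy; rewrite /hi fib_lower_inf.
have [[Ox Oy]|Oxy] := pselect (OO (x, y)); last first.
  have Oyx : ~ OO (y, x) by move=> [Oy Ox]; exact: Oxy.
  by rewrite (patch_out _ Oxy) /FE /FA !(patch_out _ Oxy) (patch_out _ Oyx) !adde0.
have Oyx : OO (y, x) by [].
have Oxy : OO (x, y) by [].
rewrite (patch_in _ Oxy) /FE /FA !(patch_in _ Oxy) (patch_in _ Oyx).
exact: (fib_subgraph_sym u n_ge1 s0 xy).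
Qed.

Let hi0 z : (0 <= hi z)%E. Proof. exact: fib_ge0. Qed.

(** Undoes the symmetrization, infinite values included. *)
Lemma adde_self_inj (a b : \bar R) : (a + a = b + b)%E -> a = b.
Proof.
case: a => [a| |]; case: b => [b| |] //=; rewrite -!EFinD => -[ab]; congr EFin; lra.
Qed.

(** The integrands agree only after adding the value at the swapped pair, so twice each side is
    compared. The diagonal is discarded since the line formulas require |x - y| > 0. *)
Let inside_total : (\int[leb \x leb]_z FE z = PerL s H Oinf + A_s s Omega u)%E.
Proof.
have -> : PerL s H Oinf = (\int[leb \x leb]_z hi z)%E.
  have mI := measurable_cylinder_inf mO.
  exact: (interaction_fib _ (measurableI _ _ mH mI) (measurableI _ _ mHC mI)).
have -> : A_s s Omega u = (\int[leb \x leb]_z FA z)%E.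
  by rewrite A_sE [LHS]integral_mkcond.
rewrite -(integralD2 mhi mFA hi0 FA0); apply: adde_self_inj.
have mhA := emeasurable_funD mhi mFA.
have hA0 z : (0 <= hi z + FA z)%E by apply: adde_ge0; [exact: hi0|exact: FA0].
rewrite -[RHS](integralD2 mhA mhA hA0 hA0) -[X in (_ + X)%E](integral_swap leb mFE FE0).
have mFEs := measurableT_comp mFE mswap.
rewrite -[LHS](integralD2 mFE mFEs FE0 (fun z => FE0 (swapT z))).
have aeT : {ae leb, forall x : Tn, True} by exact: aeW.
apply: (eq_integral_pairs aeT (negligible_diagonal R n_ge1) (emeasurable_funD mFE mFEs)
  (emeasurable_funD mhA mhA)) => x y _ _ xy.
exact: pointwise_sym.
Qed.

(* Nothing is subtracted: this also holds when both sides are infinite. *)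
Lemma perimeter_identity :
  (Per s E O + PerL s H (Oinf `\` O) = PerL s H Oinf + F_s s M Omega u)%E.
Proof. by rewrite total_integral ae_total split_total inside_total -addeA. Qed.

End perimeter_identity.

(** * Boundary layers of Lipschitz domains *)

Section boundary_layer.
Variables (R : realType) (n : nat).
Local Notation leb := (@leb R n).
Local Notation lam := (@lebesgue_measure R).
Local Notation V := 'rV[R]_n.
Implicit Types x y h p e : V.

Lemma measurable_shift d (T : measurableType d) (f g : T -> V) :
  (forall i, measurable_fun [set: T] (fun x : T => f x ord0 i)) ->
  (forall i, measurable_fun [set: T] (fun x : T => g x ord0 i)) ->
  measurable_fun [set: T] (fun x : T => (f x + g x : borelRn R n)).
Proof.
move=> mf mg; apply: measurable_fun_borelRn => // i.
rewrite [X in measurable_fun _ X](_ : _ = fun x : T => f x ord0 i + g x ord0 i).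
  exact: measurable_funD.
by apply/funext => x; rewrite mxE.
Qed.

Lemma dotpDl x y e : dotp (x + y) e = dotp x e + dotp y e.
Proof. by rewrite /dotp -big_split; apply: eq_bigr => i _; rewrite mxE mulrDl. Qed.

Lemma dotpZl a x e : dotp (a *: x) e = a * dotp x e.
Proof. by rewrite /dotp mulr_sumr; apply: eq_bigr => i _; rewrite mxE mulrA. Qed.

Lemma dotpBl x y e : dotp (x - y) e = dotp x e - dotp y e.
Proof. by rewrite dotpDl -scaleN1r dotpZl mulN1r. Qed.

Lemma dotp_unit e : enorm e = 1 -> dotp e e = 1.
Proof.
move=> e1; have e0 : 0 <= dotp e e.
  by apply: sumr_ge0 => i _; rewrite -expr2 sqr_ge0.
by rewrite -(sqr_sqrtr e0) -/(enorm e) e1 expr1n.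
Qed.

Lemma dotp_le x e : enorm e = 1 -> `|dotp x e| <= n%:R * `|x|.
Proof.
move=> e1; apply: (le_trans (ler_norm_sum _ _ _)).
rewrite -[n in n%:R]card_ord -sumr_const mulr_suml.
apply: ler_sum => i _; rewrite normrM mul1r.
rewrite -[leRHS]mulr1 ler_pM ?rV_coord_le//.
by rewrite -e1 rV_coord_le_enorm.
Qed.

Definition boundary_layer (A Omega : set V) h : set V :=
  [set x | A x /\ Omega x /\ ~ Omega (x + h)].

(** Stated through a Borel cover B, so that A need not be measurable and finite unions are
    immediate. The bound rho <= 1 is what the far estimate [far_kernel_le] asks for. *)
Definition thin_layers (Omega A : set V) :=
  exists rho C : R, [/\ 0 < rho <= 1, 0 <= C & forall h, `|h| < rho ->
    exists2 B : set (borelRn R n), measurable B /\ boundary_layer A Omega h `<=` B &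
      (leb (B : set (Rn R n)) <= (C * `|h|)%:E)%E].

Lemma thin_layers_bigU Omega (I : eqType) (l : seq I) (A : I -> set V) :
  (forall i, i \in l -> thin_layers Omega (A i)) ->
  thin_layers Omega (\bigcup_(i in [set` l]) A i).
Proof.
elim: l => [_|i l IH thinA].
  exists 1, 0; split; rewrite ?ltr01 ?lexx// => h _.
  exists set0; last by rewrite measure0 mul0r.
  by split => // x [[i]].
have [|r1 [C1 [r10 C10 h1]]] := IH; first by move=> j jl; apply: thinA; rewrite inE jl orbT.
have [|r2 [C2 [r20 C20 h2]]] := thinA i; first by rewrite inE eqxx.
exists (Num.min r1 r2), (C1 + C2); split.
- case/andP: r10 => r10 r11; case/andP: r20 => r20 r21.
  by rewrite lt_min r10 r20/= ge_min r11.
- exact: addr_ge0.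
move=> h; rewrite lt_min => /andP[/h1[B1 [mB1 sB1] B1h] /h2[B2 [mB2 sB2] B2h]].
exists (B1 `|` B2).
  split; first exact: measurableU.
  move=> x [[j /=]]; rewrite inE => /predU1P[->{j} Aix Ox|jl Ajx Ox]; first by right; apply: sB2.
  by left; apply: sB1; split => //; exists j.
have mB (B : set (borelRn R n)) : measurable B -> measurable (B : set (Rn R n)).
  exact: measurable_borelRn_Rn.
apply: (le_trans (measureU2 leb (mB _ mB1) (mB _ mB2))).
by rewrite mulrDl EFinD leeD.
Qed.

Lemma measurable_boundary_layer (Omega A : set V) h :
  measurable (Omega : set (borelRn R n)) -> measurable (A : set (borelRn R n)) ->
  measurable (boundary_layer A Omega h : set (borelRn R n)).
Proof.
move=> mO mA.
rewrite (_ : boundary_layer A Omega h = A `&` (Omega `&` ~` ((fun x : borelRn R n => ((x : 'rV_n) + h : borelRn R n)) @^-1` Omega))) //.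
apply: measurableI => //; apply: measurableI => //; apply: measurableC.
rewrite -[X in measurable X]setTI.
apply: (measurable_shift (f := fun x : borelRn R n => (x : 'rV_n)) (g := fun=> h)) => // i.
exact: measurable_coord.
Qed.

(* Sliding: if [f (x + t e) = f x + t] and [f] lies in an interval of length
   [delta] on [A], then every line of direction [e] meets the translates
   [A + t e], [0 <= t <= rho], for a set of [t] of measure at most [delta]. *)
Lemma sliding (A : set (borelRn R n)) (f : V -> R) e p (rho delta a : R) :
  measurable A -> 0 < rho -> `|e| <= 1 ->
  (forall x t, f (x + t *: e) = f x + t) ->
  (forall x, A x -> a <= f x <= a + delta) -> (forall x, A x -> `|x - p| <= rho) ->
  0 <= delta ->
  (rho%:E * leb (A : set (Rn R n)) <= (delta * (4 * rho) ^+ n)%:E)%E.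
Proof.
move=> mA rho0 e1 fe fA Ap delta0.
have mAR : measurable (A : set (Rn R n)) by exact: measurable_borelRn_Rn.
pose F (w : measurableTypeR R * Rn R n) : \bar R :=
  (\1_(`[0%R, rho]%classic : set (measurableTypeR R)) w.1 * \1_A ((w.2 : V) + (- w.1) *: e))%:E.
have F0 w : (0 <= F w)%E by rewrite lee_fin mulr_ge0.
have m1A : measurable_fun [set: borelRn R n] (\1_A : _ -> R) by exact: measurable_indic.
have mF : measurable_fun setT F.
  apply/measurable_EFinP; apply: measurable_funM.
    have mi : measurable_fun [set: measurableTypeR R] (\1_(`[0%R, rho]%classic : set (measurableTypeR R)) : _ -> R).
      exact: measurable_indic.
    exact: (measurableT_comp mi measurable_fst).
  apply: (measurableT_comp m1A).
  apply: (measurable_shift (f := fun w : measurableTypeR R * Rn R n => (w.2 : V)) (g := fun w => (- w.1) *: e)) => i.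
    exact: (measurableT_comp (measurable_coord_Rn i) measurable_snd).
  under eq_fun do rewrite mxE.
  by apply: measurable_funM => //; apply: measurableT_comp.
have shiftA (v : V) : (\int[leb]_z (\1_A ((z : V) + v))%:E = leb (A : set (Rn R n)))%E.
  rewrite (@integral_leb_shift R n v (fun z => (\1_A z)%:E)).
  - by rewrite integral_indic// setIT.
  - exact/measurable_EFinP.
  - by move=> z; rewrite lee_fin.
have -> : (rho%:E * leb (A : set (Rn R n)) = \int[lam]_t \int[leb]_z F (t, z))%E.
  transitivity (\int[lam]_(t in `[0%R, rho]) cst (leb (A : set (Rn R n))) t)%E.
    rewrite integral_cst//= lebesgue_measure_itv/= lte_fin rho0 -EFinB subr0.
    by rewrite muleC.
  rewrite integral_mkcond; apply: eq_integral => t _; rewrite patchE.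
  rewrite /F/= indicE; case: ifP => _.
    by rewrite -[LHS](shiftA (- t *: e)); apply: eq_integral => z _; rewrite mul1r.
  by rewrite integral0_eq// => z _; rewrite mul0r.
rewrite (fubini_tonelli F mF F0).
have m1B : measurable_fun [set: Rn R n] (fun z : Rn R n => (\1_(rV_box p (2 * rho) : set (Rn R n)) z : R)%:E).
  have mB := measurable_borelRn_Rn (measurable_rV_box p (2 * rho)).
  exact/measurable_EFinP/measurable_indic.
have rho2 : 0 <= 2 * rho by rewrite mulr_ge0// ltW.
(* A lies within rho of p and slides by at most rho, as |e| <= 1: all translates stay in the box of
   radius 2 rho, of volume (4 rho)^n. *)
apply: (@le_trans _ _ (\int[leb]_z (delta%:E * (\1_(rV_box p (2 * rho) : set (Rn R n)) z)%:E))%E).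
  apply: ge0_le_integralT.
  - exact: (measurable_fun_fubini_tonelli_G _ mF F0).
  - exact: measurable_funeM m1B.
  - by move=> z; apply: integral_ge0 => t _; exact: F0.
  move=> z; have [pz|pz] := pselect (rV_box p (2 * rho) z); last first.
    rewrite indicE memNset// mule0 integral0_eq// => t _.
    rewrite /F/= indicE; have [|_] := boolP (t \in _); last by rewrite mul0r.
    rewrite inE/= in_itv/= => /andP[t0 t1].
    rewrite indicE memNset ?mulr0// => At; apply: pz => i.
    have zp := Ap _ At.
    have -> : (z : V) ord0 i - p ord0 i = ((z : V) + ((- t) *: e) - p) ord0 i + t * e ord0 i.
      by rewrite !mxE; lra.
    rewrite (le_trans (ler_normD _ _))// (_ : 2 * rho = rho + rho); last by lra.
    apply: lerD; first exact: le_trans (rV_coord_le _ _) zp.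
    rewrite normrM ger0_norm// -[leRHS]mulr1 ler_pM//.
    exact: le_trans (rV_coord_le _ _) e1.
  rewrite indicE mem_set// mule1.
  (* If z - t e is in A then f z - t is in [a, a + delta], which leaves an interval of length delta
     for t. *)
  apply: (@le_trans _ _ (\int[lam]_t (\1_(`[f z - a - delta, f z - a]%classic : set (measurableTypeR R)) t)%:E)%E).
    apply: ge0_le_integralT.
    - exact: (measurableT_comp mF (measurable_pair2 z)).
    - exact/measurable_EFinP/measurable_indic.
    - by move=> t; exact: F0.
    move=> t; rewrite lee_fin /F/= !indicE -natrM mulnb ler_nat.
    case: (boolP (_ \in A)); last by rewrite andbF.
    rewrite inE => /fA; rewrite fe => /andP[fa fd].
    have -> : t \in `[f z - a - delta, f z - a]%classic.
      by rewrite inE/= in_itv/=; apply/andP; split; lra.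
    exact: leq_b1.
  rewrite integral_indic// setIT/= lebesgue_measure_itv/= lte_fin.
  by case: ifP => _; rewrite -?EFinB lee_fin; lra.
rewrite ge0_integralZl_EFin// integral_indic//; last first.
  by apply: measurable_borelRn_Rn; exact: measurable_rV_box.
rewrite setIT/= leb_box// -EFinM lee_fin (_ : 4 * rho = 2 * (2 * rho))//; lra.
Qed.

(** Half the radius goes to the point and half to the translation: the layer is empty. *)
Lemma thin_layers_interior (Omega : set V) p : open Omega -> Omega p ->
  exists2 r : R, 0 < r & thin_layers Omega (ball p r).
Proof.
move=> oO Op; have /nbhs_ballP[d /= d0 pd] : nbhs p Omega by exact: open_nbhs_nbhs.
exists (d / 2); first by rewrite divr_gt0.
exists (Num.min 1 (d / 2)), 0; split => //.
  by rewrite lt_min ltr01 divr_gt0//= ge_min lexx.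
move=> h; rewrite lt_min => /andP[_ hd].
exists set0; last by rewrite measure0 mul0r.
split => // x [px [_]]; apply; apply: pd.
move: px; rewrite -!ball_normE /ball_/= => px.
rewrite (_ : p - (x + h) = (p - x) - h); last by rewrite opprD addrA.
by rewrite (le_lt_trans (ler_normB _ _))//; lra.
Qed.

(** The height f above the graph is Lipschitz, grows at unit speed along e, and is negative exactly
    on Omega near p. A point of the layer has f x < 0 <= f (x + h), so f x lies in an interval of
    length K |h|, and sliding applies. *)
Lemma thin_layers_boundary (Omega : set V) p e (r L : R) (phi : V -> R) :
  open Omega -> enorm e = 1 -> 0 < r ->
  (forall x y, dotp x e = 0 -> dotp y e = 0 -> `|phi x - phi y| <= L * enorm (x - y)) ->
  (forall x, enorm (x - p) < r -> (Omega x <-> dotp x e < phi (x - dotp x e *: e))) ->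
  exists2 r : R, 0 < r & thin_layers Omega (ball p r).
Proof.
move=> oO e1 r0 phiL Or.
have ee := dotp_unit e1.
pose f x := dotp x e - phi (x - dotp x e *: e).
have perp x : dotp (x - dotp x e *: e) e = 0 by rewrite dotpBl dotpZl ee mulr1 subrr.
have ne1 : `|e| <= 1 by rewrite -e1 norm_le_enorm.
have ft x t : f (x + t *: e) = f x + t.
  rewrite /f dotpDl dotpZl ee mulr1 scalerDl opprD addrACA subrr addr0; lra.
(* K is a Lipschitz constant of f for the sup norm: n bounds h.e / |h|, and n (1 + n) bounds the
   Euclidean norm of the projection h - (h.e) e. The sign of L is not prescribed, hence [|L|]. *)
pose K : R := n%:R + `|L| * (n%:R * (1 + n%:R)).
have K0 : 0 <= K by rewrite addr_ge0 ?mulr_ge0 ?addr_ge0.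
have fK x h : `|f (x + h) - f x| <= K * `|h|.
  rewrite /f (_ : _ - _ - _ = dotp h e - (phi (x + h - dotp (x + h) e *: e) - phi (x - dotp x e *: e))); last first.
    by rewrite dotpDl; lra.
  rewrite /K mulrDl (le_trans (ler_normB _ _))// lerD ?dotp_le//.
  apply: (le_trans (phiL _ _ (perp _) (perp _))).
  rewrite (_ : _ - _ = h - dotp h e *: e); last first.
    by apply/rowP => i; rewrite dotpDl !mxE; ring.
  apply: (@le_trans _ _ (`|L| * enorm (h - dotp h e *: e))).
    by rewrite ler_wpM2r ?enorm_ge0// ler_norm.
  rewrite -!mulrA ler_wpM2l// (le_trans (enorm_le_norm _))// ler_wpM2l//.
  rewrite (le_trans (ler_normB _ _))// mulrDl mul1r lerD2l normrZ.
  by rewrite -[leRHS]mulr1 ler_pM// dotp_le.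
(* Both x and x + h must fall in the chart: they lie within 2d of p in sup norm, hence at Euclidean
   distance at most 2 n d < 2 (n + 1) d <= r. *)
pose d : R := Num.min 1 (r / (2 * (n%:R + 1))).
have n10 : (0 : R) < n%:R + 1 by rewrite ltr_wpDl.
have d0 : 0 < d by rewrite lt_min ltr01/= divr_gt0// mulr_gt0.
have dr x : `|x - p| <= 2 * d -> enorm (x - p) < r.
  move=> xp; apply: (le_lt_trans (enorm_le_norm _)).
  apply: (@le_lt_trans _ _ (n%:R * (2 * d))); first by rewrite ler_wpM2l.
  apply: (@lt_le_trans _ _ ((n%:R + 1) * (2 * d))); first by rewrite ltr_pM2r ?mulr_gt0// ltrDl.
  apply: (@le_trans _ _ ((n%:R + 1) * (2 * (r / (2 * (n%:R + 1)))))).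
    by rewrite (ler_wpM2l (ltW n10))// ler_wpM2l// ge_min lexx orbT.
  by rewrite le_eqVlt; apply/orP; left; apply/eqP; field; rewrite gt_eqF.
exists d => //.
exists d, (K * (4 * d) ^+ n / d); split.
- by rewrite d0/= ge_min lexx.
- by rewrite divr_ge0 ?mulr_ge0 ?exprn_ge0 ?mulr_ge0// ltW.
move=> h hd.
pose B := boundary_layer (ball p d) Omega h.
have mB : measurable (B : set (borelRn R n)).
  apply: measurable_boundary_layer; apply: open_measurable_borelRn => //.
  exact: ball_open.
exists B; first by split.
have Bx x : B x -> `|x - p| <= d /\ - (K * `|h|) <= f x <= - (K * `|h|) + K * `|h|.
  move=> [px [Ox Oxh]].
  have xp : `|x - p| <= d by move: px; rewrite -ball_normE /ball_/= distrC => /ltW.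
  split => //.
  have fx : f x < 0.
    rewrite /f subr_lt0; apply/(Or x) => //; apply: dr.
    by rewrite (le_trans xp)// ler_peMl ?ler1n// ltW.
  have fxh : 0 <= f (x + h).
    rewrite /f subr_ge0 leNgt; apply/negP => /(Or (x + h)) H; apply: Oxh; apply: H.
    apply: dr; rewrite addrAC (le_trans (ler_normD _ _))// (_ : 2 * d = d + d); last by lra.
    by rewrite lerD// ltW.
  by have := fK x h; rewrite ler_norml => /andP[h1 h2]; apply/andP; split; lra.
have := @sliding B f e p d (K * `|h|) (- (K * `|h|)) mB d0 ne1 ft
  (fun x Hx => (Bx x Hx).2) (fun x Hx => (Bx x Hx).1) (mulr_ge0 K0 (normr_ge0 _)).
move=> H.
have -> : (K * (4 * d) ^+ n / d * `|h|)%:E = ((d^-1)%:E * (K * `|h| * (4 * d) ^+ n)%R%:E)%E.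
  by rewrite -EFinM; congr EFin; ring.
by rewrite lee_pdivlMl.
Qed.

(** Compactness of the closure makes the local estimates, at interior and at boundary points,
    uniform in rho and C. *)
Lemma lipschitz_thin_layers (Omega : set V) :
  bounded_set Omega -> open Omega -> lipschitz_boundary Omega ->
  exists rho C : R, [/\ 0 < rho <= 1, 0 <= C & forall h, `|h| < rho ->
    (leb (boundary_layer setT Omega h : set (Rn R n)) <= (C * `|h|)%:E)%E].
Proof.
move=> bO oO lO.
have cK : compact (closure Omega).
  apply: bounded_closed_compact; last exact: closed_closure.
  case: bO => N [Nr NO]; exists N; split => // N' NN'.
  have cl : closed [set x : V | `|x| <= N'].
    rewrite (_ : mkset _ = (fun x : V => `|x|) @^-1` [set t | t <= N'])//.
    apply: preimage_closed; last exact: closed_le.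
    by move=> x _; exact: norm_continuous.
  move=> x; rewrite closureE => /(_ [set x : V | `|x| <= N']); apply.
  by split => // y Oy; exact: NO.
(* The implication sits under the existential so that choice yields a radius defined on all of
   R^n. *)
have loc p : exists r : R, closure Omega p -> 0 < r /\ thin_layers Omega (ball p r).
  have [cp|ncp] := pselect (closure Omega p); last by exists 0.
  have [Op|nOp] := pselect (Omega p).
    by have [r r0 thr] := thin_layers_interior oO Op; exists r.
  have [|e [r [L [phi [e1 r0 phiL Or]]]]] := lO p.
    by split => // ip; apply: nOp; exact: (interior_subset ip).
  have [d d0 thd] := thin_layers_boundary oO e1 r0 phiL Or.
  by exists d.
have [r rP] := choice loc.
have [D sD cD] : finite_subset_cover (closure Omega) (fun p => ball p (r p)) (closure Omega).
  move: cK; rewrite compact_cover => /(_ _ (closure Omega) (fun p => ball p (r p))).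
  apply.
    by move=> p cp; exact: ball_open.
  by move=> p cp; exists p => //; apply: ballxx; exact: (rP p cp).1.
have /finite_seqP[l Dl] := finite_fset D.
have [|rho [C [rho0 C0 H]]] := @thin_layers_bigU Omega _ l (fun p => ball p (r p)).
  move=> p pl; apply: (rP p _).2.
  have := pl; rewrite -[is_true _]/([set` l] p) -Dl => /sD.
  by rewrite inE.
exists rho, C; split => // h hrho.
have [B [mB sB] Bh] := H _ hrho.
apply: le_trans Bh; apply: le_measure; rewrite ?inE.
- apply: measurable_borelRn_Rn; apply: measurable_boundary_layer => //.
  exact: open_measurable_borelRn.
- exact: measurable_borelRn_Rn.
move=> x [_ Ox]; apply: sB; split => //.
by rewrite -Dl; apply: cD; apply: subset_closure; exact: Ox.1.
Qed.

End boundary_layer.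

(** * Singular kernels *)

Section singular_kernels.
Variables (R : realType) (n : nat).
Hypothesis n_ge1 : (1 <= n)%N.
Local Notation leb := (@leb R n).
Local Notation lam := (@lebesgue_measure R).
Local Notation V := 'rV[R]_n.
Local Notation Tn := (Rn R n).

Let n0 : (0 : R) < n%:R. Proof. by rewrite ltr0n. Qed.

(** Discards the points that share a coordinate with x, where the product bound of the kernel
    fails. *)
Lemma leb_hyperplane (i : 'I_n) (c : R) :
  leb ([set y : V | y ord0 i = c] : set Tn) = 0%E.
Proof.
have mA : measurable ([set y : V | y ord0 i = c] : set Tn).
  rewrite (_ : [set y : V | _] = Defs.coord i @^-1` [set c]); last by [].
  by rewrite -[X in measurable X]setTI; apply: measurable_coord_Rn.
set A := [set y : V | _] in mA *; rewrite -[in LHS](setIT (A : set Tn)).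
rewrite -(@integral_indic _ _ _ leb setT measurableT)//.
pose f (j : 'I_n) : R -> R := if j == i then \1_([set c] : set (measurableTypeR R)) else cst 1.
transitivity (\int[leb]_y (\prod_(j < n) f j ((y : V) ord0 j))%:E)%E.
  apply: eq_integral => y _; congr EFin.
  rewrite (bigD1 i)//= big1 => [|j ji]; last by rewrite /f (negbTE ji).
  by rewrite /f eqxx mulr1 !indicE.
rewrite integral_leb_prod.
- rewrite (bigD1 i)//= /f eqxx integral_indic// setIT/= lebesgue_measure_set1.
  by rewrite mul0e.
- by move=> j; rewrite /f; case: ifP => _; [exact: measurable_indic|exact: measurable_cst].
- by move=> j t; rewrite /f; case: ifP => _ /=.
Qed.

(* The Euclidean norm dominates each coordinate, which bounds a radial kernel by
   a product of functions of one variable. *)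
Lemma prod_powR_le (a : R) (r : R) (h : 'I_n -> R) : 0 <= a ->
  (forall i, 0 < h i <= r) ->
  (r `^ a)^-1 <= \prod_(i < n) h i `^ (- (a / n%:R)).
Proof.
move=> a0 hr; have an0 : 0 <= a / n%:R by rewrite divr_ge0// ltW.
have r0 : 0 < r.
  case/andP: (hr (Ordinal n_ge1)) => h0 hr0; exact: lt_le_trans hr0.
rewrite -powRN (_ : r `^ (- a) = \prod_(i < n) r `^ (- (a / n%:R))).
  apply: ler_prod => i _; rewrite powR_ge0/= !powRN lef_pV2 ?posrE ?powR_gt0//.
    by have /andP[h0 hir] := hr i; rewrite ge0_ler_powR ?nnegrE// ltW.
  by have /andP[] := hr i.
rewrite prodr_const card_ord -powR_mulrn ?powR_ge0// -powRrM; congr (_ `^ _).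
by rewrite mulNr divfK// gt_eqF.
Qed.

Lemma measurable_powRV_enorm d (T : measurableType d) (f : T -> V) a :
  (forall i, measurable_fun [set: T] (fun x : T => f x ord0 i)) ->
  measurable_fun [set: T] (fun x : T => (enorm (f x) `^ a)^-1).
Proof.
move=> mf; rewrite (_ : (fun _ => _) = (fun x => enorm (f x) `^ (- a))); last first.
  by apply/funext => x; rewrite powRN.
exact: (measurableT_comp (measurable_powR _) (measurable_fun_enorm mf)).
Qed.

Let mcoordB (x : V) i : measurable_fun [set: Tn] (fun y : Tn => (x - y) ord0 i).
Proof.
under eq_fun do rewrite !mxE.
exact: (measurable_funB (measurable_cst _) (measurable_coord_Rn i)).
Qed.

Let mkernel (x : V) a : measurable_fun [set: Tn] (fun y : Tn => (enorm (x - y) `^ a)^-1).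
Proof. exact: (measurable_powRV_enorm a (mcoordB x)). Qed.

Definition near_const (a B : R) : \bar R :=
  (\prod_(i < n) \int[lam]_t (trunc_pow (a / n%:R) B t)%:E)%E.

(** The exponent of each one-dimensional factor is a / n, below 1 because a < n. *)
Lemma near_const_lty a B : 0 < a < n%:R -> (near_const a B < +oo)%E.
Proof.
move=> /andP[a0 an]; have an01 : 0 < a / n%:R < 1.
  by rewrite divr_gt0//= ltr_pdivrMr// mul1r.
rewrite /near_const; set I := (integral _ _ _).
have -> : I = (fine I)%:E.
  rewrite fineK// ge0_fin_numE; first exact: integral_trunc_pow_lty.
  by apply: integral_ge0 => t _; rewrite lee_fin trunc_pow_ge0.
by rewrite prodEFin ltry.
Qed.

Lemma near_kernel_le a B (x : V) (D : set Tn) : 0 < a -> measurable D ->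
  (forall y : V, D y -> `|x - y| <= B) ->
  (\int[leb]_(y in D) ((enorm (x - (y : V)) `^ a)^-1)%:E <= near_const a B)%E.
Proof.
move=> a0 mD DB.
pose f (i : 'I_n) t := trunc_pow (a / n%:R) B (x ord0 i - t).
have mf i : measurable_fun setT (f i).
  apply: (measurableT_comp (measurable_trunc_pow _ _)); exact: measurable_funB.
have f0 i t : 0 <= f i t by exact: trunc_pow_ge0.
have -> : near_const a B = (\int[leb]_y (\prod_(i < n) f i ((y : V) ord0 i))%:E)%E.
  rewrite (integral_leb_prod mf f0); apply: eq_bigr => i _; apply/esym.
  apply: (ge0_integral_reflect (x ord0 i) (f := fun t => (trunc_pow (a / n%:R) B t)%:E)).
    by apply/measurable_EFinP; exact: measurable_trunc_pow.
  by move=> t; rewrite lee_fin trunc_pow_ge0.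
pose P (y : borelRn R n) : R := \prod_(i < n) f i ((y : V) ord0 i).
have mP : measurable_fun [set: borelRn R n] P by exact: measurable_fun_prod_coord.
have mprod : measurable_fun [set: Tn] (EFin \o P).
  have mP' := measurable_fun_Rn_borel mP.
  exact: (proj2 (measurable_EFinP [set: Tn] P) mP').
rewrite integral_mkcond; apply: ae_ge0_le_integral => //.
- by move=> y _; apply: erestrict_ge0 => z _; rewrite lee_fin invr_ge0 powR_ge0.
- exact/(measurable_restrictT _ mD)/measurable_funTS/measurable_EFinP.
- by move=> y _; rewrite lee_fin prodr_ge0.
(* Where a coordinate of x - y vanishes, [trunc_pow] is 0 while the kernel may be positive; these
   hyperplanes are removed. *)
have nH : leb.-negligible (\big[setU/set0]_(i < n) ([set y : V | y ord0 i = x ord0 i] : set Tn)).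
  elim/big_ind : _ => [|A1 A2|i _]; [exact: negligible_set0|exact: negligibleU|].
  exists [set y : V | y ord0 i = x ord0 i]; split => //; last exact: leb_hyperplane.
  rewrite (_ : [set y : V | _] = Defs.coord i @^-1` [set x ord0 i]); last by [].
  by rewrite -[X in measurable X]setTI; apply: measurable_coord_Rn.
apply: negligibleS nH => y /= ny; rewrite -bigcup_seq; apply: contrapT => yH; apply: ny => _.
rewrite patchE; case: ifPn => [|_]; last by rewrite lee_fin prodr_ge0.
rewrite inE => Dy; have xyB := DB _ Dy; rewrite lee_fin.
have -> : \prod_(i < n) f i (y ord0 i) = \prod_(i < n) `|x ord0 i - y ord0 i| `^ (- (a / n%:R)).
  apply: eq_bigr => i _; rewrite /f /trunc_pow (_ : (`|_| <= B) = true) ?mul1r//.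
  by apply: le_trans xyB; have := rV_coord_le (x - y) i; rewrite !mxE.
apply: prod_powR_le; first exact: ltW.
move=> i; apply/andP; split; last by have := rV_coord_le_enorm (x - y) i; rewrite !mxE.
rewrite normr_gt0 subr_eq0; apply/eqP => xy; apply: yH; exists i => //=.
by rewrite mem_index_enum.
Qed.

(** Since d <= 1 and |x - y| >= d, each d max(1, |x_i - y_i|) is at most the Euclidean distance. A
    product of Japanese brackets of exponent b thus dominates the kernel of exponent b n. *)
Lemma far_kernel_le b d (x : V) (D : set Tn) : 1 < b -> 0 < d <= 1 -> measurable D ->
  (forall y : V, D y -> d <= `|x - y|) ->
  (\int[leb]_(y in D) ((enorm (x - (y : V)) `^ (b * n%:R))^-1)%:E <=
   \prod_(i < n) ((d `^ (- b))%:E * \int[lam]_t (japanese b t)%:E))%E.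
Proof.
move=> b1 /andP[d0 d1] mD Dd.
pose f (i : 'I_n) t := d `^ (- b) * japanese b (x ord0 i - t).
have mf i : measurable_fun setT (f i).
  apply: measurable_funM => //; apply: (measurableT_comp (measurable_japanese _)).
  exact: measurable_funB.
have f0 i t : 0 <= f i t by rewrite mulr_ge0 ?powR_ge0 ?japanese_ge0.
have mj : measurable_fun setT (fun t => (japanese b t)%:E).
  by apply/measurable_EFinP; exact: measurable_japanese.
have j0 t : (0 <= (japanese b t)%:E)%E by rewrite lee_fin japanese_ge0.
have -> : (\prod_(i < n) ((d `^ (- b))%:E * \int[lam]_t (japanese b t)%:E) =
    \int[leb]_y (\prod_(i < n) f i ((y : V) ord0 i))%:E)%E.
  rewrite (integral_leb_prod mf f0); apply: eq_bigr => i _.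
  rewrite -(ge0_integral_reflect (x ord0 i) mj j0).
  rewrite -(ge0_integralZl_EFin _ measurableT (fun t _ => j0 _) _ (powR_ge0 _ _))//.
  by apply: (measurableT_comp mj); exact: measurable_funB.
pose P (y : borelRn R n) : R := \prod_(i < n) f i ((y : V) ord0 i).
have mP : measurable_fun [set: borelRn R n] P by exact: measurable_fun_prod_coord.
have mprod : measurable_fun [set: Tn] (EFin \o P).
  have mP' := measurable_fun_Rn_borel mP.
  exact: (proj2 (measurable_EFinP [set: Tn] P) mP').
have P0 y : (0 <= (EFin \o P) y)%E by rewrite lee_fin prodr_ge0.
apply: (@le_trans _ _ (\int[leb]_(y in D) (EFin \o P) y)%E); last first.
  by apply: ge0_subset_integral => // y _; exact: P0.
apply: ge0_le_integral => //.
- by move=> y _; rewrite lee_fin invr_ge0 powR_ge0.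
- exact/measurable_funTS/measurable_EFinP.
- exact: measurable_funTS.
move=> y Dy; rewrite lee_fin /P.
have -> : \prod_(i < n) f i ((y : V) ord0 i) =
    \prod_(i < n) (d * Num.max 1 `|x ord0 i - (y : V) ord0 i|) `^ (- (b * n%:R / n%:R)).
  apply: eq_bigr => i _; rewrite /f /japanese mulfK ?gt_eqF//.
  by rewrite powRM// ?ltW// le_max ler01.
apply: prod_powR_le; first by rewrite mulr_ge0// ltW// (lt_trans _ b1).
move=> i; rewrite mulr_gt0 ?lt_max ?ltr01//=.
have xyd := Dd _ Dy.
have xyn : d <= enorm (x - (y : V)) by apply: le_trans xyd _; exact: norm_le_enorm.
have [_|_] := leP 1 `|x ord0 i - (y : V) ord0 i|; last by rewrite mulr1.
have := rV_coord_le_enorm (x - (y : V)) i; rewrite !mxE => h.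
by apply: le_trans h; rewrite ler_piMl.
Qed.

Lemma far_const_lty b d : 1 < b ->
  (\prod_(i < n) ((d `^ (- b))%:E * \int[lam]_t (japanese b t)%:E) < +oo)%E.
Proof.
move=> b1; set I := (integral _ _ _).
have -> : I = (fine I)%:E.
  rewrite fineK// ge0_fin_numE; first exact: integral_japanese_lty.
  by apply: integral_ge0 => t _; rewrite lee_fin japanese_ge0.
by under eq_bigr do rewrite -EFinM; rewrite prodEFin ltry.
Qed.

End singular_kernels.

(** * Integrability of the kernels over pairs of points *)

Section kernel_integrals.
Variables (R : realType) (n : nat).
Hypothesis n_ge1 : (1 <= n)%N.
Local Notation leb := (@leb R n).
Local Notation V := 'rV[R]_n.
Local Notation Tn := (Rn R n).

Lemma integral_sections_le d (T : measurableType d) (mu : {sigma_finite_measure set T -> \bar R})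
    (A : set T) (D : set (T * T)) (F : T * T -> \bar R) (C : \bar R) :
  measurable A -> measurable D -> D `<=` A `*` setT ->
  measurable_fun setT F -> (forall z, 0 <= F z)%E -> (0 <= C)%E ->
  (forall x, A x -> \int[mu]_(y in xsection D x) F (x, y) <= C)%E ->
  (\int[mu \x mu]_(z in D) F z <= C * mu A)%E.
Proof.
move=> mA mD DA mF F0 C0 FC.
have F'0 z : (0 <= (F \_ D) z)%E by exact: erestrict_ge0.
have mF' : measurable_fun setT (F \_ D).
  exact/(measurable_restrictT _ mD)/measurable_funTS.
rewrite integral_mkcond (fubini_tonelli1 _ mF' F'0).
rewrite -(integral_cst mu mA C) [leRHS]integral_mkcond.
apply: ge0_le_integralT.
- exact: measurable_fun_fubini_tonelli_F.
- exact/(measurable_restrictT _ mA)/measurable_cst.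
- by move=> x; apply: integral_ge0 => y _; exact: F'0.
move=> x; rewrite patchE; case: ifPn => xA.
  apply: le_trans (FC x _); last by rewrite inE in xA.
  rewrite [leRHS]integral_mkcond; rewrite le_eqVlt; apply/orP; left; apply/eqP; apply: eq_integral => y _.
  by rewrite !patchE mem_xsection.
rewrite /fubini_F integral0_eq// => y _; rewrite patchE memNset// => /DA[/= Ax _].
by move: xA; rewrite (mem_set Ax).
Qed.

Lemma measurable_kernel a :
  measurable_fun [set: Tn * Tn] (fun z : Tn * Tn => ((enorm ((z.1 : V) - z.2) `^ a)^-1)%:E).
Proof.
apply/measurable_EFinP; rewrite (_ : (fun _ => _) = fun z : Tn * Tn => enorm ((z.1 : V) - z.2) `^ (- a)).
  exact: (measurableT_comp (measurable_powR _) (@measurable_fun_enormB R n)).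
by apply/funext => z; rewrite powRN.
Qed.

Lemma kernel_ge0 a (z : Tn * Tn) : (0 <= ((enorm ((z.1 : V) - z.2) `^ a)^-1)%:E)%E.
Proof. by rewrite lee_fin invr_ge0 powR_ge0. Qed.

Lemma interior_kernel_lty (Omega : set V) a : 0 < a < n%:R ->
  bounded_set Omega -> measurable (Omega : set Tn) ->
  (\int[leb \x leb]_(z in Omega `*` Omega) ((enorm ((z.1 : V) - z.2) `^ a)^-1)%:E < +oo)%E.
Proof.
move=> /andP[a0 an] bO mO.
have [B BO] : exists B, forall x, Omega x -> `|x| <= B.
  by case: bO => N [_ NO]; exists (N + 1) => x Ox; apply: NO => //; rewrite ltrDl.
have C0 : (0 <= near_const n a (B + B))%E.
  by apply: prode_ge0 => i _; apply: integral_ge0 => t _; rewrite lee_fin trunc_pow_ge0.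
have Cf : near_const n a (B + B) \is a fin_num.
  by rewrite ge0_fin_numE// near_const_lty// a0.
have Of : leb (Omega : set Tn) \is a fin_num by rewrite ge0_fin_numE// leb_bounded_lty.
apply: (@le_lt_trans _ _ (near_const n a (B + B) * leb (Omega : set Tn))%E); last first.
  by rewrite -(fineK Cf) -(fineK Of) -EFinM ltry.
apply: (@integral_sections_le _ _ leb Omega (Omega `*` Omega) _ _ mO) => //.
- exact: measurableX.
- by move=> z [].
- exact: measurable_kernel.
- exact: kernel_ge0.
move=> x Ox; apply: near_kernel_le => //.
  exact: (measurable_xsection x (measurableX mO mO)).
move=> y; rewrite /xsection/= inE => -[_ /= Oy].
by apply: (le_trans (ler_normB _ _)); apply: lerD; exact: BO.
Qed.

Section exterior.
Variables (Omega : set V) (s : R).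
Hypotheses (s01 : 0 < s < 1) (bO : bounded_set Omega) (oO : open Omega).
Hypothesis lO : lipschitz_boundary Omega.
Local Notation k := (fun z : Tn * Tn => ((enorm ((z.1 : V) - z.2) `^ (n%:R + s))^-1)%:E).

Let mOb : measurable (Omega : set (borelRn R n)). Proof. exact: open_measurable_borelRn. Qed.

Let mO : measurable (Omega : set Tn). Proof. exact: measurable_borelRn_Rn. Qed.

Let Of : leb (Omega : set Tn) \is a fin_num.
Proof. by rewrite ge0_fin_numE// leb_bounded_lty. Qed.

Let ext : set (Tn * Tn) := Omega `*` ~` Omega.

Let mE : measurable ext.
Proof. by apply: measurableX => //; exact: measurableC. Qed.

Let mdiff : measurable_fun [set: Tn * Tn] (fun z : Tn * Tn => ((z.2 : V) + (- (z.1 : V)) : borelRn R n)).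
Proof.
apply: measurable_shift => i; first exact: (measurableT_comp (measurable_coord_Rn i) measurable_snd).
under eq_fun do rewrite mxE.
exact: (measurableT_comp (@oppr_measurable R setT) (measurableT_comp (measurable_coord_Rn i) measurable_fst)).
Qed.

Let mball rho : measurable ([set h : V | `|h| < rho] : set (borelRn R n)).
Proof.
apply: open_measurable_borelRn; rewrite (_ : [set h : V | _] = (fun h : V => `|h|) @^-1` [set t | t < rho])//.
apply: open_comp; last exact: open_lt.
by move=> x _; exact: norm_continuous.
Qed.

Let near_pairs rho : set (Tn * Tn) := [set z | `|(z.2 : V) - z.1| < rho].

Let mnear rho : measurable (near_pairs rho).
Proof. by rewrite -[X in measurable X]setTI; exact: (mdiff measurableT (mball rho)). Qed.

Let far_lty rho : 0 < rho <= 1 ->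
  (\int[leb \x leb]_(z in ext `\` near_pairs rho) k z < +oo)%E.
Proof.
move=> rho01; have [s0 s1] := andP s01; have n0 : (0 : R) < n%:R by rewrite ltr0n.
(* The exponent n + s is shared equally among the n coordinates, each receiving 1 + s / n > 1. *)
have b1 : 1 < 1 + s / n%:R by rewrite ltrDl divr_gt0.
have bn : (1 + s / n%:R) * n%:R = n%:R + s by rewrite mulrDl mul1r divfK ?gt_eqF.
set C := (\prod_(i < n) ((rho `^ (- (1 + s / n%:R)))%:E *
  \int[@lebesgue_measure R]_t (japanese (1 + s / n%:R) t)%:E))%E.
have C0 : (0 <= C)%E.
  apply: prode_ge0 => i _; apply: mule_ge0; first by rewrite lee_fin powR_ge0.
  by apply: integral_ge0 => t _; rewrite lee_fin japanese_ge0.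
have Cf : C \is a fin_num by rewrite ge0_fin_numE// far_const_lty.
pose D : set (Tn * Tn) := ext `\` near_pairs rho; have mD : measurable D by exact: measurableD.
apply: (@le_lt_trans _ _ (C * leb (Omega : set Tn))%E); last first.
  by rewrite -(fineK Cf) -(fineK Of) -EFinM ltry.
apply: (@integral_sections_le _ _ leb Omega D k C mO mD) => //.
- by move=> z [[]].
- exact: measurable_kernel.
- exact: kernel_ge0.
move=> x Ox; rewrite -bn; apply: far_kernel_le => //.
  exact: (measurable_xsection x mD).
move=> y; rewrite /xsection/= inE => -[_ /= /negP]; rewrite -leNgt.
by rewrite distrC.
Qed.

(* Fubini in the variables x and h = y - x: the layer of points of Omega that
   the translation by h moves out of Omega has measure at most C |h|, which
   lowers the singularity from n + s to n + s - 1. *)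
Let near_lty rho C : 0 < rho ->
  (forall h : V, `|h| < rho -> (leb (boundary_layer setT Omega h : set Tn) <= (C * `|h|)%:E)%E) ->
  (0 <= C) ->
  (\int[leb \x leb]_(z in ext `&` near_pairs rho) k z < +oo)%E.
Proof.
move=> rho0 thin C0; have [s0 s1] := andP s01.
set D : set (Tn * Tn) := _ `&` _; have mD : measurable D by exact: measurableI.
have mF : measurable_fun setT (k \_ D).
  exact: (proj1 (measurable_restrictT _ mD) (measurable_funTS (measurable_kernel (n%:R + s)))).
have F0 z : (0 <= (k \_ D) z)%E by apply: erestrict_ge0 => ? _; exact: kernel_ge0.
rewrite integral_mkcond (fubini_tonelli1 _ mF F0).
pose kk (h : V) : \bar R := ((enorm h `^ (n%:R + s))^-1)%:E.
have kk0 h : (0 <= kk h)%E by rewrite lee_fin invr_ge0 powR_ge0.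
pose D' : set (Tn * Tn) := [set z | boundary_layer setT Omega (z.2 : V) z.1 /\ `|z.2 : V| < rho].
pose G := (fun z : Tn * Tn => kk z.2) \_ D'.
pose B : set Tn := [set h : V | `|h| < rho]; have mB : measurable B by exact: (measurable_borelRn_Rn (mball rho)).
have mkk d (T : measurableType d) (f : T -> V) :
    (forall i, measurable_fun [set: T] (fun x : T => f x ord0 i)) ->
    measurable_fun [set: T] (fun x : T => kk (f x)).
  by move=> mf; apply/measurable_EFinP; exact: measurable_powRV_enorm.
have mD' : measurable D'.
  have -> : D' = (Omega `*` [set h : V | `|h| < rho] : set (Tn * Tn)) `&`
      ~` ((fun z : Tn * Tn => ((z.1 : V) + z.2 : borelRn R n)) @^-1` Omega).
    apply/seteqP; split => -[x h] /=; first by move=> [[_ [Ox nO]] hr].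
    by move=> [[Ox hr] nO]; split.
  apply: measurableI; first exact: measurableX.
  apply: measurableC; rewrite -[X in measurable X]setTI.
  apply: (@measurable_shift R n _ _ (fun z : Tn * Tn => z.1 : V) (fun z => z.2)) => // i.
    exact: (measurableT_comp (measurable_coord_Rn i) measurable_fst).
  exact: (measurableT_comp (measurable_coord_Rn i) measurable_snd).
have G0 z : (0 <= G z)%E by exact: erestrict_ge0.
have mG : measurable_fun setT G.
  apply/(measurable_restrictT _ mD')/measurable_funTS/mkk => i.
  exact: (measurableT_comp (measurable_coord_Rn i) measurable_snd).
have -> : (\int[leb]_x fubini_F leb (k \_ D) x = \int[leb]_x \int[leb]_h G (x, h))%E.
  apply: eq_integral => x _; rewrite /fubini_F.
  have [Ox|nOx] := pselect (Omega x); last first.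
    rewrite !integral0_eq// => y _.
      by apply: patch_out => -[[_ [Ox _]] _].
    by apply: patch_out => -[[Ox _] _].
  (* With x frozen the integrand is Borel in y, as the translation y = x + h requires. *)
  pose Dx : set (borelRn R n) := ~` Omega `&` [set y : V | `|y - x| < rho].
  pose Fx : borelRn R n -> \bar R := (fun y : borelRn R n => kk ((x : V) - y)) \_ Dx.
  have mDx : measurable Dx.
    apply: measurableI; first exact: measurableC.
    rewrite (_ : mkset _ = (fun y : borelRn R n => ((y : V) + (- (x : V)) : borelRn R n)) @^-1` [set h : V | `|h| < rho])//.
    rewrite -[X in measurable X]setTI.
    apply: (@measurable_shift R n _ _ (fun y : borelRn R n => y : V) (fun=> - (x : V))) => // i.
    exact: measurable_coord.
  have mFx : measurable_fun setT Fx.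
    apply/(measurable_restrictT _ mDx)/measurable_funTS/mkk => i.
    under eq_fun do rewrite !mxE.
    exact: (measurable_funB (measurable_cst _) (measurable_coord i)).
  have Fx0 y : (0 <= Fx y)%E by exact: erestrict_ge0.
  transitivity (\int[leb]_y Fx y)%E.
    apply: eq_integral => y _; rewrite !patchE; congr (if _ then _ else _).
    apply/idP/idP; rewrite !inE => -[]; first by move=> [_ /= nO] yx; split.
    by move=> nO yx; split.
  rewrite -(integral_leb_shift (x : V) mFx Fx0); apply: eq_integral => h _.
  rewrite /Fx /G !patchE /= opprD addrCA subrr addr0.
  rewrite (_ : kk (- (h : V)) = kk h); last by rewrite /kk -[in LHS]sub0r enorm_distC subr0.
  congr (if _ then _ else _); apply/idP/idP; rewrite !inE /Dx /D' /=.
    by rewrite addrK => -[nO hr]; split => //; split => //=; rewrite addrC.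
  by rewrite addrK => -[[_ [_ nO]] hr]; split => //=; rewrite addrC.
rewrite (fubini_tonelli _ mG G0).
pose K (h : Tn) : \bar R := (C%:E * ((enorm ((0 : V) - h) `^ (n%:R - 1 + s))^-1)%:E)%E.
have mk0 : measurable_fun [set: Tn] (fun h : Tn => ((enorm ((0 : V) - h) `^ (n%:R - 1 + s))^-1)%:E).
  apply/measurable_EFinP; apply: measurable_powRV_enorm => i.
  under eq_fun do rewrite !mxE.
  exact: (measurable_funB (measurable_cst _) (measurable_coord_Rn i)).
have mK : measurable_fun [set: Tn] K by exact: measurable_funeM.
have a01 : 0 < n%:R - 1 + s < n%:R.
  have : (1 : R) <= n%:R by rewrite ler1n.
  by move: s0 s1; lra.
apply: (@le_lt_trans _ _ (\int[leb]_(h in B) K h)%E); last first.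
  have k00 h : B h -> (0 <= ((enorm ((0 : V) - h) `^ (n%:R - 1 + s))^-1)%:E)%E.
    by move=> _; rewrite lee_fin invr_ge0 powR_ge0.
  rewrite [ltLHS](ge0_integralZl_EFin leb mB k00 (measurable_funTS mk0) C0).
  have : (\int[leb]_(h in B)
      ((enorm ((0 : V) - h) `^ (n%:R - 1 + s))^-1)%:E <= near_const n (n%:R - 1 + s) rho)%E.
    apply: (near_kernel_le n_ge1) => //; first by case/andP: a01.
    by move=> y yr; rewrite sub0r normrN ltW.
  move=> /le_lt_trans /(_ (near_const_lty n_ge1 rho a01)).
  by apply: lte_mul_pinfty; rewrite ?lee_fin.
rewrite (integral_mkcond B K); apply: ge0_le_integralT.
- exact: (measurable_fun_fubini_tonelli_G (m1 := leb) _ mG G0).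
- exact/(measurable_restrictT _ mB)/measurable_funTS.
- by move=> h; apply: integral_ge0 => x _; exact: G0.
move=> h; rewrite patchE; case: ifPn => hB; last first.
  rewrite integral0_eq// => x _; rewrite /G patchE memNset// => -[_ /= hr].
  by move: hB; rewrite notin_setE; apply.
rewrite inE /= in hB.
have -> : (\int[leb]_x G (x, h) = \int[leb]_(x in boundary_layer setT Omega h) cst (kk h) x)%E.
  rewrite [RHS]integral_mkcond; apply: eq_integral => x _; rewrite /G !patchE.
  by congr (if _ then _ else _); apply/idP/idP; rewrite !inE; [case|split].
rewrite integral_cst; last first.
  exact: (measurable_borelRn_Rn (measurable_boundary_layer _ mOb measurableT)).
apply: (le_trans (lee_wpmul2l (kk0 h) (thin _ hB))).
rewrite /K /kk -!EFinM lee_fin sub0r -[enorm (- _)]/(enorm (- (h : V))) -sub0r enorm_distC subr0.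
have [->|h0] := eqVneq (h : V) 0; first by rewrite normr0 !mulr0 mulr_ge0// invr_ge0 powR_ge0.
have eh : 0 < enorm (h : V) by rewrite enorm_gt0.
(* One power of the Euclidean norm is split off to absorb the factor |h| of the layer estimate, the
   sup norm being the smaller of the two. *)
have -> : enorm (h : V) `^ (n%:R + s) = enorm (h : V) `^ (n%:R - 1 + s) * enorm (h : V).
  rewrite -[X in _ * X](powRr1 (ltW eh)) -powRD; last by rewrite (gt_eqF eh) implybT.
  by congr (_ `^ _); lra.
rewrite invfM mulrCA ler_wpM2l// -mulrA ler_piMr ?invr_ge0 ?powR_ge0//.
by rewrite ler_pdivrMl// mulr1 norm_le_enorm.
Qed.

Lemma exterior_kernel_lty :
  (\int[leb \x leb]_(z in Omega `*` ~` Omega) k z < +oo)%E.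
Proof.
have [rho [C [rho01 C0 thin]]] := lipschitz_thin_layers bO oO lO.
have rho0 : 0 < rho by case/andP: rho01.
rewrite -/ext -(setUIDK ext (near_pairs rho)) ge0_integral_setU.
- by rewrite lte_add_pinfty ?far_lty// (near_lty rho0 thin).
- exact: measurableI.
- exact: measurableD.
- exact: (measurable_funTS (measurable_kernel (n%:R + s))).
- by move=> z _; exact: kernel_ge0.
- by apply/disj_setPS => z [[_ ?] []].
Qed.

End exterior.

End kernel_integrals.

(** * Finiteness of the half-space and nonlocal terms *)

Lemma ge0_lty_fin_num (R : realDomainType) (x : \bar R) :
  (0 <= x)%E -> (x < +oo)%E -> x \is a fin_num.
Proof. by move=> x0 xoo; rewrite ge0_fin_numE. Qed.

Lemma integral2_gt0 d (T : measurableType d) (R : realType)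
    (mu : {sigma_finite_measure set T -> \bar R}) (A B : set T) (F : T * T -> \bar R) :
  measurable A -> measurable B -> measurable_fun setT F -> (forall z, 0 <= F z)%E ->
  (forall x y, A x -> B y -> 0 < F (x, y))%E -> (0 < mu A)%E -> (0 < mu B)%E ->
  (0 < \int[mu]_(x in A) \int[mu]_(y in B) F (x, y))%E.
Proof.
move=> mA mB mF F0 FAB A0 B0; rewrite integral_setX//; apply: integral_gt0.
- exact: measurableX.
- exact: measurable_funTS.
- by move=> -[x y] [Ax By]; exact: FAB.
- by rewrite [ltRHS](product_measure1E mu mu mA mB) mule_gt0.
Qed.

(** * The half-space terms and the constant kappa *)

Section lower_halfspace_perimeter.
Variables (R : realType) (n : nat) (s : R) (Omega : set 'rV[R]_n).
Hypotheses (n_ge1 : (1 <= n)%N) (s01 : 0 < s < 1).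
Hypotheses (mO : measurable (Omega : set (Rn R n))).
Local Notation leb := (@leb R n).
Local Notation lam := (@lebesgue_measure R).
Local Notation V := 'rV[R]_n.
Local Notation Tn := (Rn R n).
Local Notation T1 := (Rn R n * measurableTypeR R)%type.
Local Notation H := (@lower_halfspace R n).
Local Notation Oinf := (cylinder_inf Omega).

Let s0 : 0 < s. Proof. by case/andP: s01. Qed.

Let a01 : 0 < n%:R - 1 + s < n%:R.
Proof.
have : (1 : R) <= n%:R by rewrite ler1n.
by case/andP: s01 => ? ?; lra.
Qed.

Let mH : measurable H. Proof. exact: measurable_lower_halfspace. Qed.

Let mHC : measurable (~` H). Proof. exact: measurableC. Qed.

Lemma fib_le_setU (A1 A2 B1 B2 : set T1) z :
  measurable A1 -> measurable A2 -> measurable B1 -> measurable B2 ->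
  [disjoint A1 & A2] -> [disjoint B1 & B2] ->
  (fib s A1 B1 z + fib s A2 B2 z <= fib s (A1 `|` A2) (B1 `|` B2) z)%E.
Proof.
case: z => x y mA1 mA2 mB1 mB2 A12 B12; rewrite !fibE.
have xU (A B : set T1) w : xsection (A `|` B) w = xsection A w `|` xsection B w.
  by rewrite !xsectionE.
rewrite !xU.
have disj (A B : set T1) w : [disjoint A & B] -> [disjoint xsection A w & xsection B w].
  by move=> /disj_setPS AB; apply/disj_setPS => t; rewrite !xsectionE => /AB.
have mx (A : set T1) w := @xsection_measurable R n A w.
rewrite line_interactionUl; [|exact: mx|exact: mx| |exact: disj]; last by apply: measurableU; exact: mx.
rewrite !line_interactionUr; [|by [exact: mx|exact: disj]..].
by apply: leeD; [apply: leeDl|apply: leeDr]; exact: line_interaction_ge0.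
Qed.

(** The two cross interactions are dropped. Applied to the strip and the cylinder, this bounds the
    strip term by the perimeter in Omega^oo and [kappa] from below by the perimeter in Omega^M. *)
Lemma interaction_le_setU (A1 A2 B1 B2 : set T1) :
  measurable A1 -> measurable A2 -> measurable B1 -> measurable B2 ->
  [disjoint A1 & A2] -> [disjoint B1 & B2] ->
  (interaction s A1 B1 + interaction s A2 B2 <= interaction s (A1 `|` A2) (B1 `|` B2))%E.
Proof.
move=> mA1 mA2 mB1 mB2 A12 B12.
have mA := measurableU _ _ mA1 mA2; have mB := measurableU _ _ mB1 mB2.
rewrite (interaction_fib _ mA1 mB1) (interaction_fib _ mA2 mB2) (interaction_fib _ mA mB).
rewrite -(ge0_integralD (leb \x leb)%E measurableT (fun z _ => fib_ge0 s A1 B1 z)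
  (measurable_fib _ mA1 mB1) (fun z _ => fib_ge0 s A2 B2 z) (measurable_fib _ mA2 mB2)).
apply: ge0_le_integralT.
- exact: (emeasurable_funD (measurable_fib s mA1 mB1) (measurable_fib s mA2 mB2)).
- exact: measurable_fib.
- by move=> z; rewrite adde_ge0// fib_ge0.
- by move=> z; exact: fib_le_setU.
Qed.

Lemma interaction_ge0 (A B : set T1) : (0 <= interaction s A B)%E.
Proof.
by apply: integral_ge0 => X _; apply: integral_ge0 => Y _; rewrite lee_fin invr_ge0 powR_ge0.
Qed.

(** Positivity of the kernel comes from t != v and not from r, so pairs with x = y are covered. *)
Lemma line_interaction_gt0 r (S W : set (measurableTypeR R)) :
  measurable S -> measurable W -> (forall t v, S t -> W v -> t != v) ->
  (0 < lam S)%E -> (0 < lam W)%E -> (0 < line_interaction n s r S W)%E.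
Proof.
move=> mS mW SW S0 W0.
pose k (z : measurableTypeR R * measurableTypeR R) := (kern n s r (z.1 - z.2))%:E.
have mk : measurable_fun setT k.
  apply/measurable_EFinP; apply: measurable_kern; first exact: measurable_cst.
  exact: (measurable_funB measurable_fst measurable_snd).
have k0 z : (0 <= k z)%E by rewrite lee_fin kern_ge0.
have -> : line_interaction n s r S W = (\int[lam]_(t in S) \int[lam]_(v in W) k (t, v))%E.
  rewrite [RHS]integral_mkcond; apply: eq_integral => t _; rewrite patchE.
  case: ifPn => tS; last first.
    by apply: integral0_eq => v _; rewrite indicE (negbTE tS) !mul0r.
  rewrite [RHS]integral_mkcond; apply: eq_integral => v _; rewrite patchE !indicE tS mul1r.
  by case: ifPn => vW; rewrite ?mul1r ?mul0r.
apply: (integral2_gt0 mS mW mk k0) => // t v St Wv.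
rewrite lte_fin invr_gt0 powR_gt0// sqrtr_gt0 ltr_wpDl ?sqr_ge0//.
by rewrite exprn_even_gt0//= subr_eq0 SW.
Qed.

Lemma PerL_lower_lty : bounded_set Omega -> (PerL s H Oinf < +oo)%E.
Proof.
move=> bO.
have mI := measurable_cylinder_inf mO.
have mHI := measurableI _ _ mH mI; have mHCI := measurableI _ _ mHC mI.
pose OO : set (Tn * Tn) := Omega `*` Omega.
have mOO : measurable OO by exact: measurableX.
pose k (z : Tn * Tn) : \bar R := ((enorm ((z.1 : V) - z.2) `^ (n%:R - 1 + s))^-1)%:E.
have mk : measurable_fun setT k by exact: measurable_kernel.
have k0 z : (0 <= k z)%E by exact: kernel_ge0.
have P0 : (0 <= Phi_s n s 0)%E by exact: Phi_s_ge0.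
have Pf : Phi_s n s 0 = (fine (Phi_s n s 0))%:E.
  by rewrite fineK// ge0_fin_numE// Phi_s0_lty.
rewrite /PerL (interaction_fib _ mHI mHCI).
have -> : (\int[leb \x leb]_z fib s (H `&` Oinf) (~` H `&` Oinf) z =
    \int[leb \x leb]_z ((fun z => (fine (Phi_s n s 0))%:E * k z) \_ OO) z)%E.
  apply: (@eq_integral_pairs _ _ _ leb setT _ _ _ _ (negligible_diagonal R n_ge1)).
  - by apply: aeW.
  - exact: measurable_fib.
  - apply/(measurable_restrictT _ mOO)/measurable_funTS.
    exact: measurable_funeM.
  move=> x y _ _ /eqP xy; rewrite fib_lower_inf !patchE; case: ifP => // _.
  by rewrite (fib_lower n_ge1 s0 xy) -Pf muleC.
rewrite -integral_mkcond.
rewrite [ltLHS](ge0_integralZl_EFin _ mOO (fun z _ => k0 z) (measurable_funTS mk) (fine_ge0 P0)).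
have : (\int[leb \x leb]_(z in OO) k z < +oo)%E by exact: interior_kernel_lty.
by apply: lte_mul_pinfty; rewrite ?lee_fin ?fine_ge0.
Qed.

Variable M : R.
Hypothesis M0 : 0 < M.
Local Notation O := (cylinder Omega M).

Let lower_split : (PerL s H (Oinf `\` O) + PerL s H O <= PerL s H Oinf)%E.
Proof.
have mI := measurable_cylinder_inf mO; have mC := measurable_cylinder M mO.
have mS := measurable_strip M mO.
have OI : O `<=` Oinf by move=> X [OX _]; split.
have E (A : set T1) : A `&` Oinf = (A `&` (Oinf `\` O)) `|` (A `&` O).
  by rewrite -setIUr setUC setDUK.
have disj (A : set T1) : [disjoint A `&` (Oinf `\` O) & A `&` O].
  by apply/disj_setPS => X [[_ [_ ?]] []].
rewrite /PerL (E H) (E (~` H)); apply: interaction_le_setU => //; exact: measurableI.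
Qed.

Lemma PerL_lower_strip_lty : bounded_set Omega -> (PerL s H (Oinf `\` O) < +oo)%E.
Proof.
move=> bO; apply: le_lt_trans (PerL_lower_lty bO); apply: le_trans lower_split.
exact/leeDl/interaction_ge0.
Qed.

Lemma kappa_fin_num : bounded_set Omega -> kappa s Omega M \is a fin_num.
Proof.
move=> bO; rewrite /kappa fin_numB; apply/andP; split.
  exact: (ge0_lty_fin_num (interaction_ge0 _ _) (PerL_lower_lty bO)).
exact: (ge0_lty_fin_num (interaction_ge0 _ _) (PerL_lower_strip_lty bO)).
Qed.

(** By superadditivity it suffices that the half-space has positive perimeter in Omega^M: over each
    pair of points of Omega the sections ]-M, 0[ and [0, M[ have positive length, and a nonempty
    open set has positive measure. *)
Lemma kappa_gt0 : bounded_set Omega -> open Omega -> Omega !=set0 -> (0 < kappa s Omega M)%E.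
Proof.
move=> bO oO O0.
have mC := measurable_cylinder M mO.
have fP : PerL s H (Oinf `\` O) \is a fin_num.
  exact: (ge0_lty_fin_num (interaction_ge0 _ _) (PerL_lower_strip_lty bO)).
have leb0 : (0 < leb (Omega : set Tn))%E by exact: leb_open_gt0.
have P0 : (0 < PerL s H O)%E.
  have mHO := measurableI _ _ mH mC; have mHCO := measurableI _ _ mHC mC.
  pose OO : set (Tn * Tn) := Omega `*` Omega.
  have mOO : measurable OO by exact: measurableX.
  rewrite /PerL (interaction_fib _ mHO mHCO).
  have mF := measurable_fib s mHO mHCO.
  apply: (@lt_le_trans _ _ (\int[leb \x leb]_(z in OO) fib s (H `&` O) (~` H `&` O) z)%E); last first.
    by apply: ge0_subset_integral => // z _; exact: fib_ge0.
  apply: (integral_gt0 mOO (measurable_funTS mF)); last first.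
    by rewrite [ltRHS](product_measure1E leb leb mO mO) mule_gt0.
  move=> -[x y] [Ox Oy]; rewrite fibE !xsectionI_cylinder// xsection_lower xsection_lowerC.
  have itv (a b : R) (S : set (measurableTypeR R)) : a < b -> measurable S ->
      `]a, b[%classic `<=` S -> (0 < lam S)%E.
    move=> ab mS abS; apply: (@lt_le_trans _ _ (lam `]a, b[%classic)).
      by rewrite lebesgue_measure_itv/= lte_fin ab -EFinB lte_fin subr_gt0.
    by apply: le_measure; rewrite ?inE//; exact: measurable_itv.
  have mSP (a b : itv_bound R) : measurable ([set` Interval a b] `&` `](- M), M[%classic : set (measurableTypeR R)).
    by apply: measurableI; exact: measurable_itv.
  apply: line_interaction_gt0.
  - exact: mSP.
  - exact: mSP.
  - move=> t v [t0 _] [v0 _]; apply/eqP => tv; move: t0 v0; rewrite tv /= !in_itv/= andbT.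
    by move=> v0; rewrite leNgt v0.
  - apply: (itv (- M) 0); [by rewrite oppr_lt0|exact: mSP|].
    by move=> t; rewrite /= !in_itv/= => /andP[-> t0]; rewrite t0 (lt_trans t0).
  - apply: (itv 0 M); [exact: M0|exact: mSP|].
    move=> t; rewrite /= !in_itv/= andbT => /andP[t0 ->]; rewrite ltW//.
    by rewrite (lt_trans _ t0)// oppr_lt0.
rewrite /kappa sube_gt0; apply: lt_le_trans lower_split.
by rewrite lteDl.
Qed.

End lower_halfspace_perimeter.

(** * Finiteness of the nonlocal term and comparison with the Gagliardo seminorm *)

Section graph_energy.
Variables (R : realType) (n : nat) (s : R) (Omega : set 'rV[R]_n) (u : 'rV[R]_n -> R) (M : R).
Hypotheses (n_ge1 : (1 <= n)%N) (s01 : 0 < s < 1) (M0 : 0 < M).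
Hypotheses (bO : bounded_set Omega) (mO : measurable (Omega : set (Rn R n))).
Hypothesis mu : measurable_fun [set: Rn R n] u.
Local Notation leb := (@leb R n).
Local Notation lam := (@lebesgue_measure R).
Local Notation V := 'rV[R]_n.
Local Notation Tn := (Rn R n).
Local Notation q := (n%:R - 1 + s).
Local Notation C := (mass_g_s n s).

Let s0 : 0 < s. Proof. by case/andP: s01. Qed.

Let q0n : 0 < q < n%:R.
Proof.
have : (1 : R) <= n%:R by rewrite ler1n.
by case/andP: s01 => ? ?; lra.
Qed.

Lemma oint_le (f : R -> R) (B a b : R) : measurable_fun setT f ->
  (forall t, 0 <= f t <= B) -> a <= b -> oint a b f <= B * (b - a).
Proof.
move=> mf fB ab; rewrite -lee_fin (EFin_oint mf fB ab).
have mab : measurable (`[a, b]%classic : set (measurableTypeR R)) by exact: measurable_itv.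
apply: (@le_trans _ _ (\int[lam]_(t in `[a, b]) (cst B%:E t))%E).
  apply: ge0_le_integral => //.
  - by move=> t _; rewrite lee_fin; case/andP: (fB t).
  - exact/measurable_funTS/measurable_EFinP.
  - by move=> t _; rewrite lee_fin; case/andP: (fB t).
rewrite integral_cst//= lebesgue_measure_itv/= lte_fin.
have B0 : 0 <= B by have /andP[f0 fB'] := fB 0; exact: le_trans fB'.
case: ifP => _; first by rewrite -EFinD -EFinM.
by rewrite mule0 lee_fin mulr_ge0// subr_ge0.
Qed.

Lemma powR_succ (r : R) : 0 <= r -> r `^ (n%:R + s) = r * r `^ q.
Proof.
move=> r0; rewrite -{2}(powRr1 r0) -powRD.
  by congr (_ `^ _); lra.
by apply/implyP => /eqP; case/andP: q0n; lra.
Qed.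

(** Both integrands are at most the mass of [g_s], and the two intervals together have length 2M /
    r. *)
Lemma cross_le (z : Tn * Tn) :
  cross_lower s u M z + cross_upper s u M z <=
  C * (2 * M) * (enorm ((z.1 : V) - z.2) `^ (n%:R + s))^-1.
Proof.
rewrite /cross_lower /cross_upper; set r := enorm _; set c := clip u M _; set v := u _.
have r0 : 0 <= r by exact: enorm_ge0.
have /andP[Mc cM] : - M <= c <= M by exact: clip_itv.
have rV0 : 0 <= r^-1 by rewrite invr_ge0.
have mG := measurable_barG_s n_ge1 s0.
have GC t : 0 <= @barG_s R n s t <= C by rewrite barG_s_ge0// barG_s_le.
have dl a b : a <= b -> (a - v) / r <= (b - v) / r by move=> ab; rewrite ler_wpM2r// lerD2r.
have h1 := oint_le mG GC (dl _ _ Mc).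
have h2 : oint ((c - v) / r) ((M - v) / r) (fun t => @barG_s R n s (- t)) <=
    C * ((M - v) / r - (c - v) / r).
  by apply: oint_le (dl _ _ cM) => //; exact: (measurableT_comp mG).
rewrite -mulrDl (powR_succ r0) invfM mulrA ler_wpM2r ?invr_ge0 ?powR_ge0//.
apply: (le_trans (lerD h1 h2)); rewrite -mulrDr -mulrA ler_wpM2l ?mass_g_s_ge0//.
by rewrite [leLHS](_ : _ = 2 * M / r)//; ring.
Qed.

Lemma cross_integral_lty : open Omega -> lipschitz_boundary Omega ->
  (\int[leb \x leb]_(z in Omega `*` ~` Omega)
     ((cross_lower s u M z)%:E + (cross_upper s u M z)%:E) < +oo)%E.
Proof.
move=> oO lO; pose E : set (Tn * Tn) := Omega `*` ~` Omega.
have mE : measurable E by apply: measurableX => //; exact: measurableC.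
pose k (z : Tn * Tn) : \bar R := ((enorm ((z.1 : V) - z.2) `^ (n%:R + s))^-1)%:E.
have mk : measurable_fun setT k by exact: measurable_kernel.
have k0 z : (0 <= k z)%E by exact: kernel_ge0.
have B0 : 0 <= C * (2 * M) by rewrite !mulr_ge0 ?mass_g_s_ge0// ltW.
have mcl : measurable_fun setT (EFin \o cross_lower s u M).
  by apply/measurable_EFinP; exact: measurable_cross_lower.
have mcu : measurable_fun setT (EFin \o cross_upper s u M).
  by apply/measurable_EFinP; exact: measurable_cross_upper.
apply: (@le_lt_trans _ _ (\int[leb \x leb]_(z in E) ((C * (2 * M))%:E * k z))%E).
  apply: ge0_le_integral.
  - exact: mE.
  - by move=> z _; rewrite adde_ge0// lee_fin; [exact: cross_lower_ge0|exact: cross_upper_ge0].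
  - exact: (measurable_funTS (emeasurable_funD mcl mcu)).
  - exact: (measurable_funTS (measurable_funeM _ mk)).
  - by move=> z _; rewrite -EFinD lee_fin; exact: cross_le.
rewrite [ltLHS](ge0_integralZl_EFin _ mE (fun z _ => k0 z) (measurable_funTS mk) B0).
have : (\int[leb \x leb]_(z in E) k z < +oo)%E by exact: exterior_kernel_lty.
by apply: lte_mul_pinfty; rewrite ?lee_fin.
Qed.

Definition gagliardo (z : Tn * Tn) : R :=
  `|u z.1 - u z.2| / enorm ((z.1 : V) - z.2) `^ (n%:R + s).

Lemma gagliardo_ge0 z : 0 <= gagliardo z.
Proof. by rewrite mulr_ge0// invr_ge0 powR_ge0. Qed.

Lemma measurable_gagliardo : measurable_fun setT gagliardo.
Proof.
apply: measurable_funM; last by apply/measurable_EFinP; exact: measurable_kernel.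
apply: measurableT_comp => //; apply: measurable_funB.
  exact: (measurableT_comp mu measurable_fst).
exact: (measurableT_comp mu measurable_snd).
Qed.

Lemma gagliardoE z : gagliardo z =
  `|(u z.1 - u z.2) / enorm ((z.1 : V) - z.2)| / enorm ((z.1 : V) - z.2) `^ q.
Proof.
have r0 := enorm_ge0 ((z.1 : V) - z.2).
by rewrite /gagliardo (powR_succ r0) invfM mulrA normrM (ger0_norm (_ : 0 <= _^-1)) ?invr_ge0.
Qed.

Lemma area_integrand_le z : area_integrand s u z <= C * gagliardo z.
Proof.
rewrite gagliardoE mulrA ler_wpM2r ?invr_ge0 ?powR_ge0//.
exact: calG_s_le.
Qed.

(** The additive 1 of [norm_le_calG_s] costs a kernel of exponent n - 1 + s, integrable on Omega x
    Omega. *)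
Lemma gagliardo_le z : gagliardo z <=
  (half_mass n s 1)^-1 * area_integrand s u z + (enorm ((z.1 : V) - z.2) `^ q)^-1.
Proof.
rewrite gagliardoE /area_integrand; set w := (_ - _) / _; set k := (_ `^ _)^-1.
rewrite (_ : _ + k = (calG_s n s w / half_mass n s 1 + 1) * k); last by ring.
by rewrite ler_wpM2r ?norm_le_calG_s// invr_ge0 powR_ge0.
Qed.

Let OO : set (Tn * Tn) := Omega `*` Omega.

Let mOO : measurable OO. Proof. exact: measurableX. Qed.

Let mgag : measurable_fun setT (EFin \o gagliardo).
Proof. by apply/measurable_EFinP; exact: measurable_gagliardo. Qed.

Let marea : measurable_fun setT (EFin \o area_integrand s u).
Proof. by apply/measurable_EFinP; exact: measurable_area_integrand. Qed.

Let gag0 z : (0 <= (EFin \o gagliardo) z)%E. Proof. by rewrite lee_fin gagliardo_ge0. Qed.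

Let area0 z : (0 <= (EFin \o area_integrand s u) z)%E.
Proof. by rewrite lee_fin area_integrand_ge0. Qed.

Lemma area_lty_gagliardo :
  (\int[leb \x leb]_(z in OO) (gagliardo z)%:E < +oo)%E <-> (A_s s Omega u < +oo)%E.
Proof.
have hV : 0 <= (half_mass n s 1)^-1 by rewrite invr_ge0 half_mass_ge0.
rewrite (A_sE n_ge1 s0 mO mu); split => h.
  apply: (@le_lt_trans _ _ (\int[leb \x leb]_(z in OO) (C%:E * (EFin \o gagliardo) z))%E).
    apply: ge0_le_integral.
    - exact: mOO.
    - by move=> z _; exact: area0.
    - exact: (measurable_funTS marea).
    - exact: (measurable_funTS (measurable_funeM _ mgag)).
    - by move=> z _; rewrite lee_fin; exact: area_integrand_le.
  have C0 := mass_g_s_ge0 n_ge1 s0.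
  rewrite [ltLHS](ge0_integralZl_EFin _ mOO (fun z _ => gag0 z) (measurable_funTS mgag) C0).
  by move: h; apply: lte_mul_pinfty; rewrite ?lee_fin.
pose k (z : Tn * Tn) : \bar R := ((enorm ((z.1 : V) - z.2) `^ q)^-1)%:E.
have mk : measurable_fun setT k by exact: measurable_kernel.
have k0 z : (0 <= k z)%E by exact: kernel_ge0.
have klty : (\int[leb \x leb]_(z in OO) k z < +oo)%E by exact: interior_kernel_lty.
pose ha z := ((half_mass n s 1)^-1%:E * (EFin \o area_integrand s u) z)%E.
have ha0 z : (0 <= ha z)%E by rewrite mule_ge0// lee_fin.
have mha : measurable_fun setT ha by exact: measurable_funeM.
apply: (@le_lt_trans _ _ (\int[leb \x leb]_(z in OO) (ha z + k z))%E).
  apply: ge0_le_integral.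
    - exact: mOO.
  - by move=> z _; exact: gag0.
  - exact: (measurable_funTS mgag).
  - exact: (measurable_funTS (emeasurable_funD mha mk)).
  - by move=> z _; rewrite /ha /k -EFinM -EFinD lee_fin; exact: gagliardo_le.
rewrite [ltLHS](ge0_integralD _ mOO (fun z _ => ha0 z) (measurable_funTS mha)
  (fun z _ => k0 z) (measurable_funTS mk)).
apply: lte_add_pinfty; last exact: klty.
rewrite [ltLHS](ge0_integralZl_EFin _ mOO (fun z _ => area0 z) (measurable_funTS marea) hV).
by move: h; apply: lte_mul_pinfty; rewrite ?lee_fin.
Qed.

(** The L^1 half of [Ws1] comes for free: u is bounded on a set of finite measure. *)
Lemma Ws1_area : {ae leb, forall x, Omega x -> `|u x| <= M} ->
  Ws1 s Omega u <-> (A_s s Omega u < +oo)%E.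
Proof.
move=> uM; rewrite -area_lty_gagliardo.
have -> : (\int[leb \x leb]_(z in OO) (gagliardo z)%:E =
    \int[leb]_(x in Omega) \int[leb]_(y in Omega) (gagliardo (x, y))%:E)%E.
  by rewrite -(integral_setX leb mO mO mgag gag0).
split => [[]//|h]; split => //.
have mu' : measurable_fun (Omega : set Tn) (EFin \o u).
  by apply: measurable_funTS; apply/measurable_EFinP.
apply/integrableP; split => //.
apply: (@le_lt_trans _ _ (\int[leb]_(x in Omega) cst M%:E x)%E).
  apply: ae_ge0_le_integral.
  - exact: mO.
  - by move=> x _; exact: abse_ge0.
  - exact: (measurableT_comp (@abse_measurable R setT) mu').
  - by move=> x _; rewrite lee_fin ltW.
  - exact: measurable_cst.
  - by case: uM => N [mN N0 NP]; exists N; split => // x hx; apply: NP => uxM; apply: hx.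
rewrite integral_cst//.
have := leb_bounded_lty mO bO.
by apply: lte_mul_pinfty; rewrite ?lee_fin// ltW.
Qed.

End graph_energy.

Lemma Linfty_norm_le (R : realType) (n : nat) (Omega : set 'rV[R]_n) (u : 'rV[R]_n -> R) (M : R) :
  (Linfty_norm Omega u <= M%:E)%E -> {ae @leb R n, forall x, Omega x -> `|u x| <= M}.
Proof.
rewrite /Linfty_norm unlock; case: ifPn => [_ /ess_supP|].
  move=> [N [mN N0 NP]]; exists N; split => // x hx; apply: NP => /= uM; apply: hx => Ox.
  by move: uM; rewrite patchE mem_set//= lee_fin.
(* If the whole space is null, it serves as the exceptional set. *)
rewrite -leNgt => T0 _; exists setT; split => //.
by apply/eqP; rewrite eq_le measure_ge0 andbT.
Qed.

(** The half-space terms a and b are subtracted only here, once known to be finite; p and f may be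
    infinite. *)
Lemma adde_shift (R : realDomainType) (p a b f : \bar R) :
  a \is a fin_num -> b \is a fin_num -> (p + b = a + f)%E -> (p = f + (a - b))%E.
Proof.
move=> af bf; rewrite -(fineK af) -(fineK bf).
case: p => [p| |]; case: f => [f| |] //=; rewrite -!EFinD => -[pf].
by congr EFin; lra.
Qed.

Unset Implicit Arguments.

Theorem proposition2p12 (R : realType) (n : nat) (s : R)
  (Omega : set 'rV[R]_n) (u : 'rV[R]_n -> R) (M : R)
  (n_ge1 : (1 <= n)%N) (s01 : 0 < s < 1)
  (Omega_bounded : bounded_set Omega) (Omega_open : open Omega)
  (Omega_lip : lipschitz_boundary Omega)
  (u_meas : measurable_fun [set: Rn R n] u)
  (u_Linfty : Linfty Omega u)
  (M_gt0 : 0 < M) (M_ge : (Linfty_norm Omega u <= M%:E)%E) :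
  [/\ Ws1 s Omega u <-> (Per s (subgraph u) (cylinder Omega M) < +oo)%E,
      Per s (subgraph u) (cylinder Omega M)
        = (F_s s M Omega u + kappa s Omega M)%E,
      kappa s Omega M \is a fin_num &
      Omega !=set0 -> (0 < kappa s Omega M)%E].
Proof.
have [s0 s1] := andP s01.
have mO : measurable (Omega : set (Rn R n)).
  exact: (measurable_borelRn_Rn (open_measurable_borelRn Omega_open)).
have uM := Linfty_norm_le M_ge.
have kf := kappa_fin_num n_ge1 s01 mO M Omega_bounded.
have PerE : (Per s (subgraph u) (cylinder Omega M) = F_s s M Omega u + kappa s Omega M)%E.
  apply: (adde_shift _ _ (perimeter_identity n_ge1 s0 M_gt0 mO u_meas uM)).
    exact: (ge0_lty_fin_num (interaction_ge0 _ _ _) (PerL_lower_lty n_ge1 s01 mO Omega_bounded)).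
  exact: (ge0_lty_fin_num (interaction_ge0 _ _ _) (PerL_lower_strip_lty n_ge1 s01 mO M Omega_bounded)).
split => //; last exact: kappa_gt0.
have Nlty : (N_s s M Omega u < +oo)%E.
  rewrite (N_sE n_ge1 s0 M_gt0 mO u_meas uM); exact: cross_integral_lty.
have N0 : (0 <= N_s s M Omega u)%E.
  rewrite (N_sE n_ge1 s0 M_gt0 mO u_meas uM); apply: integral_ge0 => z _.
  by rewrite adde_ge0// lee_fin; [exact: cross_lower_ge0|exact: cross_upper_ge0].
rewrite (Ws1_area n_ge1 s01 M_gt0 Omega_bounded mO u_meas uM) PerE /F_s.
(* With [N_s] and [kappa] finite, the perimeter is finite exactly when [A_s] is. *)
have Nf := ge0_lty_fin_num N0 Nlty.
rewrite -(fineK Nf) -(fineK kf).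
by case: (A_s s Omega u) => [a| |] /=; rewrite -?EFinD ?ltry.
Qed.
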